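(* Let $A$ and $\lambda_0>0$ satisfy Assumption (A1) (stated in the context), and let $L$ and $I(\lambda)$ be the operator and the action integral defined in the context. (i) If $A(\alpha_0)=A(\beta_0)$, then there exist positive constants $\delta$ and $h_0$ and a function $r_+(\lambda,h)$ bounded on $[\lambda_0-\delta,\lambda_0+\delta]\times(0,h_0]$ such that, for $h\in(0,h_0]$, a number $\lambda\in[\lambda_0-\delta,\lambda_0+\delta]$ is an eigenvalue of $L$ if and only if $$I(\lambda)=\left(k+\tfrac12\right)\pi h+h^2r_+(\lambda,h)$$ holds for some integer $k$. (ii) If $A(\alpha_0)=-A(\beta_0)$, then there exist positive constants $\delta$ and $h_0$ and a function $r_-(\lambda,h)$ bounded on $[\lambda_0-\delta,\lambda_0+\delta]\times(0,h_0]$ such that, for $h\in(0,h_0]$, a number $\lambda\in[\lambda_0-\delta,\lambda_0+\delta]$ is an eigenvalue of $L$ if and only if $$I(\lambda)=k\pi h+h^2r_-(\lambda,h)$$ holds for some integer $k$.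
   Context: For $h>0$ the (self-adjoint) Zakharov-Shabat operator on the line is $$L=\begin{pmatrix} ih\frac{d}{dx} & -iA(x)\\ iA(x) & -ih\frac{d}{dx}\end{pmatrix},$$ acting in $L^2(\mathbb{R};\mathbb{C}^2)$; $\lambda$ is an eigenvalue of $L$ if $L\boldsymbol{u}=\lambda\boldsymbol{u}$ has a nonzero solution $\boldsymbol{u}\in L^2(\mathbb{R};\mathbb{C}^2)$. Assumption (A1): $A$ is a function analytic in a strip $D=\{z\in\mathbb{C}: |\mathrm{Im}\,z|<\delta_D\}$ for some $\delta_D>0$, real-valued on $\mathbb{R}$, and $\lambda_0$ is a positive real number such that: (1) there exist real numbers $\alpha_0<\beta_0$ such that, for $x\in\mathbb{R}$, $|A(x)|=\lambda_0$ if and only if $x=\alpha_0$ or $x=\beta_0$; (2) $A'(\alpha_0)A'(\beta_0)\neq0$; (3) $|A(x)|<\lambda_0$ for $\alpha_0<x<\beta_0$, and $|A(x)|>\lambda_0$ for $x<\alpha_0$ and for $x>\beta_0$; (4) $\liminf_{|x|\to\infty}|A(x)|>\lambda_0$ ($x$ real). For $\lambda\in\mathbb{R}$ close enough to $\lambda_0$, the function $\lambda^2-A(x)^2$ has exactly two real zeros $\alpha(\lambda)$ and $\beta(\lambda)$, close to $\alpha_0$ and $\beta_0$ respectively, and the action integral is $$I(\lambda)=\int_{\alpha(\lambda)}^{\beta(\lambda)}\sqrt{\lambda^2-A(t)^2}\,dt.$$ *)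

(* Defs.v *)
(* Stdlib reals with Coquelicot for the calculus; MathComp-Analysis, over the
   same real numbers (Rstruct), for the Lebesgue integral and the limit inferior. *)
From mathcomp Require Import all_boot all_order all_algebra.
From mathcomp Require Import all_classical all_reals all_analysis.
From mathcomp Require Import Rstruct Rstruct_topology.
From Stdlib Require Import Reals ClassicalEpsilon Lra.
From Coquelicot Require Import Coquelicot.

Open Scope R_scope.

(* Analytic in the strip |Im z| < d: locally the sum of a convergent power series. *)
Definition analytic_in_strip (d : R) (F : C -> C) : Prop :=
  forall z0 : C, Rabs (Im z0) < d ->
  exists (r : R) (a : nat -> C), 0 < r /\
    forall z : C, Cmod (z - z0)%C < r ->
      @is_pseries C_AbsRing C_NormedModule a (z - z0)%C (F z).

(* The filter of the limit |x| -> oo on the line. *)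
Definition abs_infty (P : set R) : Prop :=
  exists M : R, forall x : R, M < Rabs x -> P x.

Definition liminf_abs_infty (f : R -> R) : \bar R :=
  limf_einf (fun x : R => (f x)%:E) abs_infty.

(* The potential is given by its values on the line, where it is real; they
   determine the analytic continuation [F] uniquely. *)
Record assumption_A1 (A : R -> R) (lambda0 alpha0 beta0 : R) : Prop := {
  A1_analytic : exists (deltaD : R) (F : C -> C), 0 < deltaD /\
    analytic_in_strip deltaD F /\ forall x : R, F (RtoC x) = RtoC (A x);
  A1_lambda0 : 0 < lambda0;
  A1_order : alpha0 < beta0;
  A1_turning : forall x : R, Rabs (A x) = lambda0 <-> x = alpha0 \/ x = beta0;
  A1_simple : Derive A alpha0 * Derive A beta0 <> 0;
  A1_inside : forall x : R, alpha0 < x < beta0 -> Rabs (A x) < lambda0;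
  A1_outside : forall x : R, x < alpha0 \/ beta0 < x -> lambda0 < Rabs (A x);
  A1_liminf : (lambda0%:E < liminf_abs_infty (fun x => Rabs (A x)))%E
}.

(* [ZS_op h A u w] says that L u = w; the derivatives are those of functions
   from R to C. *)
Definition ZS_op (h : R) (A : R -> R) (u w : R -> C * C) : Prop :=
  forall x : R, exists du1 du2 : C,
    @is_derive R_AbsRing C_R_NormedModule (fun t => fst (u t)) x du1 /\
    @is_derive R_AbsRing C_R_NormedModule (fun t => snd (u t)) x du2 /\
    fst (w x) = (Ci * RtoC h * du1 - Ci * RtoC (A x) * snd (u x))%C /\
    snd (w x) = (Ci * RtoC (A x) * fst (u x) - Ci * RtoC h * du2)%C.

Definition measurable_RR (f : R -> R) : Prop :=
  @measurable_fun _ _ (measurableTypeR R) (measurableTypeR R) setT f.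

Definition L2_C2 (u : R -> C * C) : Prop :=
  measurable_RR (fun x => Re (fst (u x))) /\ measurable_RR (fun x => Im (fst (u x))) /\
  measurable_RR (fun x => Re (snd (u x))) /\ measurable_RR (fun x => Im (snd (u x))) /\
  (\int[lebesgue_measure]_(x in setT)
     (Cmod (fst (u x)) ^ 2 + Cmod (snd (u x)) ^ 2)%R%:E < +oo)%E.

(* A solution of L u = lambda u is differentiable, hence continuous, so being
   nonzero in L^2 amounts to being nonzero at some point. *)
Definition ZS_eigenvalue (h : R) (A : R -> R) (lambda : R) : Prop :=
  exists u : R -> C * C,
    L2_C2 u /\
    ZS_op h A u (fun x => ((RtoC lambda * fst (u x))%C, (RtoC lambda * snd (u x))%C)) /\
    exists x : R, u x <> (RtoC 0, RtoC 0).

Definition is_turning_points (A : R -> R) (lambda : R) (p : R * R) : Prop :=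
  fst p < snd p /\
  forall x : R, lambda ^ 2 - A x ^ 2 = 0 <-> x = fst p \/ x = snd p.

(* The pair (alpha(lambda), beta(lambda)) when lambda^2 - A^2 has exactly two
   real zeros, an arbitrary pair otherwise. *)
Definition turning_points (A : R -> R) (lambda : R) : R * R :=
  epsilon (inhabits (0, 0)) (is_turning_points A lambda).

Lemma turning_points_unique (A : R -> R) (lambda a b : R) :
  is_turning_points A lambda (a, b) -> turning_points A lambda = (a, b).
Proof.
intros H.
assert (E : is_turning_points A lambda (turning_points A lambda)).
{ unfold turning_points; apply epsilon_spec; exists (a, b); exact H. }
destruct (turning_points A lambda) as [c d].
destruct H as [Hab H], E as [Hcd E]; simpl in *.
destruct (proj1 (H c) (proj2 (E c) (or_introl erefl)));
destruct (proj1 (H d) (proj2 (E d) (or_intror erefl)));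
destruct (proj1 (E a) (proj2 (H a) (or_introl erefl)));
destruct (proj1 (E b) (proj2 (H b) (or_intror erefl)));
f_equal; lra.
Qed.

Definition action_integral (A : R -> R) (lambda : R) : R :=
  RInt (fun t => sqrt (lambda ^ 2 - A t ^ 2))
    (fst (turning_points A lambda)) (snd (turning_points A lambda)).

Definition bounded_on_box (lambda0 delta h0 : R) (r : R -> R -> R) : Prop :=
  exists M : R, forall lambda h : R,
    lambda0 - delta <= lambda <= lambda0 + delta -> 0 < h <= h0 ->
    Rabs (r lambda h) <= M.

(* Main.v *)
Require Import Defs.
From Stdlib Require Import ssreflect Reals Arith ZArith Lra Lia ClassicalEpsilon.
From Coquelicot Require Import Coquelicot.
From mathcomp Require all_boot all_order all_algebra all_classical all_reals all_analysis.
From mathcomp Require measurable_realfun Rstruct Rstruct_topology.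

(** Since the remainder is only required to be bounded, it suffices to show that every eigenvalue
    satisfies the quantization condition up to O(h^2); elsewhere the remainder can be chosen so
    that the condition fails.

    With f = lambda + A and g = lambda - A, a solution reduces to a real pair with h Q' = f P and
    h P' = - g Q, and square integrability forces QP to have a definite sign in each forbidden
    region. Near a turning point where A = lambda, Langer's variable z, z z'^2 = f g, turns
    Q = m e(z / h^(2/3)), e the recessive Airy function, into an approximate solution. The
    Wronskian of an exact solution with it changes by O(h) only, which fixes the WKB phase of the
    solution inside the well up to O(h), as (1/h) int sqrt(f g) + theta with a universal constant
    theta. A zero of f instead of g is reduced to this case by exchanging Q and P, which shifts
    the phase by a quarter turn. Matching the phases obtained from the two ends gives
    sin (I/h + 2 theta) = O(h) in case (i) and cos (I/h + 2 theta) = O(h) in case (ii). Finally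
    cos (2 theta) = 0, because the potential A(x) = - x has the explicit eigenvalue lambda = 1
    with I = pi/2 whenever h = 1/(2k). *)

Open Scope R_scope.

(** A phase error O(h) is good enough because the action is h times the phase. No exact solution is
    constructed: a hypothetical eigenfunction is compared with explicit quasimodes through
    Wronskians, and all estimates are homogeneous in it, measured against its size at one point of
    the well.

    The obstacle is uniformity. The coefficients of the system have size 1/h, so crude bounds on (Q,
    P) near a turning point lose powers of h. The energy P^2 + (g/f) Q^2 avoids the loss: its
    derivative (g/f)' Q^2 contains no 1/h, and it is monotone across the turning point. Uniformity
    in lambda comes from the order of quantifiers: constants depend on a lower bound c, an upper
    bound M and a length, and are fixed before f and g.

    Classically theta is pi/4, from the asymptotics of the Airy function. Since theta is chosen
    before the potential, a family of exact eigenvalues with h tending to 0 can calibrate it, and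
    only |sin (2 theta)| = 1 enters the final conditions. *)

Ltac pos := first
  [ assumption | lra
  | match goal with
    | |- 0 <= _ ^ 2 => apply pow2_ge_0
    | |- 0 <= Rabs _ => apply Rabs_pos
    | |- 0 <= _ * _ => apply Rmult_le_pos
    | |- 0 <= _ / _ => apply Rdiv_le_0_compat
    | |- 0 <= _ + _ => apply Rplus_le_le_0_compat
    | |- 0 < exp _ => apply exp_pos
    | |- 0 < sqrt _ => apply sqrt_lt_R0
    | |- 0 < _ * _ => apply Rmult_lt_0_compat
    | |- 0 < _ / _ => apply Rdiv_lt_0_compat
    | |- 0 < / _ => apply Rinv_0_lt_compat
    | |- 0 < _ ^ _ => apply pow_lt
    | |- 0 < _ + _ => apply Rplus_lt_0_compat
    | |- 0 < Rmin _ _ => apply Rmin_glb_lt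
    | |- 0 <= _ => left
    end; pos ].

(** * Derivatives, continuity and differential inequalities *)

Lemma Rabs_le_mult (x y M N : R) : Rabs x <= M -> Rabs y <= N -> Rabs (x * y) <= M * N.
Proof.
intros Hx Hy; rewrite Rabs_mult.
apply Rmult_le_compat; auto using Rabs_pos.
Qed.

Lemma is_derive_eq (f : R -> R) (x l l' : R) : is_derive f x l -> l = l' -> is_derive f x l'.
Proof. intros H <-; exact H. Qed.

Lemma is_derive_mul (u v : R -> R) (x l k : R) :
  is_derive u x l -> is_derive v x k -> is_derive (fun y => u y * v y) x (l * v x + u x * k).
Proof. intros; apply (is_derive_mult u v x l k); auto; intros; apply Rmult_comm. Qed.

Lemma is_derive_add (u v : R -> R) (x l k : R) :
  is_derive u x l -> is_derive v x k -> is_derive (fun y => u y + v y) x (l + k).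
Proof. intros; apply (is_derive_plus u v x l k); auto. Qed.

Lemma is_derive_sub (u v : R -> R) (x l k : R) :
  is_derive u x l -> is_derive v x k -> is_derive (fun y => u y - v y) x (l - k).
Proof. intros; apply (is_derive_minus u v x l k); auto. Qed.

Lemma is_derive_neg (u : R -> R) (x l : R) :
  is_derive u x l -> is_derive (fun y => - u y) x (- l).
Proof. intros; apply (is_derive_opp u x l); auto. Qed.

Lemma is_derive_cst (c x : R) : is_derive (fun _ : R => c) x 0.
Proof. apply (is_derive_const c x). Qed.

Lemma is_derive_idR (x : R) : is_derive (fun y : R => y) x 1.
Proof. apply (is_derive_id x). Qed.

Lemma is_derive_cmul (c : R) (u : R -> R) (x l : R) :
  is_derive u x l -> is_derive (fun y => c * u y) x (c * l).
Proof.
intros H; apply is_derive_eq with (0 * u x + c * l); [|ring].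
apply is_derive_mul; [apply is_derive_cst|exact H].
Qed.

Lemma is_derive_lin (c x : R) : is_derive (fun y => c * y) x c.
Proof.
apply is_derive_eq with (c * 1); [apply (is_derive_cmul c (fun y => y)), is_derive_idR|ring].
Qed.

Lemma is_derive_compR (u v : R -> R) (x l k : R) :
  is_derive u (v x) l -> is_derive v x k -> is_derive (fun y => u (v y)) x (l * k).
Proof.
intros Hu Hv; apply is_derive_eq with (k * l); [|ring].
exact (is_derive_comp u v x l k Hu Hv).
Qed.

Lemma is_derive_continuous (f : R -> R) (x l : R) : is_derive f x l -> continuous f x.
Proof. intros H; apply (ex_derive_continuous f x); exists l; exact H. Qed.

Lemma continuous_pt (u : R -> R) (x : R) : continuous u x -> continuity_pt u x.
Proof. intros Hu; apply continuity_pt_filterlim; exact Hu. Qed.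

Lemma continuousD (u v : R -> R) (x : R) :
  continuous u x -> continuous v x -> continuous (fun y => u y + v y) x.
Proof. intros Hu Hv; exact (continuous_plus u v x Hu Hv). Qed.

Lemma continuousM (u v : R -> R) (x : R) :
  continuous u x -> continuous v x -> continuous (fun y => u y * v y) x.
Proof. intros Hu Hv; exact (continuous_mult u v x Hu Hv). Qed.

Lemma continuousZ (c : R) (u : R -> R) (x : R) :
  continuous u x -> continuous (fun y => c * u y) x.
Proof. intros Hu; apply continuousM; auto; apply continuous_const. Qed.

Lemma is_derive_local (f g : R -> R) (a b x l : R) :
  a < x < b -> (forall y, a < y < b -> f y = g y) -> is_derive f x l -> is_derive g x l.
Proof.
intros Hx Hfg; apply is_derive_ext_loc.
assert (He : 0 < Rmin (x - a) (b - x)) by pos.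
exists (mkposreal _ He); intros y Hy; apply Hfg.
apply Rabs_lt_between' in Hy; simpl in Hy.
pose proof (Rmin_l (x - a) (b - x)); pose proof (Rmin_r (x - a) (b - x)); lra.
Qed.

(** The mean value theorem for [B - D] and [B + D]. It replaces integration of the bound [b], so
    that [B] may be built from energies of the unknown solution itself. *)
Lemma derive_abs_le (D B d b : R -> R) (x y : R) : x <= y ->
  (forall t, x <= t <= y -> is_derive D t (d t)) ->
  (forall t, x <= t <= y -> is_derive B t (b t)) ->
  (forall t, x <= t <= y -> Rabs (d t) <= b t) ->
  Rabs (D y - D x) <= B y - B x.
Proof.
intros Hxy HD HB Hdb.
assert (HP : forall s, (s = 1 \/ s = -1) -> s * (D y - D x) <= B y - B x).
{ intros s Hs.
  destruct (MVT_gen (fun t => B t - s * D t) x y (fun t => b t - s * d t)) as [c [Hc He]].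
  - rewrite Rmin_left ?Rmax_right; trivial; intros t Ht.
    apply is_derive_sub; [apply HB; lra|apply is_derive_cmul, HD; lra].
  - rewrite Rmin_left ?Rmax_right; trivial; intros t Ht.
    apply continuous_pt.
    apply (is_derive_continuous _ _ (b t - s * d t)).
    apply is_derive_sub; [apply HB; lra|apply is_derive_cmul, HD; lra].
  - rewrite Rmin_left ?Rmax_right in Hc; trivial.
    assert (0 <= b c - s * d c).
    { specialize (Hdb c Hc); apply Rabs_le_between in Hdb; destruct Hs; subst s; lra. }
    assert (0 <= (b c - s * d c) * (y - x)) by pos.
    simpl in He; lra. }
pose proof (HP 1 (or_introl eq_refl)); pose proof (HP (-1) (or_intror eq_refl)).
apply Rabs_le_between; lra.
Qed.

Lemma derive_nonneg_le (B b : R -> R) (x y : R) : x <= y ->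
  (forall t, x <= t <= y -> is_derive B t (b t)) ->
  (forall t, x <= t <= y -> 0 <= b t) -> B x <= B y.
Proof.
intros Hxy HB Hb.
pose proof (derive_abs_le (fun _ => 0) B (fun _ => 0) b x y Hxy) as H.
assert (Rabs (0 - 0) <= B y - B x).
{ apply H; auto; intros t Ht; [apply is_derive_cst|rewrite Rabs_R0; auto]. }
rewrite Rminus_0_r Rabs_R0 in H0; lra.
Qed.

Lemma exp_le_compat (p q : R) : p <= q -> exp p <= exp q.
Proof. intros [H| ->]; [left; apply exp_increasing; auto|apply Rle_refl]. Qed.

(** Two-sided Gronwall: [exp (k t) n] increases and [exp (- k t) n] decreases. The sign [s] treats
    both at once. *)
Lemma exp_growth (n n' : R -> R) (k a b : R) : a <= b ->
  (forall t, a <= t <= b -> is_derive n t (n' t) /\ Rabs (n' t) <= k * n t) ->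
  n a <= exp (k * (b - a)) * n b /\ n b <= exp (k * (b - a)) * n a.
Proof.
intros Hab H.
assert (M : forall s, s = 1 \/ s = -1 -> s * (exp (s * k * a) * n a) <= s * (exp (s * k * b) * n b)).
{ intros s Hs.
  apply (derive_nonneg_le (fun t => s * (exp (s * k * t) * n t))
    (fun t => exp (s * k * t) * ((s * s) * k * n t + s * n' t))); auto; intros t Ht;
    destruct (H t Ht) as [dn bn].
  - eapply is_derive_eq; [apply is_derive_cmul, is_derive_mul; [|exact dn]|].
    + apply (is_derive_compR exp (fun t => s * k * t)); [apply is_derive_exp|apply is_derive_lin].
    + cbv beta; ring.
  - apply Rabs_le_between in bn; apply Rmult_le_pos; [left; apply exp_pos|].
    destruct Hs; subst s; lra. }
pose proof (M 1 (or_introl eq_refl)) as M1; pose proof (M (-1) (or_intror eq_refl)) as M2.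
split; apply Rmult_le_reg_l with (exp (1 * k * a)); try apply exp_pos.
- rewrite -Rmult_assoc -exp_plus; replace (1 * k * a + k * (b - a)) with (1 * k * b) by ring; lra.
- replace (exp (1 * k * a) * (exp (k * (b - a)) * n a)) with (exp (k * b) * n a)
    by (rewrite -Rmult_assoc -exp_plus; f_equal; f_equal; ring).
  apply Rmult_le_reg_l with (exp (- k * (a + b))); [apply exp_pos|].
  rewrite -!Rmult_assoc -!exp_plus.
  replace (- k * (a + b) + 1 * k * a) with (-1 * k * b) by ring.
  replace (- k * (a + b) + k * b) with (-1 * k * a) by ring. lra.
Qed.

Lemma le_of_sq (a b : R) : 0 <= b -> a ^ 2 <= b ^ 2 -> a <= b.
Proof. intros Hb H; apply Rsqr_incr_0_var; auto; unfold Rsqr; lra. Qed.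

Lemma Rabs_le_of_sq (a b : R) : 0 <= b -> a ^ 2 <= b ^ 2 -> Rabs a <= b.
Proof. intros Hb H; apply le_of_sq; auto; rewrite pow2_abs; auto. Qed.

Lemma is_derive_RInt_interval (a b x0 x : R) (u : R -> R) :
  (forall y, a < y < b -> continuous u y) -> a < x0 < b -> a < x < b ->
  is_derive (fun y => RInt u x0 y) x (u x).
Proof.
intros Hu H0 Hx; apply (is_derive_RInt u _ x0); [|apply Hu; auto].
assert (He : 0 < Rmin (x - a) (b - x)) by (apply Rmin_glb_lt; lra).
exists (mkposreal _ He); intros y Hy; apply Rabs_lt_between' in Hy; simpl in Hy.
pose proof (Rmin_l (x - a) (b - x)); pose proof (Rmin_r (x - a) (b - x)).
apply (RInt_correct (V := R_CompleteNormedModule)), (ex_RInt_continuous (V := R_CompleteNormedModule)).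
intros t Ht; apply Hu.
pose proof (Rmin_glb_lt x0 y a); pose proof (Rmax_lub_lt x0 y b); lra.
Qed.

(** * Twice differentiable functions with explicit bounds *)

(** The derivatives are arguments and one number [M] bounds everything, so that constants derived
    from such a bound depend on [M] alone and not on lambda or h. *)
Definition C2b (a b M : R) (u u1 u2 : R -> R) : Prop :=
  forall x, a < x < b -> is_derive u x (u1 x) /\ is_derive u1 x (u2 x) /\ continuous u2 x /\
    Rabs (u x) <= M /\ Rabs (u1 x) <= M /\ Rabs (u2 x) <= M.

Lemma C2b_mult (a b M N : R) (u u1 u2 v v1 v2 : R -> R) :
  C2b a b M u u1 u2 -> C2b a b N v v1 v2 ->
  C2b a b (4 * M * N) (fun x => u x * v x) (fun x => u1 x * v x + u x * v1 x)
    (fun x => u2 x * v x + 2 * (u1 x * v1 x) + u x * v2 x).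
Proof.
intros Hu Hv x Hx; specialize (Hu x Hx); specialize (Hv x Hx).
destruct Hu as (du & du1 & cu2 & bu & bu1 & bu2), Hv as (dv & dv1 & cv2 & bv & bv1 & bv2).
assert (HM : 0 <= M) by (pose proof (Rabs_pos (u x)); lra).
assert (HN : 0 <= N) by (pose proof (Rabs_pos (v x)); lra).
pose proof (Rmult_le_pos _ _ HM HN).
split; [apply is_derive_mul; auto|]. split.
{ eapply is_derive_eq; [apply is_derive_add; apply is_derive_mul; eauto|ring]. }
split.
{ apply continuousD; [apply continuousD|].
  - apply continuousM; auto; apply (is_derive_continuous _ _ _ dv).
  - apply continuousZ, continuousM; eapply is_derive_continuous; eauto.
  - apply continuousM; auto; apply (is_derive_continuous _ _ _ du). }
assert (T : forall p q s t, Rabs p <= s -> Rabs q <= t -> Rabs (p + q) <= s + t).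
{ intros p q s t; pose proof (Rabs_triang p q); lra. }
repeat split.
- apply Rle_trans with (M * N); [apply Rabs_le_mult; auto|lra].
- apply Rle_trans with (M * N + M * N); [apply T; apply Rabs_le_mult; auto|lra].
- apply Rle_trans with (M * N + 2 * (M * N) + M * N); [|lra].
  apply T; [apply T|]; try (apply Rabs_le_mult; auto).
  + rewrite Rabs_pos_eq; lra.
  + apply Rabs_le_mult; auto.
Qed.

Lemma Rpower_bounds (c M u p : R) : 0 < c -> c <= u <= M ->
  exp (- (Rabs p * (Rabs (ln c) + Rabs (ln M)))) <= Rpower u p
    <= exp (Rabs p * (Rabs (ln c) + Rabs (ln M))).
Proof.
intros Hc Hu; unfold Rpower.
assert (Hl : Rabs (ln u) <= Rabs (ln c) + Rabs (ln M)).
{ assert (ln c <= ln u) by (apply ln_le; lra).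
  assert (ln u <= ln M) by (apply ln_le; lra).
  apply Rabs_le; pose proof (Rle_abs (ln M)); pose proof (Rle_abs (- ln c)).
  rewrite Rabs_Ropp in H2; pose proof (Rabs_pos (ln c)); pose proof (Rabs_pos (ln M)); lra. }
assert (H := Rabs_le_mult p (ln u) _ _ (Rle_refl _) Hl).
apply Rabs_le_between in H.
split; apply exp_le_compat; lra.
Qed.

Lemma is_derive_Rpower (u : R -> R) (x l q : R) : 0 < u x -> is_derive u x l ->
  is_derive (fun y => Rpower (u y) q) x (q * l * Rpower (u x) (q - 1)).
Proof.
intros Hu Hd; unfold Rpower.
eapply is_derive_eq.
- apply (is_derive_compR exp (fun y => q * ln (u y))); [apply is_derive_exp|].
  apply is_derive_mul; [apply is_derive_cst|].
  apply (is_derive_compR ln u); [apply is_derive_ln; auto|eauto].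
- simpl. replace ((q - 1) * ln (u x)) with (q * ln (u x) - ln (u x)) by ring.
  unfold Rminus; rewrite exp_plus exp_Ropp exp_ln; auto; field; lra.
Qed.

(** [M'] can be fixed before the function because [ln (u x)] is confined between [ln c] and [ln M],
    which bounds every power of [u] from both sides. *)
Lemma C2b_Rpower (c M q : R) : 0 < c -> 0 < M -> exists M', 0 < M' /\ forall a b u u1 u2,
  C2b a b M u u1 u2 -> (forall x, a < x < b -> c <= u x) ->
  C2b a b M' (fun x => Rpower (u x) q) (fun x => q * u1 x * Rpower (u x) (q - 1))
    (fun x => q * u2 x * Rpower (u x) (q - 1)
              + q * u1 x * ((q - 1) * u1 x * Rpower (u x) (q - 1 - 1))).
Proof.
intros Hc HM.
set (L := Rabs (ln c) + Rabs (ln M)).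
set (B := fun p => exp (Rabs p * L)).
assert (HB : forall p, 0 < B p) by (intros; apply exp_pos).
pose proof (HB q); pose proof (HB (q - 1)); pose proof (HB (q - 1 - 1)).
set (q0 := Rabs q); assert (0 <= q0) by apply Rabs_pos.
set (q1 := Rabs (q - 1)); assert (0 <= q1) by apply Rabs_pos.
set (t1 := q0 * M * B (q - 1)); set (t2 := q0 * M * (q1 * M * B (q - 1 - 1))).
assert (0 <= t1). { unfold t1; pos. }
assert (0 <= t2). { unfold t2; pos. }
exists (B q + t1 + t2); split; [lra|].
intros a b u u1 u2 Hu Huc x Hx; destruct (Hu x Hx) as (du & du1 & cu2 & bu & bu1 & bu2).
assert (Hux := Huc x Hx).
assert (HuM : u x <= M) by (pose proof (Rle_abs (u x)); lra).
assert (Hp : forall p, Rabs (Rpower (u x) p) <= B p).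
{ intros p. rewrite Rabs_pos_eq; [|left; apply exp_pos].
  apply (Rpower_bounds c M (u x) p Hc); lra. }
assert (dP : forall p, is_derive (fun y => Rpower (u y) p) x (p * u1 x * Rpower (u x) (p - 1))).
{ intros p; apply is_derive_Rpower; auto; lra. }
split; [apply dP|]. split.
{ eapply is_derive_eq; [apply is_derive_mul; [|apply dP]; apply is_derive_mul;
    [apply is_derive_cst|apply du1]|cbv beta; ring]. }
assert (cont : forall p, continuous (fun y => Rpower (u y) p) x).
{ intros p; eapply is_derive_continuous, dP. }
assert (cu1 : continuous u1 x) by (eapply is_derive_continuous; eauto).
split.
{ apply continuousD; apply continuousM; auto using continuousZ, continuousM. }
assert (E1 : forall w, Rabs w <= M -> Rabs (q * w * Rpower (u x) (q - 1)) <= t1).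
{ intros w Hw; apply Rabs_le_mult; auto; apply Rabs_le_mult; auto; apply Rle_refl. }
assert (E2 : Rabs (q * u1 x * ((q - 1) * u1 x * Rpower (u x) (q - 1 - 1))) <= t2).
{ repeat apply Rabs_le_mult; auto; apply Rle_refl. }
repeat split.
- specialize (Hp q); lra.
- specialize (E1 _ bu1); lra.
- specialize (E1 _ bu2). eapply Rle_trans; [apply Rabs_triang|]; lra.
Qed.

(** * Hadamard averages *)

(* [had al n u x] is the integral of s^n u(al + s^2 (x - al)) over [0,1]; the substitution of
   s^2 for the usual variable makes averages with weight sqrt smooth at the base point. *)
Definition had (al : R) (n : nat) (u : R -> R) (x : R) : R :=
  RInt (fun s => s ^ n * u (al + s ^ 2 * (x - al))) 0 1.

Lemma had_arg (al r x s : R) : al - r < x < al + r -> 0 <= s <= 1 ->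
  al - r < al + s ^ 2 * (x - al) < al + r.
Proof. intros; assert (0 <= s ^ 2 <= 1) by nra; nra. Qed.

Lemma continuous_had_integrand (al r : R) (n : nat) (u : R -> R) (x s : R) :
  (forall y, al - r < y < al + r -> continuous u y) -> al - r < x < al + r -> 0 <= s <= 1 ->
  continuous (fun s => s ^ n * u (al + s ^ 2 * (x - al))) s.
Proof.
intros Hu Hx Hs.
apply continuousM.
- apply (is_derive_continuous _ _ (INR n * 1 * s ^ pred n)); auto_derive; trivial; ring.
- apply (continuous_comp (fun s => al + s ^ 2 * (x - al)) u).
  + apply (is_derive_continuous _ _ (2 * s * (x - al))); auto_derive; trivial; ring.
  + apply Hu, had_arg; auto.
Qed.

Lemma ex_RInt_had (al r : R) (n : nat) (u : R -> R) (x : R) :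
  (forall y, al - r < y < al + r -> continuous u y) -> al - r < x < al + r ->
  ex_RInt (fun s => s ^ n * u (al + s ^ 2 * (x - al))) 0 1.
Proof.
intros Hu Hx; apply (ex_RInt_continuous (V := R_CompleteNormedModule)).
rewrite Rmin_left ?Rmax_right; try lra; intros s Hs.
eapply continuous_had_integrand; eauto.
Qed.

Lemma is_RInt_pow (n : nat) : is_RInt (fun s => s ^ n) 0 1 (/ INR (S n)).
Proof.
assert (HS : INR (S n) <> 0) by (apply not_0_INR; lia).
replace (/ INR (S n)) with (minus (/ INR (S n) * 1 ^ S n) (/ INR (S n) * 0 ^ S n)).
- apply (is_RInt_derive (fun s => / INR (S n) * s ^ S n)).
  + intros x _. auto_derive; trivial. change (match n with O => 1 | S _ => INR n + 1 end) with (INR (S n)). field; auto.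
  + intros x _. apply (is_derive_continuous _ _ (INR n * 1 * x ^ pred n)); auto_derive; trivial; ring.
- unfold minus, plus, opp; simpl. rewrite pow1. ring.
Qed.

Lemma had_bound (al r M : R) (n : nat) (u : R -> R) (x : R) :
  (forall y, al - r < y < al + r -> continuous u y) ->
  (forall y, al - r < y < al + r -> Rabs (u y) <= M) ->
  al - r < x < al + r -> Rabs (had al n u x) <= M.
Proof.
intros Hc Hb Hx.
unfold had; apply Rle_trans with (M * (1 - 0)); [|lra].
rewrite -(Rmult_comm (1 - 0)).
apply (abs_RInt_le_const (fun s => s ^ n * u (al + s ^ 2 * (x - al)))); [lra| |].
- eapply ex_RInt_had; eauto.
- intros s Hs; rewrite -(Rmult_1_l M); apply Rabs_le_mult.
  + rewrite Rabs_pos_eq; [|apply pow_le; lra].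
    rewrite -(pow1 n); apply pow_incr; auto.
  + apply Hb, had_arg; auto.
Qed.

Lemma had_lower (al r c : R) (n : nat) (u : R -> R) (x : R) :
  (forall y, al - r < y < al + r -> continuous u y) ->
  (forall y, al - r < y < al + r -> c <= u y) ->
  al - r < x < al + r -> c / INR (S n) <= had al n u x.
Proof.
intros Hc Hb Hx.
pose proof (is_RInt_scal _ _ _ c _ (is_RInt_pow n)) as H.
change (scal c (/ INR (S n))) with (c / INR (S n)) in H.
rewrite -(is_RInt_unique _ _ _ _ H).
apply RInt_le; [lra|eexists; exact H|eapply ex_RInt_had; eauto|].
intros s Hs; change (c * s ^ n <= s ^ n * u (al + s ^ 2 * (x - al))).
rewrite (Rmult_comm c); apply Rmult_le_compat_l; [apply pow_le; lra|].
apply Hb, had_arg; auto; lra.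
Qed.

Lemma continuous_had (al r : R) (n : nat) (u : R -> R) (x : R) :
  (forall y, al - r < y < al + r -> continuous u y) -> al - r < x < al + r ->
  continuous (had al n u) x.
Proof.
intros Hu Hx.
(* Uniform continuity needs a compact interval inside the open one: [r'] lies halfway between the
   distance of [x] to [al] and [r]. *)
set (r' := (Rabs (x - al) + r) / 2).
assert (Hr : Rabs (x - al) < r) by (apply Rabs_lt_between'; lra).
apply filterlim_locally; intros eps.
assert (He2 : 0 < eps / 2) by (destruct eps; simpl; lra).
destruct (unifcont_1d u (al - r') (al + r')) with (eps := mkposreal _ He2) as [d Hd].
{ intros y Hy; apply Hu; unfold r' in Hy; lra. }
assert (Hd0 : 0 < Rmin d (r' - Rabs (x - al))).
{ apply Rmin_glb_lt; [apply cond_pos|unfold r'; lra]. }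
exists (mkposreal _ Hd0); intros y Hy.
assert (Hyx : Rabs (y - x) < Rmin d (r' - Rabs (x - al))) by exact Hy; clear Hy.
pose proof (Rmin_l d (r' - Rabs (x - al))); pose proof (Rmin_r d (r' - Rabs (x - al))).
assert (Hy : Rabs (y - al) < r').
{ replace (y - al) with ((y - x) + (x - al)) by ring.
  eapply Rle_lt_trans; [apply Rabs_triang|]; lra. }
assert (Hx' : Rabs (x - al) < r') by (unfold r'; lra).
assert (Hr' : r' < r) by (unfold r'; lra).
apply Rabs_lt_between' in Hy, Hx'.
change (Rabs (had al n u y - had al n u x) < eps).
apply Rle_lt_trans with (eps / 2); [|destruct eps; simpl; lra].
unfold had.
assert (Iy : ex_RInt (fun s => s ^ n * u (al + s ^ 2 * (y - al))) 0 1).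
{ eapply ex_RInt_had; eauto; lra. }
assert (Ix : ex_RInt (fun s => s ^ n * u (al + s ^ 2 * (x - al))) 0 1).
{ eapply ex_RInt_had; eauto; lra. }
replace (RInt (fun s => s ^ n * u (al + s ^ 2 * (y - al))) 0 1
         - RInt (fun s => s ^ n * u (al + s ^ 2 * (x - al))) 0 1)
  with (RInt (fun s => minus (s ^ n * u (al + s ^ 2 * (y - al)))
                        (s ^ n * u (al + s ^ 2 * (x - al)))) 0 1)
  by (apply (RInt_minus (V := R_CompleteNormedModule)); auto).
replace (eps / 2) with ((1 - 0) * (eps / 2)) by ring.
apply (abs_RInt_le_const (fun s => minus (s ^ n * u (al + s ^ 2 * (y - al)))
                        (s ^ n * u (al + s ^ 2 * (x - al))))); [lra| |].
{ apply (ex_RInt_minus (V := R_CompleteNormedModule)); auto. }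
intros s Hs.
replace (minus (s ^ n * u (al + s ^ 2 * (y - al))) (s ^ n * u (al + s ^ 2 * (x - al))))
  with (s ^ n * (u (al + s ^ 2 * (y - al)) - u (al + s ^ 2 * (x - al)))).
2: { unfold minus, plus, opp; simpl; ring. }
rewrite -(Rmult_1_l (eps / 2)); apply Rabs_le_mult.
- rewrite Rabs_pos_eq; [|apply pow_le; lra].
  rewrite -(pow1 n); apply pow_incr; auto.
- apply Rnot_lt_le; intros Hn.
  apply (Hd (al + s ^ 2 * (x - al)) (al + s ^ 2 * (y - al)));
    try (split; apply Rlt_le, (had_arg al r'); auto; lra).
  2: { intros Hb; change (Rabs (u (al + s ^ 2 * (y - al)) - u (al + s ^ 2 * (x - al))) < eps / 2) in Hb; lra. }
  change (Rabs (al + s ^ 2 * (y - al) - (al + s ^ 2 * (x - al))) < d).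
  replace (al + s ^ 2 * (y - al) - (al + s ^ 2 * (x - al))) with (s ^ 2 * (y - x)) by ring.
  rewrite Rabs_mult.
  assert (Rabs (s ^ 2) <= 1) by (rewrite Rabs_pos_eq; nra).
  pose proof (Rabs_pos (y - x)).
  assert (Rabs (s ^ 2) * Rabs (y - x) <= 1 * Rabs (y - x)) by (apply Rmult_le_compat_r; auto).
  lra.
Qed.

Lemma continuity_2d_had_arg (al x s : R) : continuity_2d_pt (fun x s => al + s ^ 2 * (x - al)) x s.
Proof.
apply continuity_2d_pt_plus; [apply continuity_2d_pt_const|].
apply continuity_2d_pt_mult.
- apply (continuity_1d_2d_pt_comp (fun s => s ^ 2) (fun _ s => s)); [|apply continuity_2d_pt_id2].
  apply derivable_continuous_pt, derivable_pt_pow.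
- apply continuity_2d_pt_minus; [apply continuity_2d_pt_id1|apply continuity_2d_pt_const].
Qed.

Lemma continuity_2d_pt_had (al r : R) (n : nat) (u : R -> R) (x s : R) :
  (forall y, al - r < y < al + r -> continuous u y) -> al - r < x < al + r -> 0 <= s <= 1 ->
  continuity_2d_pt (fun x s => s ^ n * u (al + s ^ 2 * (x - al))) x s.
Proof.
intros Hu Hx Hs.
apply continuity_2d_pt_mult.
- apply (continuity_1d_2d_pt_comp (fun s => s ^ n) (fun _ s => s)); [|apply continuity_2d_pt_id2].
  apply derivable_continuous_pt, derivable_pt_pow.
- apply (continuity_1d_2d_pt_comp u (fun x s => al + s ^ 2 * (x - al))); [|apply continuity_2d_had_arg].
  apply continuity_pt_filterlim, Hu, had_arg; auto.
Qed.

Lemma is_derive_had (al r : R) (n : nat) (u u1 : R -> R) (x : R) :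
  (forall y, al - r < y < al + r -> is_derive u y (u1 y)) ->
  (forall y, al - r < y < al + r -> continuous u1 y) -> al - r < x < al + r ->
  is_derive (had al n u) x (had al (n + 2) u1 x).
Proof.
intros Hu Hu1 Hx.
assert (Hd : forall y s, al - r < y < al + r -> 0 <= s <= 1 ->
  is_derive (fun z => s ^ n * u (al + s ^ 2 * (z - al))) y
    (s ^ (n + 2) * u1 (al + s ^ 2 * (y - al)))).
{ intros y s Hy Hs. eapply is_derive_eq.
  - apply is_derive_mul; [apply is_derive_cst|].
    apply (is_derive_compR u (fun z => al + s ^ 2 * (z - al)) y).
    + apply Hu, had_arg; auto.
    + instantiate (1 := s ^ 2). auto_derive; trivial; ring.
  - rewrite pow_add; ring. }
assert (Hloc : locally x (fun y => al - r < y < al + r)).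
{ assert (He : 0 < Rmin (x - (al - r)) (al + r - x)) by pos.
  exists (mkposreal _ He); intros y Hy. apply Rabs_lt_between' in Hy; simpl in Hy.
  pose proof (Rmin_l (x - (al - r)) (al + r - x)); pose proof (Rmin_r (x - (al - r)) (al + r - x)); lra. }
replace (had al (n + 2) u1 x) with
  (RInt (fun t => Derive (fun z => t ^ n * u (al + t ^ 2 * (z - al))) x) 0 1).
2: { unfold had; apply RInt_ext; rewrite Rmin_left ?Rmax_right; try lra.
     intros s Hs; apply is_derive_unique, Hd; auto; lra. }
apply (is_derive_RInt_param (fun x s => s ^ n * u (al + s ^ 2 * (x - al))) 0 1 x).
- apply: filter_imp Hloc; intros y Hy t; rewrite Rmin_left ?Rmax_right; try lra; intros Ht.
  eexists; apply Hd; auto.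
- rewrite Rmin_left ?Rmax_right; try lra; intros s Hs.
  (* The differentiation theorem asks for joint continuity of [Derive]; near [(x, s)] it is replaced
     by the explicit derivative, the radius [e] keeping the argument of [u] inside the interval. *)
  apply continuity_2d_pt_ext_loc with (fun x s => s ^ (n + 2) * u1 (al + s ^ 2 * (x - al)));
    [|eapply continuity_2d_pt_had; eauto].
  assert (Hin : al - r < al + s ^ 2 * (x - al) < al + r) by (apply had_arg; auto).
  set (e := Rmin (al + s ^ 2 * (x - al) - (al - r)) (al + r - (al + s ^ 2 * (x - al)))).
  assert (He : 0 < e) by (apply Rmin_glb_lt; lra).
  destruct (continuity_2d_had_arg al x s (mkposreal _ He)) as [d Hd2]; exists d; intros y t Hy Ht.
  specialize (Hd2 y t Hy Ht); simpl in Hd2; apply Rabs_lt_between' in Hd2.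
  pose proof (Rmin_l (al + s ^ 2 * (x - al) - (al - r)) (al + r - (al + s ^ 2 * (x - al)))).
  pose proof (Rmin_r (al + s ^ 2 * (x - al) - (al - r)) (al + r - (al + s ^ 2 * (x - al)))).
  fold e in H, H0.
  symmetry; apply is_derive_unique. eapply is_derive_eq.
  + apply is_derive_mul; [apply is_derive_cst|].
    apply (is_derive_compR u (fun z => al + t ^ 2 * (z - al)) y).
    * apply Hu; simpl in *; lra.
    * instantiate (1 := t ^ 2). auto_derive; trivial; ring.
  + rewrite pow_add; ring.
- apply: filter_imp Hloc; intros y Hy. eapply ex_RInt_had; eauto.
  intros; eapply is_derive_continuous; eauto.
Qed.

(** Each differentiation in x brings out a factor s^2, hence the weights [n + 2] and [n + 2 + 2].
    The weights are at most 1 on [0,1], so the bound [M] is preserved. *)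
Lemma C2b_had (al r M : R) (n : nat) (u u1 u2 : R -> R) :
  C2b (al - r) (al + r) M u u1 u2 ->
  C2b (al - r) (al + r) M (had al n u) (had al (n + 2) u1) (had al (n + 2 + 2) u2).
Proof.
intros Hu x Hx.
assert (c0 : forall y, al - r < y < al + r -> continuous u y).
{ intros y Hy; exact (is_derive_continuous _ _ _ (proj1 (Hu y Hy))). }
assert (c1 : forall y, al - r < y < al + r -> continuous u1 y).
{ intros y Hy; exact (is_derive_continuous _ _ _ (proj1 (proj2 (Hu y Hy)))). }
assert (c2 : forall y, al - r < y < al + r -> continuous u2 y) by (intros y Hy; apply Hu; auto).
split; [|split; [|split; [|repeat split]]].
- apply is_derive_had with r; auto; intros; apply Hu; auto.
- apply is_derive_had with r; auto; intros; apply Hu; auto.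
- apply continuous_had with r; auto.
- apply had_bound with r; auto; intros; apply Hu; auto.
- apply had_bound with r; auto; intros; apply Hu; auto.
- apply had_bound with r; auto; intros; apply Hu; auto.
Qed.

(** The fundamental theorem for s^m u(al + s^2 (x - al)) on [0,1]. With m = 0, where [0 ^ 0 = 1], it
    is Hadamard's division of u(x) - u(al) by x - al; with m = 3 it is the mean value property
    behind Langer's variable. *)
Lemma had_ibp (al r : R) (m : nat) (u u1 : R -> R) (x : R) :
  (forall y, al - r < y < al + r -> is_derive u y (u1 y)) ->
  (forall y, al - r < y < al + r -> continuous u1 y) -> al - r < x < al + r ->
  INR m * had al (pred m) u x + 2 * (x - al) * had al (S m) u1 x = u x - 0 ^ m * u al.
Proof.
intros Hu Hu1 Hx.
assert (c0 : forall y, al - r < y < al + r -> continuous u y).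
{ intros y Hy; exact (is_derive_continuous _ _ _ (Hu y Hy)). }
set (arg := fun s => al + s ^ 2 * (x - al)).
assert (I : is_RInt (fun s => INR m * (s ^ pred m * u (arg s)) + 2 * (x - al) * (s ^ S m * u1 (arg s))) 0 1
    (minus (1 ^ m * u (arg 1)) (0 ^ m * u (arg 0)))).
{ apply (is_RInt_derive (fun s => s ^ m * u (arg s)));
    rewrite Rmin_left ?Rmax_right; try lra; intros s Hs.
  - eapply is_derive_eq.
    + apply is_derive_mul; [apply is_derive_pow, is_derive_idR|].
      apply (is_derive_compR u arg s); [apply Hu, had_arg; auto|].
      instantiate (1 := 2 * s * (x - al)); unfold arg; auto_derive; trivial; ring.
    + simpl; ring.
  - apply continuousD; apply continuousZ; eapply continuous_had_integrand; eauto. }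
assert (I2 : is_RInt (fun s => INR m * (s ^ pred m * u (arg s)) + 2 * (x - al) * (s ^ S m * u1 (arg s))) 0 1
    (INR m * had al (pred m) u x + 2 * (x - al) * had al (S m) u1 x)).
{ apply (is_RInt_plus (V := R_NormedModule));
  apply (is_RInt_scal (V := R_NormedModule)), (RInt_correct (V := R_CompleteNormedModule));
  eapply ex_RInt_had; eauto. }
rewrite -(is_RInt_unique _ _ _ _ I2) (is_RInt_unique _ _ _ _ I).
unfold minus, plus, opp, arg; simpl; rewrite pow1.
replace (al + 1 * (1 * 1) * (x - al)) with x by ring.
replace (al + 0 * (0 * 1) * (x - al)) with al by ring. ring.
Qed.

(** * The recessive solution of Airy's equation *)

(** A window of three consecutive Taylor coefficients of a solution of y'' = x y. The recurrence
    skips three indices, and the initial third entry is 0 because y''(0) = 0. *)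
Fixpoint airy_coef3 (c0 c1 : R) (n : nat) : R * R * R :=
  match n with
  | O => (c0, c1, 0)
  | S n => let '(a, b, c) := airy_coef3 c0 c1 n in
           (b, c, a / ((INR n + 2) * (INR n + 3)))
  end.

Definition airy_coef (c0 c1 : R) (n : nat) : R := fst (fst (airy_coef3 c0 c1 n)).

Lemma airy_coef_rec (c0 c1 : R) (n : nat) :
  airy_coef c0 c1 (n + 3) = airy_coef c0 c1 n / ((INR n + 2) * (INR n + 3)).
Proof.
unfold airy_coef; rewrite Nat.add_comm; simpl.
destruct (airy_coef3 c0 c1 n) as [[a b] c]; reflexivity.
Qed.

(** Once (n + 2)(n + 3) exceeds r^3, a step of the recurrence does not increase |a_n r^n|, so the
    maximum over finitely many indices bounds all of them. As r is arbitrary, the radius of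
    convergence is infinite. *)
Lemma airy_coef_bounded (c0 c1 r : R) : 1 <= r ->
  exists M, forall n, Rabs (airy_coef c0 c1 n * r ^ n) <= M.
Proof.
intros Hr; set (a := fun n => Rabs (airy_coef c0 c1 n * r ^ n)).
destruct (nfloor_ex (r ^ 3)) as [N [_ HN]]; [apply pow_le; lra|].
assert (Hfin : forall k, exists M, forall n, (n <= k)%nat -> a n <= M).
{ induction k as [|k [M HM]].
  - exists (a 0%nat); intros n Hn; replace n with 0%nat by lia; lra.
  - exists (Rmax M (a (S k))); intros n Hn.
    destruct (Nat.eq_dec n (S k)) as [->|Hne]; [apply Rmax_r|].
    eapply Rle_trans; [apply HM; lia|apply Rmax_l]. }
destruct (Hfin (N + 3)%nat) as [M HM]; exists M; intros n.
induction n as [n IH] using (well_founded_induction lt_wf).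
destruct (Nat.le_gt_cases n (N + 3)) as [Hn|Hn]; [apply HM; auto|].
apply Rle_trans with (a (n - 3)%nat); [|apply IH; lia].
unfold a; replace n with ((n - 3) + 3)%nat at 1 2 by lia.
set (m := (n - 3)%nat); rewrite airy_coef_rec pow_add.
assert (HmN : INR N + 1 <= INR m) by (rewrite -S_INR; apply le_INR; unfold m; lia).
pose proof (pos_INR N).
replace (airy_coef c0 c1 m / ((INR m + 2) * (INR m + 3)) * (r ^ m * r ^ 3))
  with (airy_coef c0 c1 m * r ^ m * (r ^ 3 / ((INR m + 2) * (INR m + 3)))) by (field; split; lra).
rewrite Rabs_mult -{2}(Rmult_1_r (Rabs (airy_coef c0 c1 m * r ^ m))).
apply Rmult_le_compat_l; [apply Rabs_pos|].
assert (0 <= r ^ 3) by pos.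
assert (0 < (INR m + 2) * (INR m + 3)) by pos.
rewrite Rabs_pos_eq; [|apply Rdiv_le_0_compat; auto].
apply Rle_div_l; auto; rewrite Rmult_1_l; nra.
Qed.

Lemma airy_ode (c0 c1 : R) : exists y y1 : R -> R, y 0 = c0 /\ y1 0 = c1 /\
  forall x, is_derive y x (y1 x) /\ is_derive y1 x (x * y x).
Proof.
set (a := airy_coef c0 c1).
assert (Hcv : forall x : R, Rbar_lt (Rabs x) (CV_radius a)).
{ intros x; apply Rbar_lt_le_trans with (Rabs x + 1); [simpl; lra|].
  apply (proj1 (CV_radius_bounded a) (Rabs x + 1)).
  apply airy_coef_bounded. pose proof (Rabs_pos x). lra. }
assert (Hcv1 : forall x : R, Rbar_lt (Rabs x) (CV_radius (PS_derive a))).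
{ intros x; rewrite CV_radius_derive; apply Hcv. }
exists (PSeries a), (PSeries (PS_derive a)).
split; [rewrite PSeries_0; reflexivity|].
split; [rewrite PSeries_0 /PS_derive; unfold a, airy_coef; simpl; ring|].
intros x; split; [apply is_derive_PSeries; auto|].
replace (x * PSeries a x) with (PSeries (PS_derive (PS_derive a)) x);
  [apply is_derive_PSeries; auto|].
rewrite -PSeries_incr_1; apply PSeries_ext; intros [|n]; unfold PS_derive, PS_incr_1.
- unfold a, airy_coef; simpl; unfold zero; simpl; ring.
- unfold a; replace (S (S (S n))) with (n + 3)%nat by lia; rewrite airy_coef_rec.
  rewrite plus_INR !S_INR; pose proof (pos_INR n); simpl; field; lra.
Qed.

(* The ratios y/z and y'/z' of the solutions with data (1,0) and (0,1) at 0 are monotone and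
   squeeze the initial slope of the decaying solution y - m z. *)
Lemma airy_decay : exists e e1 : R -> R,
  (forall x, is_derive e x (e1 x) /\ is_derive e1 x (x * e x)) /\ e 0 = 1 /\
  forall x, 1 <= x -> Rabs (e x) <= 12 / x ^ 3 /\ Rabs (e1 x) <= 12 / x ^ 4.
Proof.
destruct (airy_ode 1 0) as (y & y1 & y0 & y10 & Hy).
destruct (airy_ode 0 1) as (z & z1 & z0 & z10 & Hz).
assert (dy := fun x => proj1 (Hy x)); assert (dy1 := fun x => proj2 (Hy x)).
assert (dz := fun x => proj1 (Hz x)); assert (dz1 := fun x => proj2 (Hz x)).
assert (W : forall x, y x * z1 x - z x * y1 x = 1).
{ intros x; replace 1 with (y 0 * z1 0 - z 0 * y1 0) by (rewrite y0 y10 z0 z10; ring).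
  assert (D : forall t, is_derive (fun t => y t * z1 t - z t * y1 t) t 0).
  { intros t; eapply is_derive_eq.
    - apply is_derive_sub; apply is_derive_mul; eauto.
    - ring. }
  destruct (MVT_gen (fun t => y t * z1 t - z t * y1 t) 0 x (fun _ => 0)) as [c [_ Hc]].
  - intros; apply D.
  - intros; apply continuous_pt; exact (is_derive_continuous _ _ _ (D x0)).
  - simpl in Hc; lra. }
assert (Hzz : forall x, 0 <= x -> 0 <= z x * z1 x).
{ intros x Hx; replace 0 with (z 0 * z1 0) by (rewrite z0; ring).
  apply (derive_nonneg_le (fun t => z t * z1 t) (fun t => z1 t * z1 t + z t * (t * z t))); auto.
  - intros t Ht; apply is_derive_mul; auto.
  - intros t Ht. nra. }
assert (Hz1sq : forall x, 0 <= x -> 1 <= z1 x * z1 x).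
{ intros x Hx; replace 1 with (z1 0 * z1 0) by (rewrite z10; ring).
  apply (derive_nonneg_le (fun t => z1 t * z1 t) (fun t => (t * z t) * z1 t + z1 t * (t * z t))); auto.
  - intros t Ht; apply is_derive_mul; auto.
  - intros t Ht; pose proof (Hzz t (proj1 Ht)).
    nra. }
assert (Hz1 : forall x, 0 <= x -> 1 <= z1 x).
{ intros x Hx; destruct (Rle_or_lt 0 (z1 x)) as [H|H]; [pose proof (Hz1sq x Hx); nra|exfalso].
  destruct (IVT_gen z1 0 x 0) as [c [Hc Hc0]].
  - intros t; apply continuous_pt; exact (is_derive_continuous _ _ _ (dz1 t)).
  - rewrite z10 Rmin_right ?Rmax_left; lra.
  - rewrite Rmin_left ?Rmax_right in Hc; auto.
    pose proof (Hz1sq c (proj1 Hc)); rewrite Hc0 in H0; lra. }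
assert (Hzx : forall x, 0 <= x -> x <= z x).
{ intros x Hx; assert (z 0 - 0 <= z x - x); [|rewrite z0 in H; lra].
  apply (derive_nonneg_le (fun t => z t - t) (fun t => z1 t - 1)); auto.
  - intros t Ht; apply is_derive_sub; auto using is_derive_idR.
  - intros t Ht; pose proof (Hz1 t (proj1 Ht)); lra. }
(* Integrating z'' = x z >= x^2 gives polynomial growth of z' and z, hence polynomial decay of the
   recessive solution. This is fast enough: it is used at arguments of size h^(-2/3). *)
assert (Hz13 : forall x, 0 <= x -> x ^ 3 / 3 <= z1 x).
{ intros x Hx; assert (z1 0 - 0 ^ 3 / 3 <= z1 x - x ^ 3 / 3); [|rewrite z10 in H; simpl in *; lra].
  apply (derive_nonneg_le (fun t => z1 t - t ^ 3 / 3) (fun t => t * z t - t ^ 2)); auto.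
  - intros t Ht; apply is_derive_sub; auto; auto_derive; trivial; simpl; field.
  - intros t Ht; pose proof (Hzx t (proj1 Ht)).
    nra. }
assert (Hz4 : forall x, 0 <= x -> x ^ 4 / 12 <= z x).
{ intros x Hx; assert (z 0 - 0 ^ 4 / 12 <= z x - x ^ 4 / 12); [|rewrite z0 in H; simpl in *; lra].
  apply (derive_nonneg_le (fun t => z t - t ^ 4 / 12) (fun t => z1 t - t ^ 3 / 3)); auto.
  - intros t Ht; apply is_derive_sub; auto; auto_derive; trivial; simpl; field.
  - intros t Ht; pose proof (Hz13 t (proj1 Ht)); lra. }
assert (zpos : forall x, 0 < x -> 0 < z x) by (intros x Hx; pose proof (Hzx x); lra).
assert (z1pos : forall x, 0 <= x -> 0 < z1 x) by (intros x Hx; pose proof (Hz1 x); lra).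
assert (inc1 : forall s t, 0 <= s <= t -> y1 s / z1 s <= y1 t / z1 t).
{ intros s t Hst.
  apply (derive_nonneg_le (fun t => y1 t / z1 t) (fun t => t / (z1 t * z1 t))); [lra| |].
  - intros u Hu; assert (0 < z1 u) by (apply z1pos; lra).
    eapply is_derive_eq; [apply (is_derive_div y1 z1); eauto; lra|].
    simpl. transitivity (u * (y u * z1 u - z u * y1 u) / (z1 u * z1 u)); [field; lra|].
    rewrite W; field; lra.
  - intros u Hu; assert (0 < z1 u) by (apply z1pos; lra).
    apply Rdiv_le_0_compat; [lra|nra]. }
assert (dec0 : forall s t, 0 < s <= t -> y t / z t <= y s / z s).
{ intros s t Hst; apply Ropp_le_cancel.
  apply (derive_nonneg_le (fun t => - (y t / z t)) (fun t => 1 / (z t * z t))); [lra| |].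
  - intros u Hu; assert (0 < z u) by (apply zpos; lra).
    eapply is_derive_eq; [apply (is_derive_neg (fun t => y t / z t)), (is_derive_div y z); eauto; lra|].
    unfold opp; simpl. transitivity ((y u * z1 u - z u * y1 u) / (z u * z u)); [field; lra|].
    rewrite W; reflexivity.
  - intros u Hu; assert (0 < z u) by (apply zpos; lra).
    apply Rdiv_le_0_compat; [lra|nra]. }
assert (cross : forall s, 0 < s -> y s / z s - y1 s / z1 s = 1 / (z s * z1 s)).
{ intros s Hs; rewrite -(W s); field; split; apply Rgt_not_eq; [apply z1pos; lra|apply zpos; lra]. }
(* The slope [m] is the supremum of the increasing ratios y'/z'; the decreasing ratios y/z stay
   above it, and the gap between the two is 1/(z z') by the Wronskian. *)
destruct (completeness (fun v => exists s, 0 <= s /\ v = y1 s / z1 s)) as [m [Hm1 Hm2]].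
{ exists (y 1 / z 1); intros v [s [Hs ->]].
  apply Rle_trans with (y1 (s + 1) / z1 (s + 1)); [apply inc1; lra|].
  apply Rle_trans with (y (s + 1) / z (s + 1)); [|apply dec0; lra].
  pose proof (cross (s + 1)).
  assert (0 < 1 / (z (s + 1) * z1 (s + 1))); [|lra].
  apply Rdiv_lt_0_compat; [lra|apply Rmult_lt_0_compat; [apply zpos; lra|apply z1pos; lra]]. }
{ exists (y1 0 / z1 0), 0; split; [lra|reflexivity]. }
assert (lo : forall s, 0 < s -> y1 s / z1 s <= m).
{ intros s Hs; apply Hm1; exists s; split; [lra|reflexivity]. }
assert (hi : forall s, 0 < s -> m <= y s / z s).
{ intros s Hs; apply Hm2; intros v [t [Ht ->]].
  set (u := Rmax s t); assert (s <= u) by apply Rmax_l; assert (t <= u) by apply Rmax_r.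
  apply Rle_trans with (y1 u / z1 u); [apply inc1; lra|].
  apply Rle_trans with (y u / z u); [|apply dec0; lra].
  pose proof (cross u); assert (0 < 1 / (z u * z1 u)); [|lra].
  apply Rdiv_lt_0_compat; [lra|apply Rmult_lt_0_compat; [apply zpos; lra|apply z1pos; lra]]. }
exists (fun x => y x - m * z x), (fun x => y1 x - m * z1 x).
split; [|split; [rewrite y0 z0; ring|]].
- intros x; split.
  + apply is_derive_sub; auto. eapply is_derive_eq; [apply is_derive_mul; eauto using is_derive_cst|cbv beta; ring].
  + eapply is_derive_eq; [apply is_derive_sub; auto; apply is_derive_mul; eauto using is_derive_cst|cbv beta; ring].
- intros x Hx.
  assert (0 < z x) by (apply zpos; lra); assert (0 < z1 x) by (apply z1pos; lra).
  assert (L := lo x ltac:(lra)); assert (U := hi x ltac:(lra)); assert (Cr := cross x ltac:(lra)).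
  (* The squeeze turns into 0 <= e <= 1/z' and |e'| <= 1/z, so the growth of z and z' gives the
     decay. *)
  assert (A1 : y x - m * z x = z x * (y x / z x - m)) by (field; lra).
  assert (A2 : y1 x - m * z1 x = - (z1 x * (m - y1 x / z1 x))) by (field; lra).
  assert (x3 : 0 < x ^ 3) by (apply pow_lt; lra); assert (x4 : 0 < x ^ 4) by pos.
  split.
  + rewrite A1 Rabs_pos_eq; [|pos].
    apply Rle_trans with (z x * (1 / (z x * z1 x))); [apply Rmult_le_compat_l; lra|].
    replace (z x * (1 / (z x * z1 x))) with (/ z1 x) by (field; lra).
    apply Rle_trans with (/ (x ^ 3 / 3)).
    * apply Rinv_le_contravar; [lra|apply Hz13; lra].
    * replace (/ (x ^ 3 / 3)) with (3 / x ^ 3) by (field; lra).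
      apply Rmult_le_compat_r; [left; apply Rinv_0_lt_compat; auto|lra].
  + rewrite A2 Rabs_Ropp Rabs_pos_eq; [|pos].
    apply Rle_trans with (z1 x * (1 / (z x * z1 x))); [apply Rmult_le_compat_l; lra|].
    replace (z1 x * (1 / (z x * z1 x))) with (/ z x) by (field; lra).
    apply Rle_trans with (/ (x ^ 4 / 12)).
    * apply Rinv_le_contravar; [lra|apply Hz4; lra].
    * replace (/ (x ^ 4 / 12)) with (12 / x ^ 4) by (field; lra); lra.
Qed.

(** The antiderivative of c/k^7 makes [X] a Cauchy function with tail below c/k^6. The limit is
    obtained as the supremum of the lower bounds [X k - c / k ^ 6]. *)
Lemma limit_of_derive_bound (X x : R -> R) (c : R) : 0 <= c ->
  (forall k, 1 <= k -> is_derive X k (x k)) ->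
  (forall k, 1 <= k -> Rabs (x k) <= c / k ^ 7) ->
  exists l, forall k, 1 <= k -> Rabs (X k - l) <= c / k ^ 6.
Proof.
intros Hc HX Hx.
assert (Hp : forall k n, 1 <= k -> 0 < k ^ n) by (intros; apply pow_lt; lra).
assert (D : forall s t, 1 <= s <= t -> Rabs (X t - X s) <= c / s ^ 6 - c / t ^ 6).
{ intros s t Hst.
  apply Rle_trans with ((- (c / 6) / t ^ 6) - (- (c / 6) / s ^ 6)).
  - apply (derive_abs_le X (fun t => - (c / 6) / t ^ 6) x (fun k => c / k ^ 7)); [lra| | |].
    + intros; apply HX; lra.
    + intros k Hk; pose proof (Hp k 1%nat ltac:(lra)); auto_derive; [apply (Rgt_not_eq _ _ (Hp k 6%nat ltac:(lra)))|simpl; field; lra].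
    + intros; apply Hx; lra.
  - assert (0 <= c / s ^ 6 - c / t ^ 6).
    { assert (/ t ^ 6 <= / s ^ 6).
      { apply Rinv_le_contravar; [apply Hp; lra|apply pow_incr; lra]. }
      unfold Rdiv; rewrite -Rmult_minus_distr_l; pos. }
    unfold Rdiv in *; lra. }
assert (pos : forall k, 1 <= k -> 0 <= c / k ^ 6).
{ intros; apply Rdiv_le_0_compat; auto. }
destruct (completeness (fun v => exists k, 1 <= k /\ v = X k - c / k ^ 6)) as [l [Hl1 Hl2]].
{ exists (X 1 + c / 1 ^ 6); intros v [k [Hk ->]].
  pose proof (D 1 k ltac:(lra)) as H; apply Rabs_le_between in H; pose proof (pos k Hk); lra. }
{ exists (X 1 - c / 1 ^ 6), 1; split; [lra|reflexivity]. }
exists l; intros k Hk; apply Rabs_le_between; split.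
- assert (l <= X k + c / k ^ 6); [|lra].
  apply Hl2; intros v [s [Hs ->]].
  pose proof (pos k Hk); pose proof (pos s Hs).
  destruct (Rle_or_lt s k) as [H1|H1].
  + pose proof (D s k ltac:(lra)) as H2; apply Rabs_le_between in H2; lra.
  + pose proof (D k s ltac:(lra)) as H2; apply Rabs_le_between in H2; lra.
- assert (X k - c / k ^ 6 <= l); [|lra].
  apply Hl1; exists k; auto.
Qed.

Lemma polar (x y : R) : x <> 0 \/ y <> 0 ->
  exists kappa theta, 0 < kappa /\ x = kappa * sin theta /\ y = kappa * cos theta.
Proof.
intros H; set (k := sqrt (x ^ 2 + y ^ 2)).
assert (Hp : 0 < x ^ 2 + y ^ 2).
{ destruct H as [H|H]; apply pow2_gt_0 in H; pose proof (pow2_ge_0 x); pose proof (pow2_ge_0 y); lra. }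
assert (Hk : 0 < k) by (apply sqrt_lt_R0; auto).
assert (Hk2 : k ^ 2 = x ^ 2 + y ^ 2) by (unfold k; rewrite pow2_sqrt; lra).
assert (Hy : -1 <= y / k <= 1).
{ split; [apply Rle_div_r|apply Rle_div_l]; nra. }
assert (Hs : sqrt (1 - (y / k)²) = Rabs x / k).
{ replace (1 - (y / k)²) with ((x / k)²).
  - rewrite sqrt_Rsqr_abs Rabs_div; [|lra]; rewrite (Rabs_pos_eq k); lra.
  - unfold Rsqr; apply Rmult_eq_reg_r with (k ^ 2); [|nra].
    field_simplify; [|lra|lra]; nra. }
exists k; destruct (Rle_or_lt 0 x) as [Hx|Hx].
- exists (acos (y / k)); split; [auto|]; rewrite sin_acos // cos_acos // Hs Rabs_pos_eq //.
  split; field; lra.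
- exists (- acos (y / k)); split; [auto|]; rewrite sin_neg cos_neg sin_acos // cos_acos // Hs Rabs_left //.
  split; field; lra.
Qed.

(* In the variable k = t^(1/4) the WKB amplitudes of a solution e(t) are integer powers of k. *)
Lemma airy_oscillation (e e1 : R -> R) :
  (forall t, is_derive e t (e1 t) /\ is_derive e1 t (- t * e t)) -> e 0 = 1 ->
  exists kappa theta C, 0 < kappa /\ 0 < C /\ forall k, 1 <= k ->
    Rabs (k * e (k ^ 4) - kappa * sin (2 / 3 * k ^ 6 + theta)) <= C / k ^ 6 /\
    Rabs (e1 (k ^ 4) / k - kappa * cos (2 / 3 * k ^ 6 + theta)) <= C / k ^ 6.
Proof.
intros He e0; assert (de := fun t => proj1 (He t)); assert (de1 := fun t => proj2 (He t)).
(* The value [e 0 = 1] excludes the zero solution; Gronwall carries this to t = 1, where the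
   variable k starts. *)
assert (nz : 0 < e 1 ^ 2 + e1 1 ^ 2).
{ destruct (exp_growth (fun t => e t ^ 2 + e1 t ^ 2) (fun t => 2 * (1 - t) * (e t * e1 t)) 1 0 1) as [H _]; [lra| |].
  - intros t Ht; split.
    + eapply is_derive_eq; [apply is_derive_add; apply (is_derive_pow _ 2); eauto|simpl; ring].
    + assert (0 <= (1 - t) * (e t + e1 t) ^ 2) by pos. assert (0 <= (1 - t) * (e t - e1 t) ^ 2) by pos.
      assert (0 <= t * (e t ^ 2 + e1 t ^ 2)) by pos. apply Rabs_le; lra.
  - cbv beta in H; rewrite e0 in H; pose proof (pow2_ge_0 (e1 0)).
    apply Rmult_lt_reg_l with (exp (1 * (1 - 0))); [apply exp_pos|lra]. }
set (a := fun k => k * e (k ^ 4)).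
(* [b] is the derivative of [a] with respect to the phase [xi = 2/3 k^6], so that (a, b) rotates at
   unit speed in [xi], up to a perturbation of size k^(-7) in k. *)
set (b := fun k => e1 (k ^ 4) / k + e (k ^ 4) / (4 * k ^ 5)).
assert (dek : forall f f1 k, is_derive f (k ^ 4) f1 -> is_derive (fun k => f (k ^ 4)) k (f1 * (4 * k ^ 3))).
{ intros f f1 k Hf; apply (is_derive_compR f (fun k => k ^ 4)); auto.
  auto_derive; trivial; simpl; ring. }
assert (da : forall k, 1 <= k -> is_derive a k (4 * k ^ 5 * b k)).
{ intros k Hk; eapply is_derive_eq.
  - apply is_derive_mul; [apply is_derive_idR|apply dek, de].
  - unfold b; field; lra. }
assert (db : forall k, 1 <= k -> is_derive b k (- (4 * k ^ 5 * a k) - 5 / 4 * a k / k ^ 7)).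
{ intros k Hk; assert (k <> 0) by lra; assert (4 * k ^ 5 <> 0).
  { assert (0 < k ^ 5) by (apply pow_lt; lra); lra. }
  eapply is_derive_eq.
  - apply is_derive_add.
    + apply (is_derive_div (fun k => e1 (k ^ 4)) (fun k => k)); [apply dek, de1|apply is_derive_idR|auto].
    + apply (is_derive_div (fun k => e (k ^ 4)) (fun k => 4 * k ^ 5)); [apply dek, de| |auto].
      instantiate (1 := 20 * k ^ 4); auto_derive; trivial; simpl; ring.
  - unfold a; simpl; field; auto. }
set (xi := fun k => 2 / 3 * k ^ 6).
assert (dxi : forall k, is_derive xi k (4 * k ^ 5)).
{ intros k; unfold xi; auto_derive; trivial; simpl; field. }
assert (dsin : forall k, is_derive (fun k => sin (xi k)) k (cos (xi k) * (4 * k ^ 5))).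
{ intros k; apply (is_derive_compR sin xi); auto; apply is_derive_sin. }
assert (dcos : forall k, is_derive (fun k => cos (xi k)) k (- sin (xi k) * (4 * k ^ 5))).
{ intros k; apply (is_derive_compR cos xi); auto; apply is_derive_cos. }
(* Coordinates of (a, b) in the rotating frame: only the integrable perturbation is left in their
   derivatives, so they converge. *)
set (X := fun k => a k * cos (xi k) - b k * sin (xi k)).
set (Y := fun k => a k * sin (xi k) + b k * cos (xi k)).
assert (dX : forall k, 1 <= k -> is_derive X k (5 / 4 * a k * sin (xi k) / k ^ 7)).
{ intros k Hk; eapply is_derive_eq.
  - apply is_derive_sub; apply is_derive_mul; auto.
  - cbv beta; field; lra. }
assert (dY : forall k, 1 <= k -> is_derive Y k (- (5 / 4 * a k * cos (xi k) / k ^ 7))).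
{ intros k Hk; eapply is_derive_eq.
  - apply is_derive_add; apply is_derive_mul; auto.
  - cbv beta; field; lra. }
set (N := fun k => a k * a k + b k * b k).
assert (dN : forall k, 1 <= k -> is_derive N k (- (5 / 2 * (a k * b k) / k ^ 7))).
{ intros k Hk; eapply is_derive_eq.
  - apply is_derive_add; apply is_derive_mul; auto.
  - cbv beta; field; lra. }
assert (NXY : forall k, N k = X k ^ 2 + Y k ^ 2).
{ intros k; unfold N, X, Y. pose proof (sin2_cos2 (xi k)) as H; unfold Rsqr in H.
  transitivity ((a k * a k + b k * b k) * (sin (xi k) * sin (xi k) + cos (xi k) * cos (xi k)));
    [rewrite H; ring|ring]. }
assert (Hpk : forall k n, 1 <= k -> 0 < / k ^ n <= 1).
{ intros k n Hk; split; [apply Rinv_0_lt_compat, pow_lt; lra|].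
  rewrite -Rinv_1; apply Rinv_le_contravar; [lra|apply pow_R1_Rle; auto]. }
assert (dinv : forall k, 1 <= k -> is_derive (fun k => / k ^ 6) k (- 6 * / k ^ 7)).
{ intros k Hk; auto_derive; [apply (Rgt_not_eq _ _ (pow_lt k 6 ltac:(lra)))|simpl; field; lra]. }
(* Since |N'| <= 5/4 N/k^7, the factor 1 + k^(-6), with derivative -6 k^(-7), makes the product with
   N decrease; in [Nlo] the factor 2 - k^(-6) makes it increase. *)
assert (Nhi : forall k, 1 <= k -> N k <= 2 * N 1).
{ intros k Hk. assert (0 <= N k) by (unfold N; nra).
  assert (- (N 1 * (1 + / 1 ^ 6)) <= - (N k * (1 + / k ^ 6))).
  { apply (derive_nonneg_le (fun k => - (N k * (1 + / k ^ 6)))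
      (fun k => - (- (5 / 2 * (a k * b k) / k ^ 7) * (1 + / k ^ 6) + N k * (0 + - 6 * / k ^ 7)))); auto.
    - intros t Ht; apply (is_derive_neg (fun k => N k * (1 + / k ^ 6))).
      apply (is_derive_mul N (fun k => 1 + / k ^ 6)); [apply dN; lra|apply (is_derive_add (fun _ => 1) (fun k => / k ^ 6)); [apply is_derive_cst|apply dinv; lra]].
    - intros t Ht; pose proof (Hpk t 6%nat ltac:(lra)); pose proof (Hpk t 7%nat ltac:(lra)).
      assert (Hab : - N t <= 2 * (a t * b t) <= N t) by (unfold N; pose proof (pow2_ge_0 (a t + b t)); pose proof (pow2_ge_0 (a t - b t)); lra).
      replace (- (- (5 / 2 * (a t * b t) / t ^ 7) * (1 + / t ^ 6) + N t * (0 + -6 * / t ^ 7)))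
        with (/ t ^ 7 * (6 * N t + 5 / 4 * (2 * (a t * b t)) * (1 + / t ^ 6))) by (field; lra).
      apply Rmult_le_pos; [lra|nra]. }
  rewrite pow1 Rinv_1 in H0. pose proof (Hpk k 6%nat Hk). nra. }
assert (Nlo : forall k, 1 <= k -> N 1 / 2 <= N k).
{ intros k Hk. assert (0 <= N k) by (unfold N; nra).
  assert (N 1 * (2 - / 1 ^ 6) <= N k * (2 - / k ^ 6)).
  { apply (derive_nonneg_le (fun k => N k * (2 - / k ^ 6))
      (fun k => - (5 / 2 * (a k * b k) / k ^ 7) * (2 - / k ^ 6) + N k * (0 - - 6 * / k ^ 7))); auto.
    - intros t Ht; apply (is_derive_mul N (fun k => 2 - / k ^ 6)); [apply dN; lra|apply (is_derive_sub (fun _ => 2) (fun k => / k ^ 6)); [apply is_derive_cst|apply dinv; lra]].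
    - intros t Ht; pose proof (Hpk t 6%nat ltac:(lra)); pose proof (Hpk t 7%nat ltac:(lra)).
      assert (Hab : - N t <= 2 * (a t * b t) <= N t) by (unfold N; pose proof (pow2_ge_0 (a t + b t)); pose proof (pow2_ge_0 (a t - b t)); lra).
      replace (- (5 / 2 * (a t * b t) / t ^ 7) * (2 - / t ^ 6) + N t * (0 - -6 * / t ^ 7))
        with (/ t ^ 7 * (6 * N t - 5 / 4 * (2 * (a t * b t)) * (2 - / t ^ 6))) by (field; lra).
      apply Rmult_le_pos; [lra|nra]. }
  rewrite pow1 Rinv_1 in H0. pose proof (Hpk k 6%nat Hk). nra. }
assert (N1 : 0 < N 1).
{ unfold N, a, b; rewrite !pow1.
  replace (1 * e 1 * (1 * e 1) + (e1 1 / 1 + e 1 / (4 * 1)) * (e1 1 / 1 + e 1 / (4 * 1)))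
    with (e 1 ^ 2 + (e1 1 + e 1 / 4) ^ 2) by field.
  nra. }
set (c := sqrt (2 * N 1)).
assert (Hc : 0 < c) by (apply sqrt_lt_R0; lra).
assert (Hc2 : c * c = 2 * N 1) by (apply sqrt_sqrt; lra).
assert (Ha : forall k, 1 <= k -> Rabs (a k) <= c).
{ intros k Hk; apply Rsqr_incr_0_var; [|lra]. rewrite -Rsqr_abs; unfold Rsqr.
  pose proof (Nhi k Hk); rewrite Hc2; unfold N in *; nra. }
assert (Hsc : forall k x, 1 <= k -> Rabs x <= 1 -> Rabs (5 / 4 * a k * x / k ^ 7) <= (2 * c) / k ^ 7).
{ intros k x Hk Hx; pose proof (Hpk k 7%nat Hk).
  unfold Rdiv at 1 3; rewrite Rabs_mult (Rabs_pos_eq (/ k ^ 7)); [|lra].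
  apply Rmult_le_compat_r; [lra|].
  apply Rle_trans with (5 / 4 * c * 1); [|lra].
  apply Rabs_le_mult; auto; apply Rabs_le_mult; auto; rewrite Rabs_pos_eq; lra. }
destruct (limit_of_derive_bound X _ (2 * c) ltac:(lra) dX) as [lX HX].
{ intros k Hk; apply Hsc; auto; apply Rabs_le; apply SIN_bound. }
destruct (limit_of_derive_bound Y _ (2 * c) ltac:(lra) dY) as [lY HY].
{ intros k Hk; rewrite Rabs_Ropp; apply Hsc; auto; apply Rabs_le; apply COS_bound. }
destruct (polar lX lY) as (kappa & theta & Hkappa & EX & EY).
{ apply Classical_Prop.NNPP; intros Hn; apply Classical_Prop.not_or_and in Hn.
  destruct Hn as [Hn1 Hn2]; apply Classical_Prop.NNPP in Hn1, Hn2; subst lX lY.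
  (* A zero limit would give N(k) <= 8 c^2/k; this k is large enough to contradict N(k) >=
     N(1)/2. *)
  set (k := 1 + 32 * c * c / N 1).
  assert (Hk : 1 <= k).
  { unfold k; assert (0 <= 32 * c * c / N 1); [apply Rdiv_le_0_compat; nra|lra]. }
  specialize (HX k Hk); specialize (HY k Hk); rewrite Rminus_0_r in HX, HY.
  assert (N k <= 8 * c * c / k).
  { rewrite NXY.
    assert (P : forall x, Rabs x <= 2 * c / k ^ 6 -> x ^ 2 <= 4 * c * c / k).
    { intros x Hx; rewrite -(pow2_abs x); pose proof (Rabs_pos x).
      assert (Rabs x ^ 2 <= (2 * c / k ^ 6) ^ 2) by (apply pow_incr; auto).
      replace ((2 * c / k ^ 6) ^ 2) with (4 * c * c / k * / k ^ 11) in H0 by (field; lra).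
      pose proof (Hpk k 11%nat Hk).
      nra. }
    pose proof (P _ HX); pose proof (P _ HY). unfold Rdiv in *; lra. }
  pose proof (Nlo k Hk).
  assert (N 1 / 2 * k <= 8 * c * c).
  { apply Rle_trans with (8 * c * c / k * k); [apply Rmult_le_compat_r; lra|right; field; lra]. }
  assert (N 1 / 2 * k = N 1 / 2 + 16 * c * c) by (unfold k; field; lra). nra. }
exists kappa, theta, (4 * c + c); split; [auto|split; [lra|]].
intros k Hk; specialize (HX k Hk); specialize (HY k Hk).
pose proof (Hpk k 6%nat Hk).
assert (S1 : forall x, Rabs (sin x) <= 1) by (intros; apply Rabs_le, SIN_bound).
assert (C1 : forall x, Rabs (cos x) <= 1) by (intros; apply Rabs_le, COS_bound).
assert (Q : forall p q u v, Rabs p <= 2 * c / k ^ 6 -> Rabs q <= 2 * c / k ^ 6 -> Rabs u <= 1 -> Rabs v <= 1 ->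
  Rabs (p * u + q * v) <= 4 * c / k ^ 6).
{ intros p q u v Hp Hq Hu Hv; pose proof (Rabs_le_mult _ _ _ _ Hp Hu); pose proof (Rabs_le_mult _ _ _ _ Hq Hv).
  pose proof (Rabs_triang (p * u) (q * v)). unfold Rdiv in *; lra. }
pose proof (sin2_cos2 (xi k)) as SC; unfold Rsqr in SC.
assert (ak : a k = X k * cos (xi k) + Y k * sin (xi k)).
{ unfold X, Y; transitivity (a k * (sin (xi k) * sin (xi k) + cos (xi k) * cos (xi k))); [rewrite SC; ring|ring]. }
assert (bk : b k = Y k * cos (xi k) + X k * - sin (xi k)).
{ unfold X, Y; transitivity (b k * (sin (xi k) * sin (xi k) + cos (xi k) * cos (xi k))); [rewrite SC; ring|ring]. }
fold (xi k); rewrite sin_plus cos_plus.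
assert (0 <= c / k ^ 6) by pos.
split.
- fold (a k); rewrite ak.
  replace (X k * cos (xi k) + Y k * sin (xi k) - kappa * (sin (xi k) * cos theta + cos (xi k) * sin theta))
    with ((X k - lX) * cos (xi k) + (Y k - lY) * sin (xi k)) by (rewrite EX EY; ring).
  pose proof (Q _ _ (cos (xi k)) (sin (xi k)) HX HY (C1 _) (S1 _)). unfold Rdiv in *; lra.
(* [e1 (k ^ 4) / k] and [b] differ by a/(4 k^6), which is of the order of the error and accounts for
   the summand [+ c] of the constant. *)
- replace (e1 (k ^ 4) / k) with (b k - a k * / (4 * k ^ 6)) by (unfold b, a; field; lra).
  rewrite bk.
  replace (Y k * cos (xi k) + X k * - sin (xi k) - a k * / (4 * k ^ 6) -
      kappa * (cos (xi k) * cos theta - sin (xi k) * sin theta))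
    with (((Y k - lY) * cos (xi k) + (X k - lX) * - sin (xi k)) - a k * / (4 * k ^ 6)) by (rewrite EX EY; ring).
  assert (Rabs (- sin (xi k)) <= 1) by (rewrite Rabs_Ropp; auto).
  pose proof (Q _ _ (cos (xi k)) (- sin (xi k)) HY HX (C1 _) H1).
  assert (Rabs (a k * / (4 * k ^ 6)) <= c * / k ^ 6).
  { apply Rabs_le_mult; auto; rewrite Rinv_mult Rabs_pos_eq; lra. }
  eapply Rle_trans; [apply Rabs_triang|]; rewrite Rabs_Ropp; unfold Rdiv in *; lra.
Qed.

(** The Airy equation is reflected so that t > 0 is the oscillatory side, as z > 0 is on the side
    where f g > 0. Here [e] is a positive multiple of Ai(-t); the value of [theta] is left open. *)
Lemma airy_recessive : exists (e e1 : R -> R) (kappa theta C : R), 0 < kappa /\ 0 < C /\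
  (forall t, is_derive e t (e1 t) /\ is_derive e1 t (- t * e t)) /\
  (forall x, 1 <= x -> Rabs (e (- x)) <= C / x ^ 3 /\ Rabs (e1 (- x)) <= C / x ^ 4) /\
  (forall k, 1 <= k ->
    Rabs (k * e (k ^ 4) - kappa * sin (2 / 3 * k ^ 6 + theta)) <= C / k ^ 6 /\
    Rabs (e1 (k ^ 4) / k - kappa * cos (2 / 3 * k ^ 6 + theta)) <= C / k ^ 6).
Proof.
destruct airy_decay as (y & y1 & Hy & y0 & Hd).
assert (De : forall t, is_derive (fun t => y (- t)) t (- y1 (- t)) /\
                  is_derive (fun t => - y1 (- t)) t (- t * y (- t))).
{ intros t; assert (Dn : is_derive (fun t => - t) t (-1)) by (auto_derive; trivial; ring).
  split; eapply is_derive_eq.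
  - apply (is_derive_compR y (fun t => - t) t (y1 (- t)) (-1)); [exact (proj1 (Hy (- t)))|exact Dn].
  - ring.
  - apply is_derive_neg, (is_derive_compR y1 (fun t => - t) t (- t * y (- t)) (-1)); [exact (proj2 (Hy (- t)))|exact Dn].
  - unfold opp; simpl; ring. }
destruct (airy_oscillation _ _ De) as (kappa & theta & C & Hk & HC & H).
{ cbv beta; rewrite Ropp_0; auto. }
exists (fun t => y (- t)), (fun t => - y1 (- t)), kappa, theta, (C + 12).
split; [auto|split; [lra|split; [exact De|split]]].
- intros x Hx; rewrite Ropp_involutive Rabs_Ropp; destruct (Hd x Hx) as [H3 H4].
  assert (forall n, 12 / x ^ n <= (C + 12) / x ^ n).
  { intros n; apply Rmult_le_compat_r; [left; apply Rinv_0_lt_compat, pow_lt; lra|lra]. }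
  split; [pose proof (H0 3%nat)|pose proof (H0 4%nat)]; lra.
- intros k Hk1; destruct (H k Hk1) as [H3 H4].
  assert (C / k ^ 6 <= (C + 12) / k ^ 6).
  { apply Rmult_le_compat_r; [left; apply Rinv_0_lt_compat, pow_lt; lra|lra]. }
  split; lra.
Qed.

(** * Langer's change of variable at a simple turning point *)

Lemma C2b_scal (a b M k : R) (u u1 u2 : R -> R) : 0 <= k -> C2b a b M u u1 u2 ->
  C2b a b (k * M) (fun x => k * u x) (fun x => k * u1 x) (fun x => k * u2 x).
Proof.
intros Hk Hu x Hx; destruct (Hu x Hx) as (du & du1 & cu2 & bu & bu1 & bu2).
split; [|split; [|split; [|repeat split]]].
- apply is_derive_cmul; exact du.
- apply is_derive_cmul; exact du1.
- apply continuousZ; auto.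
- apply Rabs_le_mult; auto; rewrite Rabs_pos_eq; lra.
- apply Rabs_le_mult; auto; rewrite Rabs_pos_eq; lra.
- apply Rabs_le_mult; auto; rewrite Rabs_pos_eq; lra.
Qed.

Lemma C2b_continuous (a b M : R) (u u1 u2 : R -> R) (x : R) :
  C2b a b M u u1 u2 -> a < x < b -> continuous u x.
Proof. intros H Hx; exact (is_derive_continuous _ _ _ (proj1 (H x Hx))). Qed.

Lemma C2b_le (a b M : R) (u u1 u2 : R -> R) (x : R) :
  C2b a b M u u1 u2 -> a < x < b -> u x <= M.
Proof. intros H Hx; apply Rle_trans with (Rabs (u x)); [apply Rle_abs|apply (H x Hx)]. Qed.

Lemma C2b_Rpower_lower (c M q : R) : 0 < c -> 0 < M -> exists c' M', 0 < c' /\ 0 < M' /\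
  forall a b u u1 u2, C2b a b M u u1 u2 -> (forall x, a < x < b -> c <= u x) ->
  exists v1 v2, C2b a b M' (fun x => Rpower (u x) q) v1 v2 /\
   (forall x, v1 x = q * u1 x * Rpower (u x) (q - 1)) /\
   (forall x, a < x < b -> c' <= Rpower (u x) q).
Proof.
intros Hc HM; destruct (C2b_Rpower c M q Hc HM) as (M' & HM' & H).
exists (exp (- (Rabs q * (Rabs (ln c) + Rabs (ln M))))), M'.
split; [apply exp_pos|split; auto]; intros a b u u1 u2 Hu Hc'.
eexists; eexists; split; [apply (H _ _ _ _ _ Hu Hc')|split; [reflexivity|]].
intros x Hx; apply Rpower_bounds; auto; split; auto; eapply C2b_le; eauto.
Qed.

(* The mean value property [3 K + 2 (x - al) K' = H] of the average [K] of [H = sqrt (G / (x - al))]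
   makes [z = (x - al) (3 K)^(2/3)] a smooth solution of [z z'^2 = G] through the turning point. *)
Lemma langer (c M r : R) : 0 < c -> 0 < M -> exists c' M', 0 < c' /\ 0 < M' /\
  forall al f f1 f2 G G1 G2 G3,
  C2b (al - r) (al + r) M f f1 f2 -> C2b (al - r) (al + r) M G1 G2 G3 ->
  (forall x, al - r < x < al + r -> is_derive G x (G1 x)) -> G al = 0 ->
  (forall x, al - r < x < al + r -> c <= f x /\ c <= G1 x) ->
  exists z z1 m m1 chi, forall x, al - r < x < al + r ->
    is_derive z x (z1 x) /\ c' <= z1 x <= M' /\ z x * z1 x ^ 2 = G x /\
    (exists w, c' <= w <= M' /\ z x = (x - al) * w) /\
    is_derive m x (m1 x) /\ m x ^ 2 * z1 x = f x /\ c' <= m x <= M' /\ Rabs (m1 x) <= M' /\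
    is_derive (fun y => m1 y / f y) x (chi x) /\ Rabs (chi x) <= M'.
Proof.
intros Hc HM.
(* Bounds come before functions, so the construction is first run on constants: H is a square root,
   B = K^(-1/3), W = K^(2/3), z' = H B, then 1/z', m = (f/z')^(1/2) and 1/f. *)
destruct (C2b_Rpower_lower c (2 * M) (1 / 2) Hc ltac:(lra)) as (cH & MH & HcH & HMH & PH).
destruct (C2b_Rpower_lower cH (3 * MH) (- (1 / 3)) HcH ltac:(lra)) as (cB & MB & HcB & HMB & PB).
destruct (C2b_Rpower_lower cH (3 * MH) (2 / 3) HcH ltac:(lra)) as (cW & MW & HcW & HMW & PW).
set (Mz := 4 * MH * MB); assert (HMz : 0 < Mz) by (unfold Mz; pos).
set (cz := cH * cB); assert (Hcz : 0 < cz) by (unfold cz; pos).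
destruct (C2b_Rpower_lower cz Mz (-1) Hcz HMz) as (ci & Mi & Hci & HMi & Pi).
set (Mm := 4 * M * Mi); assert (HMm : 0 < Mm) by (unfold Mm; pos).
set (cm := c * ci); assert (Hcm : 0 < cm) by (unfold cm; pos).
destruct (C2b_Rpower_lower cm Mm (1 / 2) Hcm HMm) as (cr & Mr & Hcr & HMr & Pr).
destruct (C2b_Rpower_lower c M (-1) Hc HM) as (cf & Mf & Hcf & HMf & Pf).
assert (HMx : 0 < Mr * Mf) by pos.
exists (Rmin (Rmin cz cW) cr), (Mz + MW + Mr + 2 * (Mr * Mf)).
assert (cc : Rmin (Rmin cz cW) cr <= cz /\ Rmin (Rmin cz cW) cr <= cW /\ Rmin (Rmin cz cW) cr <= cr).
{ pose proof (Rmin_l (Rmin cz cW) cr); pose proof (Rmin_r (Rmin cz cW) cr);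
  pose proof (Rmin_l cz cW); pose proof (Rmin_r cz cW); lra. }
split; [repeat apply Rmin_glb_lt; auto|split; [lra|]].
intros al f f1 f2 G G1 G2 G3 Hf HG1 dG Gal Hlow.
assert (Cf := fun x Hx => proj1 (Hlow x Hx)); assert (CG := fun x Hx => proj2 (Hlow x Hx)).
assert (cG1 : forall y, al - r < y < al + r -> continuous G1 y).
{ intros; eapply C2b_continuous; eauto. }
pose proof (C2b_scal _ _ _ 2 _ _ _ ltac:(lra) (C2b_had _ _ _ 1 _ _ _ HG1)) as Hq.
assert (Lq : forall x, al - r < x < al + r -> c <= 2 * had al 1 G1 x).
{ intros x Hx; pose proof (had_lower al r c 1 G1 x cG1 CG Hx) as H; replace (INR 2) with 2 in H by (simpl; lra); lra. }
destruct (PH _ _ _ _ _ Hq Lq) as (H1 & H2 & HH & _ & LH).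
set (H := fun x => Rpower (2 * had al 1 G1 x) (1 / 2)) in HH, LH.
pose proof (C2b_scal _ _ _ 3 _ _ _ ltac:(lra) (C2b_had _ _ _ 2 _ _ _ HH)) as HK.
(* This [K] includes the factor 3, so z = (x - al) K^(2/3). *)
set (K := fun x => 3 * had al 2 H x) in HK.
assert (cHc : forall y, al - r < y < al + r -> continuous H y).
{ intros; eapply C2b_continuous; eauto. }
assert (LK : forall x, al - r < x < al + r -> cH <= K x).
{ intros x Hx; pose proof (had_lower al r cH 2 H x cHc LH Hx) as L; replace (INR 3) with 3 in L by (simpl; lra); unfold K; lra. }
destruct (PB _ _ _ _ _ HK LK) as (B1 & B2 & HB & _ & LB).
destruct (PW _ _ _ _ _ HK LK) as (W1 & W2 & HW & EW & LW).
pose proof (C2b_mult _ _ _ _ _ _ _ _ _ _ HH HB) as Hz1; cbv beta in Hz1.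
set (z1 := fun x => H x * Rpower (K x) (- (1 / 3))) in Hz1.
fold Mz in Hz1; set (z2 := fun x => _) in Hz1 at 1; set (z3 := fun x => _) in Hz1 at 1.
assert (Lz1 : forall x, al - r < x < al + r -> cz <= z1 x).
{ intros x Hx; exact (Rmult_le_compat _ _ _ _ (Rlt_le _ _ HcH) (Rlt_le _ _ HcB) (LH x Hx) (LB x Hx)). }
destruct (Pi _ _ _ _ _ Hz1 Lz1) as (i1 & i2 & Hi & _ & Li).
pose proof (C2b_mult _ _ _ _ _ _ _ _ _ _ Hf Hi) as Hmu; fold Mm in Hmu.
assert (Lmu : forall x, al - r < x < al + r -> cm <= f x * Rpower (z1 x) (-1)).
{ intros x Hx; exact (Rmult_le_compat _ _ _ _ (Rlt_le _ _ Hc) (Rlt_le _ _ Hci) (Cf x Hx) (Li x Hx)). }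
destruct (Pr _ _ _ _ _ Hmu Lmu) as (m1 & m2 & Hm & _ & Lm).
destruct (Pf _ _ _ _ _ Hf Cf) as (g1 & g2 & Hg & _ & Lg).
set (m := fun x => Rpower (f x * Rpower (z1 x) (-1)) (1 / 2)) in Hm, Lm.
exists (fun x => (x - al) * Rpower (K x) (2 / 3)), z1, m, m1,
  (fun x => m2 x * Rpower (f x) (-1) + m1 x * g1 x).
intros x Hx.
assert (Kx : 0 < K x) by (specialize (LK x Hx); lra).
assert (z1x : 0 < z1 x) by (specialize (Lz1 x Hx); lra).
assert (fx : 0 < f x) by (specialize (Cf x Hx); lra).
assert (K13 : Rpower (K x) (2 / 3) = K x * Rpower (K x) (- (1 / 3))).
{ rewrite -{2}(Rpower_1 (K x)) // -Rpower_plus; f_equal; lra. }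
split; [|split; [|split; [|split; [|split; [|split; [|split; [|split; [|split]]]]]]]].
- eapply is_derive_eq.
  + apply (is_derive_mul (fun x => x - al)).
    * apply is_derive_sub; [apply is_derive_idR|apply is_derive_cst].
    * exact (proj1 (HW x Hx)).
  + rewrite EW; cbv beta; unfold z1.
    replace (2 / 3 - 1) with (- (1 / 3)) by field.
    rewrite K13.
    (* With m = 3 this reads K + (2/3)(x - al) K' = H, so the derivative of (x - al) K^(2/3)
       collapses to H K^(-1/3), which is [z1]. *)
    assert (I := had_ibp al r 3 H H1 x (fun y Hy => proj1 (HH y Hy))
       (fun y Hy => is_derive_continuous _ _ _ (proj1 (proj2 (HH y Hy)))) Hx).
    rewrite pow_ne_zero in I; [|lia].
    replace (INR 3) with 3 in I by (simpl; lra).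
    change (had al 4 H1 x) with (had al (2 + 2) H1 x) in I; change (pred 3) with 2%nat in I; fold (K x) in I; unfold Rdiv.
    replace (H x) with (K x + 2 * (x - al) * had al (2 + 2) H1 x) by lra. field.
- split; [specialize (Lz1 x Hx); lra|]. pose proof (C2b_le _ _ _ _ _ _ x Hz1 Hx). lra.
- unfold z1.
  assert (Hq2 : H x * H x = 2 * had al 1 G1 x).
  { unfold H; rewrite -Rpower_plus; replace (1 / 2 + 1 / 2) with 1 by field.
    apply Rpower_1; specialize (Lq x Hx); lra. }
  assert (K0 : Rpower (K x) (2 / 3) * (Rpower (K x) (- (1 / 3)) * Rpower (K x) (- (1 / 3))) = 1).
  { rewrite -!Rpower_plus; replace (2 / 3 + (- (1 / 3) + - (1 / 3))) with 0 by field.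
    apply Rpower_O; auto. }
  (* The powers of K cancel in z z'^2, leaving (x - al) H^2, which is G by the case m = 0. *)
  assert (F := had_ibp al r 0 G G1 x dG cG1 Hx); rewrite Gal in F; simpl in F.
  transitivity ((x - al) * (H x * H x) * (Rpower (K x) (2 / 3) * (Rpower (K x) (- (1 / 3)) * Rpower (K x) (- (1 / 3)))));
    [ring|rewrite K0 Hq2; lra].
- exists (Rpower (K x) (2 / 3)); split; [|reflexivity].
  pose proof (C2b_le _ _ _ _ _ _ x HW Hx). specialize (LW x Hx). lra.
- exact (proj1 (Hm x Hx)).
- unfold m; rewrite /= Rmult_1_r -Rpower_plus; replace (1 / 2 + 1 / 2) with 1 by field.
  assert (0 < Rpower (z1 x) (-1)) by apply exp_pos.
  rewrite Rpower_1; [|apply Rmult_lt_0_compat; auto].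
  rewrite Rpower_Ropp Rpower_1; auto; field; lra.
- split; [exact (Rle_trans _ _ _ (proj2 (proj2 cc)) (Lm x Hx))|].
  apply Rle_trans with Mr; [exact (C2b_le _ _ _ _ _ _ x Hm Hx)|lra].
- apply Rle_trans with Mr; [exact (proj1 (proj2 (proj2 (proj2 (proj2 (Hm x Hx))))))|lra].
- apply (is_derive_local (fun y => m1 y * Rpower (f y) (-1)) _ (al - r) (al + r)); auto.
  + intros y Hy; unfold Rdiv; rewrite Rpower_Ropp Rpower_1; auto; specialize (Cf y Hy); lra.
  + cbv beta; apply (is_derive_mul m1 (fun y => Rpower (f y) (-1))); [exact (proj1 (proj2 (Hm x Hx)))|exact (proj1 (Hg x Hx))].
- eapply Rle_trans; [apply Rabs_triang|].
  destruct (Hm x Hx) as (_ & _ & _ & _ & bm1 & bm2), (Hg x Hx) as (_ & _ & _ & bg & bg1 & _).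
  pose proof (Rabs_le_mult _ _ _ _ bm2 bg); pose proof (Rabs_le_mult _ _ _ _ bm1 bg1).
  lra.
Qed.

(** * The connection formula at a turning point *)

Definition zs_system (a b : R) (f g : R -> R) (h : R) (Q P : R -> R) : Prop :=
  forall x, a < x < b -> is_derive Q x (f x * P x / h) /\ is_derive P x (- (g x * Q x / h)).

(** The forbidden side is on the left, since f > 0 and f g increases through 0. The lower bound on
    (f g)' is what Langer's variable needs; the one on (g/f)' makes the energy P^2 + (g/f) Q^2
    strictly controlled, with derivative at least c Q^2. *)
Definition simple_turning (c M r al : R) (f g : R -> R) : Prop :=
  exists f1 f2 G1 G2 G3 W1, C2b (al - r) (al + r) M f f1 f2 /\ C2b (al - r) (al + r) M G1 G2 G3 /\
    g al = 0 /\ forall x, al - r < x < al + r ->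
      is_derive (fun y => f y * g y) x (G1 x) /\ is_derive (fun y => g y / f y) x (W1 x) /\
      c <= f x /\ c <= G1 x /\ c <= W1 x.

(** The two terms of size 1/h, from P P' and from (g/f) Q Q', cancel; only the derivative of the
    coefficient g/f remains. *)
Lemma zs_energy (f g W1 Q P : R -> R) (h x : R) : h <> 0 -> f x <> 0 ->
  is_derive Q x (f x * P x / h) -> is_derive P x (- (g x * Q x / h)) ->
  is_derive (fun y => g y / f y) x (W1 x) ->
  is_derive (fun y => P y ^ 2 + g y / f y * Q y ^ 2) x (W1 x * Q x ^ 2).
Proof.
intros Hh Hf dQ dP dW; eapply is_derive_eq.
- apply is_derive_add; [apply (is_derive_pow _ 2), dP|].
  apply (is_derive_mul (fun y => g y / f y)); [exact dW|apply (is_derive_pow _ 2), dQ].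
- simpl; field; auto.
Qed.

Lemma energy_le_norm (w W q p : R) : 0 <= w <= W -> p ^ 2 + w * q ^ 2 <= ((1 + W) * (Rabs q + Rabs p)) ^ 2.
Proof.
intros Hw; rewrite -(pow2_abs p) -(pow2_abs q).
pose proof (Rabs_pos q) as Hq; pose proof (Rabs_pos p) as Hp; revert Hq Hp.
generalize (Rabs q) (Rabs p); clear q p; intros q p Hq Hp.
assert (w * q ^ 2 <= W * q ^ 2) by (apply Rmult_le_compat_r; pos).
replace (((1 + W) * (q + p)) ^ 2) with (p ^ 2 + W * q ^ 2 +
  (q ^ 2 + 2 * (q * p) + W * q ^ 2 + (2 * W + W ^ 2) * (p ^ 2 + 2 * (q * p)) + W ^ 2 * q ^ 2)) by ring.
assert (0 <= q ^ 2 + 2 * (q * p) + W * q ^ 2 + (2 * W + W ^ 2) * (p ^ 2 + 2 * (q * p)) + W ^ 2 * q ^ 2) by pos.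
lra.
Qed.

(** Starting from QP >= 0, the quantities QP, Q^2 and P^2 all increase to the right. Two successive
    gains of size 1/h, first of QP from Q(al - r)^2 and then of P^2 from QP, show that Q(al - r) is
    small compared with P(al). *)
Lemma forbidden_growth (c M r al h : R) (f g Q P : R -> R) : 0 < c -> 0 < M -> 0 < r -> 0 < h ->
  (forall x, al - r <= x <= al -> is_derive Q x (f x * P x / h) /\ is_derive P x (- (g x * Q x / h))) ->
  (forall x, al - r <= x <= al -> 0 <= f x /\ c * (al - x) <= M * - g x) ->
  0 <= Q (al - r) * P (al - r) ->
  P (al - r) ^ 2 <= P al ^ 2 /\
  Q (al - r) ^ 2 <= 64 * M ^ 2 / (c ^ 2 * r ^ 4) * h ^ 2 * P al ^ 2.
Proof.
intros Hc HM Hr Hh Hs Hfg H0.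
assert (gneg : forall x, al - r <= x <= al -> g x <= 0).
{ intros x Hx; destruct (Hfg x Hx) as [_ H]; assert (0 <= c * (al - x)) by pos; nra. }
assert (Hi : 0 < / h) by pos.
assert (dS : forall x, al - r <= x <= al ->
  is_derive (fun y => Q y * P y) x (/ h * (f x * P x ^ 2 + - g x * Q x ^ 2))).
{ intros x Hx; destruct (Hs x Hx) as [dQ dP]; eapply is_derive_eq; [apply is_derive_mul; eauto|].
  field; lra. }
assert (dQ2 : forall x, al - r <= x <= al -> is_derive (fun y => Q y ^ 2) x (/ h * (2 * f x * (Q x * P x)))).
{ intros x Hx; destruct (Hs x Hx) as [dQ dP]; eapply is_derive_eq; [apply (is_derive_pow _ 2); eauto|].
  simpl; field; lra. }
assert (dP2 : forall x, al - r <= x <= al -> is_derive (fun y => P y ^ 2) x (/ h * (2 * - g x * (Q x * P x)))).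
{ intros x Hx; destruct (Hs x Hx) as [dQ dP]; eapply is_derive_eq; [apply (is_derive_pow _ 2); eauto|].
  simpl; field; lra. }
assert (S0 : forall x, al - r <= x <= al -> 0 <= Q x * P x).
{ intros x Hx; eapply Rle_trans; [exact H0|].
  apply (derive_nonneg_le (fun y => Q y * P y) (fun x => / h * (f x * P x ^ 2 + - g x * Q x ^ 2))); [lra| |].
  - intros t Ht; apply dS; lra.
  - intros t Ht; apply Rmult_le_pos; [lra|].
    assert (0 <= f t) by (apply Hfg; lra). pose proof (gneg t ltac:(lra)).
    pos. }
assert (Qm : forall x, al - r <= x <= al -> Q (al - r) ^ 2 <= Q x ^ 2).
{ intros x Hx.
  apply (derive_nonneg_le (fun y => Q y ^ 2) (fun x => / h * (2 * f x * (Q x * P x)))); [lra| |].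
  - intros t Ht; apply dQ2; lra.
  - intros t Ht; apply Rmult_le_pos; [lra|].
    assert (0 <= f t) by (apply Hfg; lra).
    apply Rmult_le_pos; [lra|apply S0; lra]. }
assert (Pm : forall x y, al - r <= x <= y -> y <= al -> P x ^ 2 <= P y ^ 2).
{ intros x y Hx Hy.
  apply (derive_nonneg_le (fun y => P y ^ 2) (fun x => / h * (2 * - g x * (Q x * P x)))); [lra| |].
  - intros t Ht; apply dP2; lra.
  - intros t Ht; apply Rmult_le_pos; [lra|].
    pose proof (gneg t ltac:(lra)).
    apply Rmult_le_pos; [lra|apply S0; lra]. }
split; [apply Pm; lra|].
(* Lower bound of -g up to al - r/4. The gains are taken over [al - r, al - r/2] and
   [al - r/2, al - r/4], of lengths r/2 and r/4; this produces the constant 64. *)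
set (g0 := c * r / (4 * M)).
assert (Hg0 : 0 < g0) by (unfold g0; pos).
assert (Hg : forall x, al - r <= x <= al - r / 4 -> g0 <= - g x).
{ intros x Hx; destruct (Hfg x ltac:(lra)) as [_ H]; unfold g0.
  apply Rle_div_l; [lra|]. assert (c * (r / 4) <= c * (al - x)) by (apply Rmult_le_compat_l; lra). lra. }
set (q := Q (al - r) ^ 2) in *; assert (Hq : 0 <= q) by apply pow2_ge_0.
set (s1 := / h * (g0 * q) * (r / 2)).
assert (0 <= / h * (g0 * q)) by pos.
assert (Hs1p : 0 <= s1) by (unfold s1; pos).
assert (S1 : s1 <= Q (al - r / 2) * P (al - r / 2)).
{ assert (Q (al - r) * P (al - r) - / h * (g0 * q) * (al - r)
      <= Q (al - r / 2) * P (al - r / 2) - / h * (g0 * q) * (al - r / 2)); [|unfold s1; lra].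
  apply (derive_nonneg_le (fun y => Q y * P y - / h * (g0 * q) * y)
     (fun x => / h * (f x * P x ^ 2 + - g x * Q x ^ 2) - / h * (g0 * q))); [lra| |].
  - intros t Ht; apply is_derive_sub; [apply dS; lra|].
    apply is_derive_lin.
  - intros t Ht; rewrite -Rmult_minus_distr_l; apply Rmult_le_pos; [lra|].
    assert (0 <= f t) by (apply Hfg; lra).
    assert (0 <= f t * P t ^ 2) by pos.
    assert (g0 * q <= - g t * Q t ^ 2).
    { apply Rmult_le_compat; auto; [lra|apply Hg; lra|apply Qm; lra]. }
    lra. }
assert (S2 : forall x, al - r / 2 <= x <= al -> s1 <= Q x * P x).
{ intros x Hx; eapply Rle_trans; [exact S1|].
  apply (derive_nonneg_le (fun y => Q y * P y) (fun x => / h * (f x * P x ^ 2 + - g x * Q x ^ 2))); [lra| |].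
  - intros t Ht; apply dS; lra.
  - intros t Ht; apply Rmult_le_pos; [lra|].
    assert (0 <= f t) by (apply Hfg; lra). pose proof (gneg t ltac:(lra)).
    pos. }
assert (P2 : / h * (2 * g0 * s1) * (r / 4) <= P al ^ 2).
{ apply Rle_trans with (P (al - r / 4) ^ 2); [|apply Pm; lra].
  assert (P (al - r / 2) ^ 2 - / h * (2 * g0 * s1) * (al - r / 2)
      <= P (al - r / 4) ^ 2 - / h * (2 * g0 * s1) * (al - r / 4)).
  { apply (derive_nonneg_le (fun y => P y ^ 2 - / h * (2 * g0 * s1) * y)
     (fun x => / h * (2 * - g x * (Q x * P x)) - / h * (2 * g0 * s1))); [lra| |].
    - intros t Ht; apply is_derive_sub; [apply dP2; lra|].
      apply is_derive_lin.
    - intros t Ht; rewrite -Rmult_minus_distr_l; apply Rmult_le_pos; [lra|].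
      assert (g0 * s1 <= - g t * (Q t * P t)); [|lra].
      apply Rmult_le_compat; auto; [lra|apply Hg; lra|apply S2; lra]. }
  pose proof (pow2_ge_0 (P (al - r / 2))). lra. }
assert (E : / h * (2 * g0 * s1) * (r / 4) = q / (64 * M ^ 2 / (c ^ 2 * r ^ 4) * h ^ 2)).
{ unfold s1, g0; field; lra. }
rewrite E in P2.
assert (0 < 64 * M ^ 2 / (c ^ 2 * r ^ 4) * h ^ 2) by pos.
set (w := 64 * M ^ 2 / (c ^ 2 * r ^ 4) * h ^ 2) in *.
apply Rle_trans with (w * (q / w)); [right; field; lra|apply Rmult_le_compat_l; lra].
Qed.

(** Both sides vanish at [al] and have derivative sqrt(z) z' to its right. The square root is not
    differentiable at z = 0, so at [al] itself only continuity is used. *)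
Lemma langer_action (al r : R) (z z1 G : R -> R) (x : R) :
  (forall y, al - r < y < al + r -> is_derive z y (z1 y) /\ 0 < z1 y /\ z y * z1 y ^ 2 = G y /\
     continuous G y /\ exists w, 0 < w /\ z y = (y - al) * w) ->
  al < x < al + r -> RInt (fun t => sqrt (G t)) al x = 2 / 3 * (z x * sqrt (z x)) :> R.
Proof.
intros Hz Hx.
assert (zal : z al = 0).
{ destruct (Hz al ltac:(lra)) as (_ & _ & _ & _ & w & _ & Hw); rewrite Hw; ring. }
assert (zpos : forall y, al < y < al + r -> 0 < z y).
{ intros y Hy; destruct (Hz y ltac:(lra)) as (_ & _ & _ & _ & w & Hw0 & Hw); rewrite Hw.
  pos. }
assert (csG : forall y, al - r < y < al + r -> continuous (fun t => sqrt (G t)) y).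
{ intros y Hy; apply (continuous_comp G sqrt); [apply (Hz y Hy)|apply continuous_sqrt]. }
assert (dI : forall y, al <= y < al + r -> is_derive (fun y => RInt (fun t => sqrt (G t)) al y) y (sqrt (G y))).
{ intros y Hy; apply (is_derive_RInt_interval (al - r) (al + r) al y (fun t => sqrt (G t))); auto; lra. }
destruct (MVT_gen (fun y => RInt (fun t => sqrt (G t)) al y - 2 / 3 * (z y * sqrt (z y))) al x (fun _ => 0)) as [c [_ Hc]].
- rewrite Rmin_left ?Rmax_right; try lra; intros y Hy.
  assert (Hzy : 0 < z y) by (apply zpos; lra).
  destruct (Hz y ltac:(lra)) as (dz & z1p & zz & _).
  assert (ds : is_derive (fun y => sqrt (z y)) y (/ (2 * sqrt (z y)) * z1 y)).
  { apply (is_derive_compR sqrt z); auto; apply is_derive_Reals, derivable_pt_lim_sqrt; auto. }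
  eapply is_derive_eq.
  + apply is_derive_sub; [apply dI; lra|].
    apply is_derive_mul; [apply is_derive_cst|apply is_derive_mul; eauto].
  + assert (0 < sqrt (z y)) by pos.
    rewrite -zz sqrt_mult ?sqrt_pow2; try lra; [|apply pow2_ge_0].
    pose proof (sqrt_sqrt (z y) ltac:(lra)) as E.
    transitivity (sqrt (z y) * z1 y - 2 / 3 * (z1 y * sqrt (z y) + (sqrt (z y) * sqrt (z y)) * (/ (2 * sqrt (z y)) * z1 y)));
      [rewrite E; ring|field; lra].
- rewrite Rmin_left ?Rmax_right; try lra; intros y Hy; apply continuous_pt.
  apply (continuous_minus (V := R_NormedModule)).
  + exact (is_derive_continuous _ _ _ (dI y ltac:(lra))).
  + apply continuousZ, continuousM.
    * exact (is_derive_continuous _ _ _ (proj1 (Hz y ltac:(lra)))).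
    * apply (continuous_comp z sqrt); [|apply continuous_sqrt].
      exact (is_derive_continuous _ _ _ (proj1 (Hz y ltac:(lra)))).
- simpl in Hc; rewrite RInt_point zal in Hc; unfold zero in Hc; simpl in Hc; lra.
Qed.

(** With k = (f/g)^(1/4) the WKB form is Q = k sin, P = cos / k, up to a common factor; the
    inequality says that the vector (Q/k, P k) has the direction of phase action/h + theta up to
    O(h). It is homogeneous in (Q, P), and [C], [h0] depend on [c], [M], [r] only. *)
Definition is_connection_phase (theta : R) : Prop :=
  forall c M r, 0 < c -> 0 < M -> 0 < r -> exists C h0, 0 < C /\ 0 < h0 /\
  forall al f g h Q P k, simple_turning c M (2 * r) al f g -> 0 < h <= h0 ->
    zs_system (al - 2 * r) (al + 2 * r) f g h Q P -> 0 <= Q (al - r) * P (al - r) ->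
    0 < k -> k ^ 4 * g (al + r) = f (al + r) ->
    Rabs (Q (al + r) / k * cos (RInt (fun x => sqrt (f x * g x)) al (al + r) / h + theta)
          - P (al + r) * k * sin (RInt (fun x => sqrt (f x * g x)) al (al + r) / h + theta))
    <= C * h * (Rabs (Q (al + r)) + Rabs (P (al + r))).

Lemma pow4_lt (u v : R) : 0 < u -> u < v -> u ^ 4 < v ^ 4.
Proof.
intros Hu Huv; assert (u ^ 2 < v ^ 2) by nra; assert (0 < u ^ 2) by nra.
replace (u ^ 4) with (u ^ 2 * u ^ 2) by ring; replace (v ^ 4) with (v ^ 2 * v ^ 2) by ring; nra.
Qed.

Lemma pow4_inj (x y : R) : 0 < x -> 0 < y -> x ^ 4 = y ^ 4 -> x = y.
Proof.
intros Hx Hy H; destruct (Rtotal_order x y) as [E|[E|E]]; auto.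
- pose proof (pow4_lt x y Hx E); lra.
- pose proof (pow4_lt y x Hy E); lra.
Qed.

Lemma root6 (h : R) : 0 < h -> exists eta, 0 < eta /\ eta ^ 6 = h.
Proof.
intros Hh; exists (Rpower h (1 / 6)); split; [apply exp_pos|].
rewrite -Rpower_pow; [|apply exp_pos]; rewrite Rpower_mult.
replace (1 / 6 * INR 6) with 1 by (simpl; field); apply Rpower_1; auto.
Qed.

(* In terms of eta = h^(1/6) only integer powers occur: h^(2/3) = eta^4, and WKB amplitudes of
   the Airy function are powers of z^(1/4) / eta. *)
Lemma airy_quasimode (f g z z1 m m1 chi e e1 : R -> R) (h eta x : R) :
  0 < eta -> eta ^ 6 = h -> (forall t, is_derive e t (e1 t) /\ is_derive e1 t (- t * e t)) ->
  f x <> 0 -> m x <> 0 -> z1 x <> 0 ->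
  is_derive z x (z1 x) -> is_derive m x (m1 x) -> is_derive (fun y => m1 y / f y) x (chi x) ->
  z x * z1 x ^ 2 = f x * g x -> m x ^ 2 * z1 x = f x ->
  let Qh := fun y => m y * e (z y / eta ^ 4) in
  let Ph := fun y => h * (m1 y / f y) * e (z y / eta ^ 4) + eta ^ 2 / m y * e1 (z y / eta ^ 4) in
  is_derive Qh x (f x * Ph x / h) /\
  is_derive Ph x (- (g x * Qh x / h) + h * chi x * e (z x / eta ^ 4)).
Proof.
intros He Hh Hair Hf Hm Hz1 dz dm dchi Ez Em Qh Ph.
assert (dT : is_derive (fun y => z y / eta ^ 4) x (z1 x / eta ^ 4)).
{ eapply is_derive_eq; [apply is_derive_mul; [exact dz|apply is_derive_cst]|cbv beta; field; lra]. }
assert (de : is_derive (fun y => e (z y / eta ^ 4)) x (e1 (z x / eta ^ 4) * (z1 x / eta ^ 4))).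
{ apply (is_derive_compR e (fun y => z y / eta ^ 4)); auto; apply Hair. }
assert (de1 : is_derive (fun y => e1 (z y / eta ^ 4)) x (- (z x / eta ^ 4) * e (z x / eta ^ 4) * (z1 x / eta ^ 4))).
{ apply (is_derive_compR e1 (fun y => z y / eta ^ 4)); auto; apply Hair. }
assert (eta <> 0) by lra.
set (T := z x / eta ^ 4) in *.
split.
- eapply is_derive_eq; [apply is_derive_mul; [exact dm|exact de]|].
  unfold Ph; fold T. rewrite -{1}Em -Hh; cbv beta.
  transitivity (m1 x * e T + m x * z1 x / eta ^ 4 * e1 T); [field; auto|].
  replace (m x ^ 2 * z1 x * (eta ^ 6 * (m1 x / f x) * e T + eta ^ 2 / m x * e1 T) / eta ^ 6)
    with ((m x ^ 2 * z1 x) / f x * (m1 x * e T) + m x * z1 x / eta ^ 4 * e1 T) by (field; auto).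
  rewrite Em; field; auto.
- eapply is_derive_eq.
  + apply is_derive_add.
    * apply (is_derive_mul (fun y => h * (m1 y / f y))); [|exact de].
      apply is_derive_mul; [apply is_derive_cst|exact dchi].
    * apply (is_derive_mul (fun y => eta ^ 2 / m y)); [|exact de1].
      apply (is_derive_div (fun _ => eta ^ 2) m x 0 (m1 x)); auto using is_derive_cst.
  + fold T; cbv beta. unfold Qh; fold T.
    (* Eliminating g by Langer's equation cancels all terms except the one with [chi], which carries
       the full factor h. *)
    assert (Eg : g x = z x * z1 x / m x ^ 2).
    { apply Rmult_eq_reg_l with (f x); auto; rewrite -Ez -Em; field; auto. }
    rewrite Eg -Em -Hh; generalize (e T) (e1 T); intros E E1; unfold T; simpl; field.
    repeat split; auto.
Qed.

(** The Wronskian D with the quasimode has derivative h chi e Q, so the integral of |e Q| has to be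
    bounded. Pointwise bounds are avoided: by the inequality of arithmetic and geometric means |e Q|
    is dominated by e^2 and Q^2, and both are controlled by exact derivatives, of the Airy energy J
    = e'^2 + t e^2 and of the energy E of the solution. Only end values of J and E remain. *)
Lemma connection : exists theta, is_connection_phase theta.
Proof.
destruct airy_recessive as (e & e1 & kap & th & CA & Hkap & HCA & Hair & Hdec & Hosc).

(* Constants depending on c, M and r alone *)
exists th; intros c M r Hc HM Hr.
destruct (langer c M (2 * r) Hc HM) as (c' & M' & Hc' & HM' & Hlan).
(* h <= d^2 gives eta^4 = h^(2/3) <= d, so that both ends, where |z| >= c' r, fall into the range
   |t| >= 1 in which the bounds for [e] hold. *)
set (d := Rmin 1 (c' * r)).
assert (Hd : 0 < d) by (apply Rmin_glb_lt; [lra|apply Rmult_lt_0_compat; auto]).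
assert (Hd1 : d <= 1) by apply Rmin_l.
assert (Hdc : d <= c' * r) by apply Rmin_r.
assert (Hc'r : 0 < c' * r) by pos.
assert (HM'r : 0 < M' * r) by pos.
set (W0 := M' ^ 3 * r / c ^ 2).
assert (HW0 : 0 < W0) by (unfold W0; pos).
set (Cq := 64 * M ^ 2 / (c ^ 2 * r ^ 4)).
assert (HCq : 0 < Cq) by (unfold Cq; pos).
set (y0 := sqrt (sqrt (c' * r))); set (y1 := sqrt (sqrt (M' * r))).
assert (Hy0 : 0 < y0) by (apply sqrt_lt_R0, sqrt_lt_R0; auto).
assert (Hy1 : 0 < y1) by (apply sqrt_lt_R0, sqrt_lt_R0; auto).
set (C1 := M' / 2 * ((2 * y1 ^ 2 * (kap + CA) ^ 2 + CA ^ 2) / c' + (1 + W0 * Cq) / c)).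
assert (HC1 : 0 < C1) by (unfold C1; pos).
set (C2 := CA / (c' * r) ^ 2 * ((1 + Cq) * (M' / c + 1 / c') + M')).
assert (HC2 : 0 < C2) by (unfold C2; pos).
(* One summand for each of the four error terms [t1] to [t4] below. *)
set (C3 := y1 * (C1 + C2) * (1 + W0) + M' * (kap + CA) / c + y1 ^ 2 * CA / (c' * y0 ^ 6) + M' * CA / y0 ^ 6).
assert (HC3 : 0 < C3) by (unfold C3; pos).
exists (C3 / (kap * y0)), (d ^ 2).
split; [pos|split; [pos|]].

(* The solution in the forbidden region *)
intros al f g h Q P k (f1 & f2 & G1 & G2 & G3 & W1 & Hf & HG1 & gal & Hst) Hh Hsys HQP Hk Hkg.
destruct (root6 h ltac:(lra)) as (eta & Heta & Heta6).
assert (Hh0 : 0 < h) by lra.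
assert (h1 : h <= 1) by nra.
assert (eta1 : eta <= 1).
{ destruct (Rle_or_lt eta 1) as [H|H]; auto. assert (1 < eta ^ 6) by (apply Rlt_pow_R1; auto; lia). lra. }
assert (eta4 : eta ^ 4 <= d).
{ destruct (Rle_or_lt (eta ^ 4) d) as [H|H]; auto; exfalso.
  assert (eta ^ 6 * eta ^ 2 <= eta ^ 6 * 1) by (apply Rmult_le_compat_l; nra).
  nra. }
assert (e4p : 0 < eta ^ 4) by pos.
destruct (Hlan al f f1 f2 (fun y => f y * g y) G1 G2 G3 Hf HG1) as (z & z1 & m & m1 & chi & HL).
{ intros x Hx; apply (Hst x Hx). }
{ cbv beta; rewrite gal; apply Rmult_0_r. }
{ intros x Hx; split; apply (Hst x Hx). }
assert (fp : forall x, al - 2 * r < x < al + 2 * r -> c <= f x) by (intros x Hx; apply (Hst x Hx)).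
assert (Gneg : forall x, al - r <= x <= al -> f x * g x <= - (c * (al - x))).
{ intros x Hx.
  assert (f x * g x - c * x <= f al * g al - c * al); [|rewrite gal in H; lra].
  apply (derive_nonneg_le (fun y => f y * g y - c * y) (fun y => G1 y - c)); [lra| |].
  - intros t Ht; apply is_derive_sub; [apply (Hst t); lra|].
    apply is_derive_lin.
  - intros t Ht; assert (c <= G1 t) by (apply (Hst t); lra). lra. }
assert (Hgrow := forbidden_growth c M r al h f g Q P Hc HM Hr Hh0).
destruct Hgrow as [Pa Qa]; auto.
{ intros x Hx; apply Hsys; lra. }
{ intros x Hx; pose proof (fp x ltac:(lra)); split; [lra|].
  pose proof (Gneg x Hx). pose proof (C2b_le _ _ _ _ _ _ x Hf ltac:(lra)).
  assert (0 <= c * (al - x)) by pos.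
  nra. }
fold Cq in Qa.

(* The energy of the solution, bounded by the data at the right end *)
set (E := fun y => P y ^ 2 + g y / f y * Q y ^ 2).
assert (dE : forall x, al - 2 * r < x < al + 2 * r -> is_derive E x (W1 x * Q x ^ 2)).
{ intros x Hx; pose proof (fp x Hx); apply (zs_energy f g W1 Q P h); try apply (Hsys x Hx); try lra.
  apply (Hst x Hx). }
set (xL := al + r) in *.
assert (Emon : forall x y, al - r <= x <= y -> y <= xL -> E x <= E y).
{ unfold xL; intros x y Hx Hy; apply (derive_nonneg_le E (fun x => W1 x * Q x ^ 2)); [lra| |].
  - intros t Ht; apply dE; lra.
  - intros t Ht; apply Rmult_le_pos; [|apply pow2_ge_0].
    assert (c <= W1 t) by (apply (Hst t); lra). lra. }
assert (Wb : forall x, al - 2 * r < x < al + 2 * r -> Rabs (x - al) <= r -> Rabs (g x / f x) <= W0).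
{ intros x Hx Hxr; destruct (HL x Hx) as (_ & bz1 & Ez & (w & bw & Ew) & _).
  pose proof (fp x Hx).
  replace (g x / f x) with (z x * z1 x ^ 2 * (/ f x) ^ 2) by (rewrite Ez; field; lra).
  rewrite Ew.
  replace W0 with (r * M' * M' ^ 2 * (/ c) ^ 2) by (unfold W0; field; lra).
  assert (Hab : forall u v, 0 < u <= v -> Rabs u <= v) by (intros; rewrite Rabs_pos_eq; lra).
  assert (0 < / f x <= / c).
  { split; [apply Rinv_0_lt_compat|apply Rinv_le_contravar]; lra. }
  repeat apply Rabs_le_mult; auto; try (apply Hab; lra); rewrite Rabs_R1; lra. }
assert (HxL : al - 2 * r < xL < al + 2 * r) by (unfold xL; lra).
assert (HxLr : Rabs (xL - al) <= r).
{ replace (xL - al) with r by (unfold xL; ring); rewrite Rabs_pos_eq; lra. }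
destruct (HL xL HxL) as (_ & bz1L & EzL & (wL & bwL & EwL) & _ & EmL & bmL & bm1L & _).
assert (fL := fp xL HxL).
assert (zLb : c' * r <= z xL <= M' * r).
{ rewrite EwL; replace (xL - al) with r by (unfold xL; ring).
  rewrite (Rmult_comm r); split; apply Rmult_le_compat_r; lra. }
assert (GL : 0 < f xL * g xL).
{ rewrite -EzL; apply Rmult_lt_0_compat; [lra|apply pow_lt; lra]. }
assert (WL : 0 < g xL / f xL).
{ apply Rdiv_lt_0_compat; [|lra]. apply Rmult_lt_reg_l with (f xL); lra. }
set (T := Rabs (Q xL) + Rabs (P xL)).
assert (HT : 0 <= T) by (pose proof (Rabs_pos (Q xL)); pose proof (Rabs_pos (P xL)); unfold T; lra).
assert (ELb : E xL <= ((1 + W0) * T) ^ 2).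
{ apply energy_le_norm; pose proof (Wb xL HxL HxLr) as Hb; rewrite Rabs_pos_eq in Hb; lra. }
(* The zero solution is set aside because the weights below divide by the square root of the
   energy. *)
destruct (Req_dec T 0) as [HT0|HT0].
{ assert (Q xL = 0 /\ P xL = 0) as [-> ->].
  { pose proof (Rabs_pos (Q xL)); pose proof (Rabs_pos (P xL)); unfold T in HT0.
    split; apply Classical_Prop.NNPP; intros Hn; apply Rabs_pos_lt in Hn; lra. }
  rewrite HT0; unfold Rdiv; rewrite !Rmult_0_l Rminus_0_r Rabs_R0; lra. }
assert (EL : 0 < E xL).
{ unfold E; destruct (Req_dec (Q xL) 0) as [HQ|HQ].
  - rewrite HQ; assert (P xL <> 0).
    { intros HP; apply HT0; unfold T; rewrite HQ HP Rabs_R0; ring. }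
    assert (0 < P xL ^ 2) by (apply pow2_gt_0; auto). lra.
  - assert (0 < Q xL ^ 2) by (apply pow2_gt_0; auto).
    assert (0 < g xL / f xL * Q xL ^ 2) by pos.
    pose proof (pow2_ge_0 (P xL)); lra. }
set (Rg := sqrt (E xL)).
assert (HR : 0 < Rg) by (apply sqrt_lt_R0; auto).
assert (HR2 : Rg ^ 2 = E xL) by (unfold Rg; rewrite pow2_sqrt; lra).
assert (HRT : Rg <= (1 + W0) * T) by (apply le_of_sq; [pos|lra]).

(* The left end, where the quasimode is small *)
set (a := al - r) in *.
assert (Ha : al - 2 * r < a < al + 2 * r) by (unfold a; lra).
assert (Har : Rabs (a - al) <= r).
{ replace (a - al) with (- r) by (unfold a; ring); rewrite Rabs_Ropp Rabs_pos_eq; lra. }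
(* At the turning point g vanishes and the energy is P^2, so monotonicity passes the size at the
   right end on to the forbidden region. *)
assert (Pal : P al ^ 2 <= Rg ^ 2).
{ rewrite HR2; apply Rle_trans with (E al); [|apply Emon; unfold a, xL; lra].
  unfold E; rewrite gal; unfold Rdiv; lra. }
assert (h2 : h ^ 2 <= 1) by (rewrite -(pow1 2); apply pow_incr; lra).
assert (Qa2 : Q a ^ 2 <= Cq * Rg ^ 2).
{ eapply Rle_trans; [exact Qa|]. rewrite Rmult_assoc; apply Rmult_le_compat_l; [lra|].
  rewrite -(Rmult_1_l (Rg ^ 2)); apply Rmult_le_compat; auto; apply pow2_ge_0. }
assert (Paabs : Rabs (P a) <= Rg) by (apply Rabs_le_of_sq; lra).
assert (Qaabs : Rabs (Q a) <= (1 + Cq) * Rg).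
{ apply Rabs_le_of_sq; [pos|].
  replace (((1 + Cq) * Rg) ^ 2) with (Cq * Rg ^ 2 + (1 + Cq + Cq ^ 2) * Rg ^ 2) by ring.
  assert (0 <= (1 + Cq + Cq ^ 2) * Rg ^ 2) by pos. lra. }
(* Left of [al] the coefficient g/f is negative, so the energy has no sign there; the bound on Q(a)
   limits it from below. *)
assert (Eal : - E a <= W0 * Cq * Rg ^ 2).
{ unfold E; pose proof (Wb a Ha Har) as Hb; apply Rabs_le_between in Hb.
  assert (- (g a / f a) * Q a ^ 2 <= W0 * Q a ^ 2) by (apply Rmult_le_compat_r; [apply pow2_ge_0|lra]).
  assert (W0 * Q a ^ 2 <= W0 * (Cq * Rg ^ 2)) by (apply Rmult_le_compat_l; lra).
  pose proof (pow2_ge_0 (P a)). lra. }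
destruct (HL a Ha) as (_ & bz1a & Eza & (wa & bwa & Ewa) & _ & Ema & bma & bm1a & _).
assert (fa := fp a Ha).
set (X := r * wa / eta ^ 4).
assert (Tz : z a / eta ^ 4 = - X).
{ unfold X; rewrite Ewa; replace (a - al) with (- r) by (unfold a; ring); field; lra. }
assert (XX : c' * r / eta ^ 4 <= X).
{ unfold X, Rdiv; apply Rmult_le_compat_r; [left; apply Rinv_0_lt_compat; auto|].
  rewrite Rmult_comm; apply Rmult_le_compat_l; lra. }
assert (X1 : 1 <= X).
{ eapply Rle_trans; [|exact XX]. apply Rle_div_r; lra. }
assert (X2 : / X ^ 2 <= eta ^ 8 / (c' * r) ^ 2).
{ replace (eta ^ 8 / (c' * r) ^ 2) with (/ (c' * r / eta ^ 4) ^ 2) by (field; lra).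
  apply Rinv_le_contravar; [apply pow_lt, Rdiv_lt_0_compat; auto|].
  apply pow_incr; split; auto; left; pos. }
(* X is at least c' r / eta^4, so X^(-2) already gives eta^8; eta^7 is the order of the change of
   the Wronskian over the interval. *)
set (ep := CA / (c' * r) ^ 2 * eta ^ 7).
assert (Hep : forall n, (2 <= n)%nat -> CA / X ^ n <= ep).
{ intros n Hn; apply Rle_trans with (CA * / X ^ 2).
  - apply Rmult_le_compat_l; [lra|]; apply Rinv_le_contravar; [apply pow_lt; lra|apply Rle_pow; auto].
  - apply Rle_trans with (CA * (eta ^ 8 / (c' * r) ^ 2)); [apply Rmult_le_compat_l; lra|].
    unfold ep. assert (eta ^ 8 <= eta ^ 7).
    { replace (eta ^ 8) with (eta ^ 7 * eta) by ring.
      rewrite -{2}(Rmult_1_r (eta ^ 7)); apply Rmult_le_compat_l; [apply pow_le; lra|auto]. }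
    replace (CA * (eta ^ 8 / (c' * r) ^ 2)) with (CA / (c' * r) ^ 2 * eta ^ 8) by (field; lra).
    apply Rmult_le_compat_l; auto.
    apply Rlt_le, Rdiv_lt_0_compat; auto; apply pow_lt; auto. }
destruct (Hdec X X1) as [dec0 dec1].
assert (ea : Rabs (e (- X)) <= ep) by (eapply Rle_trans; [exact dec0|apply Hep; lia]).
assert (e1a : Rabs (e1 (- X)) <= ep) by (eapply Rle_trans; [exact dec1|apply Hep; lia]).

(* The Wronskian with the Airy quasimode *)
set (Qh := fun y => m y * e (z y / eta ^ 4)).
set (Ph := fun y => h * (m1 y / f y) * e (z y / eta ^ 4) + eta ^ 2 / m y * e1 (z y / eta ^ 4)).
set (D := fun y => Q y * Ph y - P y * Qh y).
assert (dD : forall x, al - 2 * r < x < al + 2 * r -> is_derive D x (h * chi x * e (z x / eta ^ 4) * Q x)).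
{ intros x Hx; destruct (HL x Hx) as (dz & bz1 & Ez & _ & dm & Em & bm & bm1 & dchi & bchi).
  pose proof (fp x Hx).
  destruct (airy_quasimode f g z z1 m m1 chi e e1 h eta x) as [dQh dPh]; auto; try lra.
  destruct (Hsys x Hx) as [dQ dP]; eapply is_derive_eq.
  - apply is_derive_sub; apply is_derive_mul; eauto.
  - cbv beta; unfold Qh, Ph; field; lra. }
set (J := fun y => e1 (z y / eta ^ 4) ^ 2 + z y / eta ^ 4 * e (z y / eta ^ 4) ^ 2).
assert (dJ : forall x, al - 2 * r < x < al + 2 * r -> is_derive J x (e (z x / eta ^ 4) ^ 2 * (z1 x / eta ^ 4))).
{ intros x Hx; destruct (HL x Hx) as (dz & _).
  apply (is_derive_compR (fun t => e1 t ^ 2 + t * e t ^ 2) (fun y => z y / eta ^ 4)).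
  - destruct (Hair (z x / eta ^ 4)) as [de de1]; eapply is_derive_eq.
    + apply is_derive_add; [apply (is_derive_pow _ 2), de1|].
      apply is_derive_mul; [apply is_derive_idR|apply (is_derive_pow _ 2), de].
    + cbv beta; simpl; ring.
  - eapply is_derive_eq; [apply is_derive_mul; [exact dz|apply is_derive_cst]|cbv beta; field; lra]. }
(* The weights of J and E balance the two terms: J is at most of order eta^(-2) and E of order Rg^2
   at the ends, so both contribute h Rg eta = Rg eta^7. *)
set (B := fun y => h * M' / 2 * (Rg * eta ^ 3 / c' * J y + eta / (Rg * c) * E y)).
assert (DD : Rabs (D xL - D a) <= B xL - B a).
{ apply (derive_abs_le D B (fun x => h * chi x * e (z x / eta ^ 4) * Q x)
   (fun x => h * M' / 2 * (Rg * eta ^ 3 / c' * (e (z x / eta ^ 4) ^ 2 * (z1 x / eta ^ 4)) + eta / (Rg * c) * (W1 x * Q x ^ 2)))).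
  - unfold a, xL; lra.
  - unfold a, xL; intros t Ht; apply dD; lra.
  - unfold a, xL; intros t Ht; unfold B.
    eapply is_derive_eq.
    + apply is_derive_mul; [apply is_derive_cst|apply is_derive_add; apply is_derive_mul;
        [apply is_derive_cst|apply dJ; lra|apply is_derive_cst|apply dE; lra]].
    + cbv beta; ring.
  - unfold a, xL; intros t Ht.
    destruct (HL t ltac:(lra)) as (_ & bz1 & _ & _ & _ & _ & _ & _ & _ & bchi).
    assert (bW : c <= W1 t) by (apply (Hst t); lra).
    set (u := e (z t / eta ^ 4)); set (v := Q t).
    replace (h * chi t * u * v) with (h * (chi t * (u * v))) by ring.
    rewrite Rabs_mult (Rabs_pos_eq h); [|lra].
    replace (h * M' / 2 * (Rg * eta ^ 3 / c' * (u ^ 2 * (z1 t / eta ^ 4)) + eta / (Rg * c) * (W1 t * v ^ 2)))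
      with (h * (M' * ((Rg / eta * (z1 t / c') * u ^ 2 + eta / Rg * (W1 t / c) * v ^ 2) / 2))) by (field; lra).
    apply Rmult_le_compat_l; [lra|].
    apply Rabs_le_mult; auto.
    assert (1 <= z1 t / c') by (apply Rle_div_r; lra).
    assert (1 <= W1 t / c) by (apply Rle_div_r; lra).
    assert (0 < Rg / eta) by pos.
    assert (0 < eta / Rg) by pos.
    assert (Rg / eta * 1 * u ^ 2 <= Rg / eta * (z1 t / c') * u ^ 2).
    { apply Rmult_le_compat_r; [apply pow2_ge_0|]; apply Rmult_le_compat_l; lra. }
    assert (eta / Rg * 1 * v ^ 2 <= eta / Rg * (W1 t / c) * v ^ 2).
    { apply Rmult_le_compat_r; [apply pow2_ge_0|]; apply Rmult_le_compat_l; lra. }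
    assert (AG : 2 * Rabs (u * v) <= Rg / eta * 1 * u ^ 2 + eta / Rg * 1 * v ^ 2); [|lra].
    rewrite Rabs_mult -(pow2_abs u) -(pow2_abs v).
    assert (SQ : 0 <= Rg / eta * (Rabs u - eta / Rg * Rabs v) ^ 2) by pos.
    replace (Rg / eta * (Rabs u - eta / Rg * Rabs v) ^ 2)
      with (Rg / eta * 1 * Rabs u ^ 2 + eta / Rg * 1 * Rabs v ^ 2 - 2 * (Rabs u * Rabs v)) in SQ by (field; lra).
    lra. }

(* The right end, where the Airy asymptotics apply *)
set (y := sqrt (sqrt (z xL))).
assert (Hy : y0 <= y <= y1) by (split; apply sqrt_le_1_alt, sqrt_le_1_alt; lra).
assert (y2 : y ^ 2 = sqrt (z xL)) by (unfold y; rewrite pow2_sqrt; auto; apply sqrt_pos).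
assert (y4 : y ^ 4 = z xL).
{ replace (y ^ 4) with (y ^ 2 * y ^ 2) by ring; rewrite y2; apply sqrt_sqrt; lra. }
set (kk := y / eta).
assert (kk4 : kk ^ 4 = z xL / eta ^ 4) by (unfold kk; rewrite -y4; field; lra).
assert (kkp : 0 < kk) by (unfold kk; pos).
assert (kk1 : 1 <= kk).
{ destruct (Rle_or_lt 1 kk) as [H|H]; auto; exfalso.
  assert (kk ^ 4 < 1) by (rewrite -(pow1 4); apply pow4_lt; auto).
  assert (1 <= z xL / eta ^ 4) by (apply Rle_div_r; lra). lra. }
destruct (Hosc kk kk1) as [osc0 osc1]; rewrite kk4 in osc0, osc1.
assert (kk6 : kk ^ 6 = y ^ 6 / h) by (unfold kk; rewrite -Heta6; field; lra).
assert (Hact : RInt (fun x => sqrt (f x * g x)) al xL = 2 / 3 * y ^ 6 :> R).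
{ transitivity (2 / 3 * (z xL * sqrt (z xL))); [apply (langer_action al (2 * r) z z1 (fun x => f x * g x))|].
  - intros x Hx; destruct (HL x Hx) as (dz & bz1 & Ez & (w & bw & Ew) & _).
    split; [exact dz|split; [lra|split; [exact Ez|split]]].
    + exact (is_derive_continuous _ _ _ (proj1 (Hst x Hx))).
    + exists w; split; [lra|exact Ew].
  - unfold xL; lra.
  - rewrite -y2 -y4; ring. }
rewrite Hact.
replace (2 / 3 * kk ^ 6 + th) with (2 / 3 * y ^ 6 / h + th) in osc0, osc1 by (rewrite kk6; field; lra).
set (Th := 2 / 3 * y ^ 6 / h + th) in *.
set (ak := kk * e (z xL / eta ^ 4)) in *; set (bk := e1 (z xL / eta ^ 4) / kk) in *.
assert (yp : 0 < y) by lra.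
assert (Hk6 : CA / kk ^ 6 <= CA / y0 ^ 6 * h).
{ rewrite kk6. replace (CA / (y ^ 6 / h)) with (CA * / y ^ 6 * h).
  - apply Rmult_le_compat_r; [lra|]; apply Rmult_le_compat_l; [lra|].
    apply Rinv_le_contravar; [apply pow_lt; auto|apply pow_incr; lra].
  - field; split; lra. }
assert (HCk : CA / kk ^ 6 <= CA).
{ unfold Rdiv; rewrite -{2}(Rmult_1_r CA); apply Rmult_le_compat_l; [lra|].
  rewrite -Rinv_1; apply Rinv_le_contravar; [lra|apply pow_R1_Rle; auto]. }
assert (akb : Rabs ak <= kap + CA).
{ replace ak with ((ak - kap * sin Th) + kap * sin Th) by ring.
  eapply Rle_trans; [apply Rabs_triang|]. rewrite Rabs_mult (Rabs_pos_eq kap); [|lra].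
  pose proof (Rmult_le_compat_l kap _ 1 ltac:(lra) (Rabs_le _ _ (SIN_bound Th))). lra. }
assert (bkb : Rabs bk <= kap + CA).
{ replace bk with ((bk - kap * cos Th) + kap * cos Th) by ring.
  eapply Rle_trans; [apply Rabs_triang|]. rewrite Rabs_mult (Rabs_pos_eq kap); [|lra].
  pose proof (Rmult_le_compat_l kap _ 1 ltac:(lra) (Rabs_le _ _ (COS_bound Th))). lra. }
assert (JL : J xL <= y1 ^ 2 / eta ^ 2 * (2 * (kap + CA) ^ 2)).
{ replace (J xL) with (y ^ 2 / eta ^ 2 * (bk ^ 2 + ak ^ 2)).
  2: { unfold J, ak, bk; rewrite -kk4; unfold kk; field; lra. }
  assert (forall u, Rabs u <= kap + CA -> u ^ 2 <= (kap + CA) ^ 2).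
  { intros u Hu; rewrite -(pow2_abs u); apply pow_incr; split; [apply Rabs_pos|auto]. }
  pose proof (H _ akb); pose proof (H _ bkb).
  assert (0 < / eta ^ 2) by pos.
  assert (0 <= y ^ 2 <= y1 ^ 2) by (split; [apply pow2_ge_0|apply pow_incr; lra]).
  apply Rmult_le_compat; try lra.
  - pos.
  - pose proof (pow2_ge_0 ak); pose proof (pow2_ge_0 bk); lra.
  - apply Rmult_le_compat_r; lra. }
assert (e2p : 0 < eta ^ 2 <= 1) by (split; [apply pow_lt; auto|rewrite -(pow1 2); apply pow_incr; lra]).
assert (Ja : - J a <= CA ^ 2 / eta ^ 2).
{ unfold J; rewrite Tz. apply Rle_trans with (X * e (- X) ^ 2).
  - pose proof (pow2_ge_0 (e1 (- X))); lra.
  - rewrite -pow2_abs. apply Rle_trans with (X * (CA / X ^ 3) ^ 2).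
    + apply Rmult_le_compat_l; [lra|]; apply pow_incr; split; [apply Rabs_pos|auto].
    + replace (X * (CA / X ^ 3) ^ 2) with (CA ^ 2 * / X ^ 5) by (field; lra).
      apply Rmult_le_compat_l; [apply pow2_ge_0|].
      apply Rinv_le_contravar; [lra|]. apply Rle_trans with 1; [lra|apply pow_R1_Rle; auto]. }
assert (BB : B xL - B a <= C1 * Rg * eta ^ 7).
{ unfold B.
  replace (h * M' / 2 * (Rg * eta ^ 3 / c' * J xL + eta / (Rg * c) * E xL) -
     h * M' / 2 * (Rg * eta ^ 3 / c' * J a + eta / (Rg * c) * E a))
   with (h * M' / 2 * (Rg * eta ^ 3 / c' * (J xL - J a) + eta / (Rg * c) * (Rg ^ 2 - E a)))
   by (rewrite HR2; ring).
  replace (C1 * Rg * eta ^ 7) with (h * M' / 2 * (Rg * eta ^ 3 / c' * ((2 * y1 ^ 2 * (kap + CA) ^ 2 + CA ^ 2) / eta ^ 2)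
      + eta / (Rg * c) * ((1 + W0 * Cq) * Rg ^ 2))) by (unfold C1; rewrite -Heta6; field; lra).
  apply Rmult_le_compat_l.
  { apply Rmult_le_pos; [pos|lra]. }
  apply Rplus_le_compat; apply Rmult_le_compat_l.
  - apply Rlt_le, Rdiv_lt_0_compat; auto; apply Rmult_lt_0_compat; auto; apply pow_lt; auto.
  - unfold Rdiv in *; lra.
  - apply Rlt_le, Rdiv_lt_0_compat; auto; apply Rmult_lt_0_compat; auto.
  - lra. }
assert (Da : Rabs (D a) <= C2 * Rg * eta ^ 7).
{ unfold D, Qh, Ph; rewrite Tz.
  assert (fi : 0 < / f a <= / c).
  { split; [apply Rinv_0_lt_compat|apply Rinv_le_contravar]; lra. }
  assert (mi : 0 < / m a <= / c').
  { split; [apply Rinv_0_lt_compat|apply Rinv_le_contravar]; lra. }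
  assert (PhB : Rabs (h * (m1 a / f a) * e (- X) + eta ^ 2 / m a * e1 (- X)) <= (M' / c + 1 / c') * ep).
  { eapply Rle_trans; [apply Rabs_triang|]. rewrite Rmult_plus_distr_r.
    apply Rplus_le_compat; apply Rabs_le_mult; auto.
    - rewrite -(Rmult_1_l (M' / c)); apply Rabs_le_mult; [rewrite Rabs_pos_eq; lra|].
      apply Rabs_le_mult; auto; rewrite Rabs_pos_eq; lra.
    - apply Rabs_le_mult; rewrite Rabs_pos_eq; lra. }
  assert (QhB : Rabs (m a * e (- X)) <= M' * ep).
  { apply Rabs_le_mult; auto; rewrite Rabs_pos_eq; lra. }
  eapply Rle_trans; [apply Rabs_triang|]; rewrite Rabs_Ropp.
  pose proof (Rabs_le_mult _ _ _ _ Qaabs PhB); pose proof (Rabs_le_mult _ _ _ _ Paabs QhB).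
  replace (C2 * Rg * eta ^ 7) with ((1 + Cq) * Rg * ((M' / c + 1 / c') * ep) + Rg * (M' * ep))
    by (unfold C2, ep; field; lra).
  lra. }
assert (DL : Rabs (D xL) <= (C1 + C2) * Rg * eta ^ 7).
{ replace (D xL) with ((D xL - D a) + D a) by ring.
  eapply Rle_trans; [apply Rabs_triang|]. lra. }
assert (mp : 0 < m xL) by lra.
(* From m^2 z' = f and z z'^2 = f g follows m^4/z = f/g: the Langer amplitude agrees with the WKB
   amplitude. *)
assert (Hkm : k = m xL / y).
{ apply pow4_inj; auto; [pos|].
  assert (gL : g xL <> 0) by (intros HH; rewrite HH in GL; lra).
  apply Rmult_eq_reg_r with (g xL); auto; rewrite Hkg.
  replace ((m xL / y) ^ 4) with ((m xL ^ 2) ^ 2 / y ^ 4) by (field; lra).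
  rewrite y4. apply Rmult_eq_reg_r with (f xL); [|lra].
  transitivity ((m xL ^ 2) ^ 2 / z xL * (f xL * g xL)); [|field; lra].
  rewrite -EzL -EmL; field; lra. }

(* The phase relation and its four errors *)
assert (KD : kk * D xL = Q xL * (h * (m1 xL / f xL) * ak + y ^ 2 / m xL * bk) - P xL * (m xL * ak)).
{ unfold D, Qh, Ph, ak, bk, kk; field; lra. }
assert (key : kap * (Q xL * (y ^ 2 / m xL) * cos Th - P xL * m xL * sin Th) =
   kk * D xL - Q xL * (h * (m1 xL / f xL) * ak) - Q xL * (y ^ 2 / m xL * (bk - kap * cos Th))
    + P xL * (m xL * (ak - kap * sin Th))).
{ rewrite KD; ring. }
assert (fi : 0 < / f xL <= / c).
{ split; [apply Rinv_0_lt_compat|apply Rinv_le_contravar]; lra. }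
assert (mi : 0 < / m xL <= / c').
{ split; [apply Rinv_0_lt_compat|apply Rinv_le_contravar]; lra. }
assert (QT : Rabs (Q xL) <= T) by (unfold T; pose proof (Rabs_pos (P xL)); lra).
assert (PT : Rabs (P xL) <= T) by (unfold T; pose proof (Rabs_pos (Q xL)); lra).
(* The factor kk = y/eta normalises the Airy amplitude and lowers eta^7 to eta^6 = h. *)
assert (t1 : Rabs (kk * D xL) <= y1 * (C1 + C2) * (1 + W0) * (h * T)).
{ apply Rle_trans with (kk * ((C1 + C2) * Rg * eta ^ 7)); [apply Rabs_le_mult; auto; rewrite Rabs_pos_eq; lra|].
  replace (kk * ((C1 + C2) * Rg * eta ^ 7)) with (y * ((C1 + C2) * h) * Rg) by (unfold kk; rewrite -Heta6; field; lra).
  replace (y1 * (C1 + C2) * (1 + W0) * (h * T)) with (y1 * ((C1 + C2) * h) * ((1 + W0) * T)) by ring.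
  assert (0 < (C1 + C2) * h) by pos.
  apply Rmult_le_compat; try lra.
  - pos.
  - apply Rmult_le_compat_r; lra. }
assert (t2 : Rabs (Q xL * (h * (m1 xL / f xL) * ak)) <= M' * (kap + CA) / c * (h * T)).
{ replace (M' * (kap + CA) / c * (h * T)) with (T * (h * (M' * / c) * (kap + CA))) by (field; lra).
  repeat apply Rabs_le_mult; auto; rewrite Rabs_pos_eq; lra. }
assert (t3 : Rabs (Q xL * (y ^ 2 / m xL * (bk - kap * cos Th))) <= y1 ^ 2 * CA / (c' * y0 ^ 6) * (h * T)).
{ replace (y1 ^ 2 * CA / (c' * y0 ^ 6) * (h * T)) with (T * (y1 ^ 2 * / c' * (CA / y0 ^ 6 * h))) by (field; lra).
  assert (0 <= y ^ 2 <= y1 ^ 2) by (split; [apply pow2_ge_0|apply pow_incr; lra]).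
  apply Rabs_le_mult; auto; apply Rabs_le_mult; [apply Rabs_le_mult; rewrite Rabs_pos_eq; lra|lra]. }
assert (t4 : Rabs (P xL * (m xL * (ak - kap * sin Th))) <= M' * CA / y0 ^ 6 * (h * T)).
{ replace (M' * CA / y0 ^ 6 * (h * T)) with (T * (M' * (CA / y0 ^ 6 * h))) by (field; lra).
  apply Rabs_le_mult; auto; apply Rabs_le_mult; [rewrite Rabs_pos_eq; lra|lra]. }
assert (bound : kap * Rabs (Q xL * (y ^ 2 / m xL) * cos Th - P xL * m xL * sin Th) <= C3 * (h * T)).
{ rewrite -{1}(Rabs_pos_eq kap) -?Rabs_mult; [|lra]. rewrite key.
  eapply Rle_trans; [apply Rabs_triang|].
  eapply Rle_trans; [apply Rplus_le_compat_r, Rabs_triang|]. rewrite Rabs_Ropp.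
  eapply Rle_trans; [apply Rplus_le_compat_r, Rplus_le_compat_r, Rabs_triang|]. rewrite Rabs_Ropp.
  unfold C3; lra. }
replace (Q xL / k * cos Th - P xL * k * sin Th)
  with (/ y * (Q xL * (y ^ 2 / m xL) * cos Th - P xL * m xL * sin Th)) by (rewrite Hkm; field; lra).
rewrite Rabs_mult (Rabs_pos_eq (/ y)); [|left; apply Rinv_0_lt_compat; auto].
set (V := Rabs (Q xL * (y ^ 2 / m xL) * cos Th - P xL * m xL * sin Th)) in *.
assert (HV : V <= C3 * (h * T) / kap) by (apply Rle_div_r; auto; lra).
replace (C3 / (kap * y0) * h * T) with (/ y0 * (C3 * (h * T) / kap)) by (field; lra).
apply Rmult_le_compat; auto.
- left; apply Rinv_0_lt_compat; auto.
- apply Rabs_pos.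
- apply Rinv_le_contravar; lra.
Qed.

(** * WKB propagation in the classically allowed region *)

(** The amplitude k = (f/g)^(1/4) enters through k^4 g = f, so that k^2 g is sqrt (f g). The
    correction h (k'/f) sin in [Ph] makes the first equation exact and leaves a residual of size h
    in the second one only. *)
Lemma wkb_quasimode (f g k k1 chi Th : R -> R) (h x : R) : 0 < h -> k x <> 0 -> f x <> 0 ->
  is_derive k x (k1 x) -> is_derive (fun y => k1 y / f y) x (chi x) ->
  k x ^ 4 * g x = f x -> is_derive Th x (k x ^ 2 * g x / h) ->
  let Qh := fun y => k y * sin (Th y) in
  let Ph := fun y => cos (Th y) / k y + h * (k1 y / f y) * sin (Th y) in
  is_derive Qh x (f x * Ph x / h) /\
  is_derive Ph x (- (g x * Qh x / h) + h * chi x * sin (Th x)).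
Proof.
intros Hh Hk Hf dk dchi Ek dTh Qh Ph.
assert (ds : is_derive (fun y => sin (Th y)) x (cos (Th x) * (k x ^ 2 * g x / h))).
{ apply (is_derive_compR sin Th); auto; apply is_derive_sin. }
assert (dc : is_derive (fun y => cos (Th y)) x (- sin (Th x) * (k x ^ 2 * g x / h))).
{ apply (is_derive_compR cos Th); auto; apply is_derive_cos. }
split.
- eapply is_derive_eq; [apply is_derive_mul; [exact dk|exact ds]|].
  unfold Ph; cbv beta. transitivity (k1 x * sin (Th x) + (k x ^ 4 * g x) * cos (Th x) / (k x * h)).
  + field; split; lra.
  + rewrite Ek; field; repeat split; lra.
- eapply is_derive_eq.
  + apply is_derive_add.
    * apply (is_derive_div (fun y => cos (Th y)) k); [exact dc|exact dk|exact Hk].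
    * apply (is_derive_mul (fun y => h * (k1 y / f y))); [|exact ds].
      apply is_derive_mul; [apply is_derive_cst|exact dchi].
  + unfold Qh; cbv beta. assert (g x <> 0) by (intros Hg; apply Hf; rewrite -Ek Hg; ring).
    rewrite -Ek; field; repeat split; auto; lra.
Qed.

(** Hypothesis and conclusion both say that the Wronskian with the WKB quasimode of phase [th] at
    [x1] is O(h), up to the correction term of [Ph]. In between it changes by O(h), since f and g
    are bounded away from 0 and the energy controls Q. *)
Lemma wkb_propagation (c M L : R) : 0 < c -> 0 < M -> 0 < L -> exists C, 0 < C /\
  forall a b f f1 f2 g g1 g2, C2b a b M f f1 f2 -> C2b a b M g g1 g2 ->
  (forall x, a < x < b -> c <= f x /\ c <= g x) ->
  forall h Q P x1 x2, 0 < h <= 1 -> zs_system a b f g h Q P ->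
  a < x1 -> x1 <= x2 -> x2 < b -> x2 - x1 <= L ->
  forall C0 ka kb th, 0 <= C0 -> 0 < ka -> ka ^ 4 * g x1 = f x1 -> 0 < kb -> kb ^ 4 * g x2 = f x2 ->
  Rabs (Q x1 / ka * cos th - P x1 * ka * sin th) <= C0 * h * (Rabs (Q x1) + Rabs (P x1)) ->
  Rabs (Q x2 / kb * cos (th + RInt (fun x => sqrt (f x * g x)) x1 x2 / h)
     - P x2 * kb * sin (th + RInt (fun x => sqrt (f x * g x)) x1 x2 / h))
   <= C * (1 + C0) * h * (Rabs (Q x2) + Rabs (P x2)).
Proof.
intros Hc HM HL.
destruct (C2b_Rpower_lower c M (1 / 4) Hc HM) as (cu & Mu & Hcu & HMu & Pu).
destruct (C2b_Rpower_lower c M (- (1 / 4)) Hc HM) as (cv & Mv & Hcv & HMv & Pv).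
destruct (C2b_Rpower_lower c M (-1) Hc HM) as (ci & Mi & Hci & HMi & Pi).
set (Mk := 4 * Mu * Mv); assert (HMk : 0 < Mk) by (unfold Mk; pos).
set (MW := 4 * M * Mi); assert (HMW : 0 < MW) by (unfold MW; pos).
set (Mx := 2 * (Mk * Mi)); assert (HMx : 0 < Mx) by (unfold Mx; pos).
set (kap := MW * M / c); assert (Hkap : 0 < kap) by (unfold kap; pos).
set (A := (1 + M / c) * exp (kap * L)).
assert (HMc : 0 < M / c) by pos.
assert (HA : 0 < A) by (apply Rmult_lt_0_compat; [lra|apply exp_pos]).
set (C1 := 2 * (1 + A) * (1 + M / c)).
assert (HC1 : 0 < C1) by (unfold C1; pos).
assert (HMki : 0 < Mk * Mi) by pos.
assert (HMxL : 0 < Mx * L) by pos.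
exists (C1 * (1 + Mk * Mi + Mx * L) + Mk * Mi).
split. { apply Rplus_lt_0_compat; auto; pos. }
intros a b f f1 f2 g g1 g2 Hf Hg Hlow h Q P x1 x2 Hh Hs Hx1 Hx Hx2 HxL C0 ka kb th HC0 Hka Eka Hkb Ekb H0.
assert (Cf := fun x Hx => proj1 (Hlow x Hx)); assert (Cg := fun x Hx => proj2 (Hlow x Hx)).
destruct (Pu _ _ _ _ _ Hf Cf) as (u1 & u2 & Hu & _ & Lu).
destruct (Pv _ _ _ _ _ Hg Cg) as (v1 & v2 & Hv & _ & Lv).
destruct (Pi _ _ _ _ _ Hf Cf) as (i1 & i2 & Hi & _ & Li).
pose proof (C2b_mult _ _ _ _ _ _ _ _ _ _ Hu Hv) as Hk; fold Mk in Hk; cbv beta in Hk.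
assert (HkE : exists k k1 k2, C2b a b Mk k k1 k2 /\ (forall x, a < x < b -> 0 < k x /\ k x ^ 4 * g x = f x)).
{ eexists; eexists; eexists; split; [exact Hk|]; intros x Hab; cbv beta.
  assert (fx : 0 < f x) by (specialize (Cf x Hab); lra).
  assert (gx : 0 < g x) by (specialize (Cg x Hab); lra).
  split; [apply Rmult_lt_0_compat; apply exp_pos|].
  rewrite Rpow_mult_distr.
  rewrite -!Rpower_pow; try apply exp_pos. rewrite !Rpower_mult.
  replace (1 / 4 * INR 4) with 1 by (simpl; field). replace (- (1 / 4) * INR 4) with (- (1)) by (simpl; field).
  rewrite Rpower_Ropp !Rpower_1; auto; field; lra. }
clear Hk; destruct HkE as (k & k1 & k2 & Hk & Ek).
pose proof (C2b_mult _ _ _ _ _ _ _ _ _ _ Hg Hi) as HW; fold MW in HW; cbv beta in HW.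
assert (dW : exists W1, forall x, a < x < b -> is_derive (fun y => g y / f y) x (W1 x) /\ Rabs (W1 x) <= MW).
{ eexists; intros x Hab; destruct (HW x Hab) as (dW & _ & _ & _ & bW & _); split; [|exact bW].
  apply (is_derive_local (fun y => g y * Rpower (f y) (-1)) _ a b); auto.
  intros y Hy; unfold Rdiv; rewrite Rpower_Ropp Rpower_1; auto; specialize (Cf y Hy); lra. }
clear HW; destruct dW as (W1 & dW).
assert (dchi : exists chi, forall x, a < x < b -> is_derive (fun y => k1 y / f y) x (chi x) /\ Rabs (chi x) <= Mx
   /\ Rabs (k1 x / f x) <= Mk * Mi).
{ exists (fun x => k2 x * Rpower (f x) (-1) + k1 x * i1 x); intros x Hab.
  destruct (Hk x Hab) as (_ & dk1 & _ & _ & bk1 & bk2), (Hi x Hab) as (di & _ & _ & bi & bi1 & _).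
  assert (Ef : forall y, a < y < b -> k1 y * Rpower (f y) (-1) = k1 y / f y).
  { intros y Hy; unfold Rdiv; rewrite Rpower_Ropp Rpower_1; auto; specialize (Cf y Hy); lra. }
  split; [|split].
  - apply (is_derive_local (fun y => k1 y * Rpower (f y) (-1)) _ a b); auto.
    apply (is_derive_mul k1 (fun y => Rpower (f y) (-1))); auto.
  - eapply Rle_trans; [apply Rabs_triang|].
    pose proof (Rabs_le_mult _ _ _ _ bk2 bi); pose proof (Rabs_le_mult _ _ _ _ bk1 bi1). unfold Mx; lra.
  - rewrite -Ef; auto; apply Rabs_le_mult; auto. }
destruct dchi as (chi & dchi).
clear Hu Hv Hi Lu Lv Li Pu Pv Pi.
assert (fp : forall x, a < x < b -> c <= f x <= M).
{ intros x Hab; split; auto; eapply C2b_le; eauto. }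
assert (gp : forall x, a < x < b -> c <= g x <= M).
{ intros x Hab; split; auto; eapply C2b_le; eauto. }
set (E := fun y => P y ^ 2 + g y / f y * Q y ^ 2).
assert (dE : forall x, a < x < b -> is_derive E x (W1 x * Q x ^ 2)).
{ intros x Hab; pose proof (fp x Hab); apply (zs_energy f g W1 Q P h); try apply (Hs x Hab); try lra.
  apply (dW x Hab). }
assert (WB : forall x, a < x < b -> / (M / c) <= g x / f x <= M / c).
{ intros x Hab; pose proof (fp x Hab); pose proof (gp x Hab).
  replace (/ (M / c)) with (c * / M) by (field; lra); unfold Rdiv.
  assert (/ M <= / f x <= / c) by (split; apply Rinv_le_contravar; lra).
  assert (0 < / M) by pos.
  split; apply Rmult_le_compat; lra. }
assert (EQ : forall x, a < x < b -> Q x ^ 2 <= M / c * E x /\ P x ^ 2 <= E x).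
{ intros x Hab; pose proof (WB x Hab) as [W _]; pose proof (pow2_ge_0 (P x)); pose proof (pow2_ge_0 (Q x)).
  assert (H3 : / (M / c) * Q x ^ 2 <= g x / f x * Q x ^ 2) by (apply Rmult_le_compat_r; auto).
  assert (0 <= / (M / c) * Q x ^ 2) by pos.
  unfold E; split; [|lra].
  apply Rle_trans with (M / c * (/ (M / c) * Q x ^ 2)); [right; field; lra|].
  apply Rmult_le_compat_l; lra. }
set (R0 := sqrt (E x2)).
assert (Ex20 : 0 <= E x2).
{ destruct (EQ x2 ltac:(lra)) as [_ H]; pose proof (pow2_ge_0 (P x2)); lra. }
assert (HR0 : 0 <= R0) by apply sqrt_pos.
assert (R2 : R0 ^ 2 = E x2) by (unfold R0; rewrite pow2_sqrt; auto).
(* Gronwall is used backwards from [x2], because the final error is measured against the solution at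
   [x2]. *)
assert (EB : forall x, x1 <= x <= x2 -> E x <= exp (kap * L) * E x2).
{ intros x Hxx; destruct (exp_growth E (fun y => W1 y * Q y ^ 2) kap x x2) as [G _]; [lra| |].
  - intros t Ht; split; [apply dE; lra|].
    destruct (EQ t ltac:(lra)) as [HQ _]; destruct (dW t ltac:(lra)) as [_ bW].
    replace (kap * E t) with (MW * (M / c * E t)) by (unfold kap; field; lra).
    apply Rabs_le_mult; auto; rewrite Rabs_pos_eq; pos.
  - eapply Rle_trans; [exact G|]; apply Rmult_le_compat_r; auto.
    apply exp_le_compat, Rmult_le_compat_l; lra. }
assert (AR : forall x, x1 <= x <= x2 -> Rabs (Q x) <= (1 + A) * R0 /\ Rabs (P x) <= (1 + A) * R0).
{ intros x Hxx; destruct (EQ x ltac:(lra)) as [HQ HP]; pose proof (EB x Hxx) as HE.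
  assert (HE2 : (1 + M / c) * E x <= A * R0 ^ 2).
  { unfold A; rewrite R2 Rmult_assoc; apply Rmult_le_compat_l; lra. }
  assert (HE0 : 0 <= E x) by (pose proof (pow2_ge_0 (P x)); lra).
  assert (0 <= M / c * E x) by pos.
  assert (sqb : forall t, t ^ 2 <= A * R0 ^ 2 -> Rabs t <= (1 + A) * R0).
  { intros t Ht; apply Rabs_le_of_sq; [pos|].
    replace (((1 + A) * R0) ^ 2) with (A * R0 ^ 2 + (1 + A + A ^ 2) * R0 ^ 2) by ring.
    assert (0 <= (1 + A + A ^ 2) * R0 ^ 2) by pos. lra. }
  split; apply sqb; lra. }
set (T2 := Rabs (Q x2) + Rabs (P x2)).
assert (HT2 : 0 <= T2) by (pose proof (Rabs_pos (Q x2)); pose proof (Rabs_pos (P x2)); unfold T2; lra).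
assert (RT : R0 <= (1 + M / c) * T2).
{ apply le_of_sq; [pos|]; rewrite R2; apply energy_le_norm.
  destruct (WB x2 ltac:(lra)) as [HW0 HW]; split; auto.
  apply Rle_trans with (/ (M / c)); auto; left; pos. }
set (Th := fun y => th + RInt (fun x => sqrt (f x * g x)) x1 y / h).
assert (Esq : forall x, a < x < b -> sqrt (f x * g x) = k x ^ 2 * g x).
{ intros x Hab; destruct (Ek x Hab) as [kp E1]; pose proof (gp x Hab).
  rewrite -E1; replace (k x ^ 4 * g x * g x) with ((k x ^ 2 * g x) ^ 2) by ring.
  apply sqrt_pow2, Rmult_le_pos; [apply pow2_ge_0|lra]. }
assert (dTh : forall x, a < x < b -> is_derive Th x (k x ^ 2 * g x / h)).
{ intros x Hab; unfold Th. eapply is_derive_eq.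
  - apply (is_derive_add (fun _ => th)); [apply is_derive_cst|].
    apply (is_derive_mul (fun y => RInt (fun x => sqrt (f x * g x)) x1 y) (fun _ => / h)); [|apply is_derive_cst].
    apply (is_derive_RInt_interval a b); auto; [|lra].
    intros y Hy; apply (continuous_comp (fun x => f x * g x) sqrt); [|apply continuous_sqrt].
    apply continuousM; eapply C2b_continuous; eauto.
  - cbv beta; rewrite Esq; auto; field; lra. }
set (Qh := fun y => k y * sin (Th y)).
set (Ph := fun y => cos (Th y) / k y + h * (k1 y / f y) * sin (Th y)).
set (D := fun y => Q y * Ph y - P y * Qh y).
assert (dD : forall x, a < x < b -> is_derive D x (h * chi x * sin (Th x) * Q x)).
{ intros x Hab; destruct (Ek x Hab) as [kp E1]; pose proof (fp x Hab).
  destruct (wkb_quasimode f g k k1 chi Th h x) as [dQh dPh]; auto; try lra.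
  - apply (Hk x Hab).
  - apply (dchi x Hab).
  - destruct (Hs x Hab) as [dQ dP]; eapply is_derive_eq.
    + apply is_derive_sub; apply is_derive_mul; eauto.
    + cbv beta; unfold Qh, Ph; field; repeat split; lra. }
assert (Th1 : Th x1 = th).
{ unfold Th; rewrite RInt_point; unfold zero; simpl; field; lra. }
set (K := h * Mx * 1 * ((1 + A) * R0)).
assert (DD : Rabs (D x2 - D x1) <= K * x2 - K * x1).
{ apply (derive_abs_le D (fun y => K * y) (fun x => h * chi x * sin (Th x) * Q x) (fun _ => K)); auto.
  - intros t Ht; apply dD; lra.
  - intros t Ht; apply is_derive_lin.
  - intros t Ht; unfold K; apply Rabs_le_mult; [apply Rabs_le_mult; [apply Rabs_le_mult|]|apply AR; lra].
    + rewrite Rabs_pos_eq; lra.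
    + apply (dchi t); lra.
    + apply Rabs_le, SIN_bound. }
(* The amplitudes given at the end points coincide with [k] there, a positive fourth root being
   unique. *)
assert (DE : forall x kk, a < x < b -> 0 < kk -> kk ^ 4 * g x = f x ->
  D x = (Q x / kk * cos (Th x) - P x * kk * sin (Th x)) + h * (k1 x / f x) * sin (Th x) * Q x).
{ intros x kk Hab Hkk Ekk; destruct (Ek x Hab) as [kp E1].
  assert (kk = k x) as ->.
  { apply pow4_inj; auto; apply Rmult_eq_reg_r with (g x); [lra|pose proof (gp x Hab); lra]. }
  pose proof (fp x Hab); unfold D, Ph, Qh; field; split; lra. }
assert (cor : forall x, x1 <= x <= x2 -> Rabs (h * (k1 x / f x) * sin (Th x) * Q x) <= h * (Mk * Mi) * Rabs (Q x)).
{ intros x Hxx; apply Rabs_le_mult; [|apply Rle_refl].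
  rewrite -(Rmult_1_r (h * (Mk * Mi))); apply Rabs_le_mult; [|apply Rabs_le, SIN_bound].
  apply Rabs_le_mult; [rewrite Rabs_pos_eq; lra|apply (dchi x); lra]. }
rewrite -/(Th x2).
pose proof (DE x1 ka ltac:(lra) Hka Eka) as D1; pose proof (DE x2 kb ltac:(lra) Hkb Ekb) as D2.
rewrite Th1 in D1. pose proof (cor x1 ltac:(lra)) as c1; rewrite Th1 in c1. pose proof (cor x2 ltac:(lra)) as c2.
destruct (AR x1 ltac:(lra)) as [AQ AP].
set (T1 := Rabs (Q x1) + Rabs (P x1)) in *.
assert (HT1 : T1 <= C1 * T2).
{ apply Rle_trans with (2 * (1 + A) * R0); [unfold T1; lra|].
  unfold C1; rewrite !Rmult_assoc -Rmult_assoc (Rmult_assoc 2); apply Rmult_le_compat_l; [lra|].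
  apply Rmult_le_compat_l; lra. }
assert (HRC : (1 + A) * R0 <= C1 * T2).
{ assert (0 <= (1 + A) * R0) by pos.
  apply Rle_trans with (2 * ((1 + A) * R0)); [lra|].
  unfold C1; rewrite !Rmult_assoc; apply Rmult_le_compat_l; [lra|]; apply Rmult_le_compat_l; lra. }
assert (HCT : 0 <= C1 * T2) by pos.
assert (DB1 : Rabs (D x1) <= (C0 + Mk * Mi) * h * (C1 * T2)).
{ rewrite D1; eapply Rle_trans; [apply Rabs_triang|].
  assert (C0 * h * T1 <= C0 * h * (C1 * T2)) by (apply Rmult_le_compat_l; auto; pos).
  assert (h * (Mk * Mi) * Rabs (Q x1) <= h * (Mk * Mi) * (C1 * T2)).
  { apply Rmult_le_compat_l; [pos|].
    pose proof (Rabs_pos (P x1)); unfold T1 in HT1; lra. }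
  lra. }
assert (DB2 : Rabs (D x2) <= (C0 + Mk * Mi + Mx * L) * h * (C1 * T2)).
{ replace (D x2) with ((D x2 - D x1) + D x1) by ring.
  eapply Rle_trans; [apply Rabs_triang|].
  assert (K * x2 - K * x1 <= Mx * L * h * (C1 * T2)).
  { rewrite -Rmult_minus_distr_l. unfold K.
    replace (h * Mx * 1 * ((1 + A) * R0) * (x2 - x1)) with (h * Mx * ((x2 - x1) * ((1 + A) * R0))) by ring.
    replace (Mx * L * h * (C1 * T2)) with (h * Mx * (L * (C1 * T2))) by ring.
    apply Rmult_le_compat_l; [pos|].
    apply Rmult_le_compat; auto; try lra; pos. }
  lra. }
replace (Q x2 / kb * cos (Th x2) - P x2 * kb * sin (Th x2))
  with (D x2 + - (h * (k1 x2 / f x2) * sin (Th x2) * Q x2)) by (rewrite D2; ring).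
eapply Rle_trans; [apply Rabs_triang|]; rewrite Rabs_Ropp.
assert (h * (Mk * Mi) * Rabs (Q x2) <= Mk * Mi * (1 + C0) * h * T2).
{ replace (Mk * Mi * (1 + C0) * h * T2) with (h * (Mk * Mi) * ((1 + C0) * T2)) by ring.
  apply Rmult_le_compat_l; [pos|].
  assert (0 <= C0 * T2) by pos.
  pose proof (Rabs_pos (P x2)); unfold T2 in *; lra. }
assert ((C0 + Mk * Mi + Mx * L) * h * (C1 * T2) <= C1 * (1 + Mk * Mi + Mx * L) * (1 + C0) * h * T2).
{ replace (C1 * (1 + Mk * Mi + Mx * L) * (1 + C0) * h * T2) with ((1 + Mk * Mi + Mx * L) * (1 + C0) * h * (C1 * T2)) by ring.
  apply Rmult_le_compat_r; auto; apply Rmult_le_compat_r; [lra|].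
  assert (0 <= C0 * (Mk * Mi)) by pos.
  assert (0 <= C0 * (Mx * L)) by pos. lra. }
lra.
Qed.

(** * Turning points near the reference energy *)

(** Three derivatives, because [simple_turning] asks for a C^2 bound on the derivative of f g =
    lambda^2 - A^2. *)
Definition smooth3 (A A1 A2 A3 : R -> R) : Prop := forall x,
  is_derive A x (A1 x) /\ is_derive A1 x (A2 x) /\ is_derive A2 x (A3 x) /\ continuous A3 x.

Lemma smooth3_continuous (A A1 A2 A3 : R -> R) : smooth3 A A1 A2 A3 ->
  (forall x, continuous A x) /\ (forall x, continuous A1 x) /\
  (forall x, continuous A2 x) /\ (forall x, continuous A3 x).
Proof.
intros H; split; [|split; [|split]]; intros x; destruct (H x) as (d & d1 & d2 & c3); auto;
  eapply is_derive_continuous; eauto.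
Qed.

(** Here (f g)' = -2 A A' >= 2 c^2 and (g/f)' = -2 lambda A'/(lambda + A)^2 >= c^2/(2 M^2), which
    explains the minimum. The bound 8 M^2 comes from -2 (3 A' A'' + A A'''), and 2 M from lambda +
    A. *)
Lemma zs_turning (c M : R) : 0 < c -> 0 < M -> exists c' M', 0 < c' /\ 0 < M' /\
  forall A A1 A2 A3 lam al r, 0 < r -> smooth3 A A1 A2 A3 -> A al = lam ->
  (forall x, al - r < x < al + r -> c <= A x /\ A1 x <= - c /\ A x <= M /\
     Rabs (A1 x) <= M /\ Rabs (A2 x) <= M /\ Rabs (A3 x) <= M) ->
  simple_turning c' M' r al (fun x => lam + A x) (fun x => lam - A x).
Proof.
intros Hc HM.
assert (HcM : 0 < c ^ 2 / (2 * M ^ 2)) by pos.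
assert (Hc2 : 0 < c ^ 2) by pos.
assert (HM2 : 0 < M ^ 2) by pos.
exists (Rmin (Rmin c (2 * c ^ 2)) (c ^ 2 / (2 * M ^ 2))), (8 * M ^ 2 + 2 * M).
split; [apply Rmin_glb_lt; auto; apply Rmin_glb_lt; lra|split; [lra|]].
set (c' := Rmin _ _).
assert (c'c : c' <= c /\ c' <= 2 * c ^ 2 /\ c' <= c ^ 2 / (2 * M ^ 2)).
{ unfold c'; pose proof (Rmin_l (Rmin c (2 * c ^ 2)) (c ^ 2 / (2 * M ^ 2)));
  pose proof (Rmin_r (Rmin c (2 * c ^ 2)) (c ^ 2 / (2 * M ^ 2)));
  pose proof (Rmin_l c (2 * c ^ 2)); pose proof (Rmin_r c (2 * c ^ 2)); lra. }
clearbody c'; destruct c'c as (cc1 & cc2 & cc3).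
intros A A1 A2 A3 lam al r Hr HA Hlam HB.
destruct (smooth3_continuous _ _ _ _ HA) as (cA & cA1 & cA2 & cA3).
assert (Hl : c <= lam <= M) by (subst lam; destruct (HB al ltac:(lra)) as (? & _ & ? & _); lra).
exists A1, A2, (fun x => -2 * (A x * A1 x)), (fun x => -2 * (A1 x * A1 x + A x * A2 x)),
  (fun x => -2 * (3 * (A1 x * A2 x) + A x * A3 x)), (fun x => -2 * lam * A1 x / (lam + A x) ^ 2).
split; [|split; [|split; [lra|]]].
- intros x Hx; destruct (HA x) as (d & d1 & d2 & _); destruct (HB x Hx) as (b0 & b1 & b2 & b3 & b4 & b5).
  split; [|split; [|split; [|repeat split]]]; auto; try lra.
  + eapply is_derive_eq; [apply is_derive_add; [apply is_derive_cst|exact d]|ring].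
  + rewrite Rabs_pos_eq; lra.
- intros x Hx; destruct (HA x) as (d & d1 & d2 & _); destruct (HB x Hx) as (b0 & b1 & b2 & b3 & b4 & b5).
  assert (bA : Rabs (A x) <= M) by (rewrite Rabs_pos_eq; lra).
  split; [|split; [|split; [|split; [|split]]]].
  + eapply is_derive_eq; [apply is_derive_mul; [apply is_derive_cst|apply is_derive_mul; eauto]|cbv beta; ring].
  + eapply is_derive_eq; [apply is_derive_mul; [apply is_derive_cst|apply is_derive_add; apply is_derive_mul; eauto]|cbv beta; ring].
  + apply continuousZ, continuousD; [apply continuousZ|]; apply continuousM; auto.
  + pose proof (Rabs_le_mult _ _ _ _ bA b3) as H1; apply Rabs_le_between in H1; apply Rabs_le_between; lra.
  + pose proof (Rabs_le_mult _ _ _ _ bA b4) as H1; apply Rabs_le_between in H1.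
    pose proof (Rabs_le_mult _ _ _ _ b3 b3) as H2; apply Rabs_le_between in H2. apply Rabs_le_between; lra.
  + pose proof (Rabs_le_mult _ _ _ _ bA b5) as H1; apply Rabs_le_between in H1.
    pose proof (Rabs_le_mult _ _ _ _ b3 b4) as H2; apply Rabs_le_between in H2. apply Rabs_le_between; lra.
- intros x Hx; destruct (HA x) as (d & d1 & d2 & _); destruct (HB x Hx) as (b0 & b1 & b2 & b3 & b4 & b5).
  assert (dp : is_derive (fun y => lam + A y) x (A1 x)).
  { eapply is_derive_eq; [apply is_derive_add; [apply is_derive_cst|exact d]|ring]. }
  assert (dm : is_derive (fun y => lam - A y) x (- A1 x)).
  { eapply is_derive_eq; [apply is_derive_sub; [apply is_derive_cst|exact d]|ring]. }
  split; [|split; [|split; [|split]]].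
  + eapply is_derive_eq; [apply is_derive_mul; eauto|cbv beta; ring].
  + eapply is_derive_eq; [apply is_derive_div; [exact dm|exact dp|cbv beta; lra]|cbv beta; field; lra].
  + lra.
  + assert (c * c <= A x * - A1 x) by (apply Rmult_le_compat; lra). lra.
  + apply Rle_trans with (c ^ 2 / (2 * M ^ 2)); auto.
    assert (H1 : 0 < (lam + A x) ^ 2) by pos.
    assert (H2 : (lam + A x) ^ 2 <= (2 * M) ^ 2) by (apply pow_incr; lra).
    assert (H3 : c * c <= lam * - A1 x) by (apply Rmult_le_compat; lra).
    replace (c ^ 2 / (2 * M ^ 2)) with (2 * (c * c) * / (2 * M) ^ 2) by (field; lra).
    unfold Rdiv; apply Rmult_le_compat; try lra.
    * left; apply Rinv_0_lt_compat, pow_lt; lra.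
    * apply Rinv_le_contravar; auto.
Qed.

Lemma continuous_near (u : R -> R) (x eps : R) : continuous u x -> 0 < eps ->
  exists d, 0 < d /\ forall y, Rabs (y - x) <= d -> Rabs (u y - u x) < eps.
Proof.
intros Hu He; apply filterlim_locally with (eps := mkposreal _ He) in Hu.
destruct Hu as [d Hd]; exists (d / 2); destruct d as [d Hd0]; simpl in *.
split; [lra|]; intros y Hy; apply Hd; change (Rabs (y - x) < d); lra.
Qed.

Lemma compact_gap (u : R -> R) (a b m : R) : a <= b -> (forall x, continuous u x) ->
  (forall x, a <= x <= b -> m < u x) -> exists e, 0 < e /\ forall x, a <= x <= b -> m + e <= u x.
Proof.
intros Hab Hu Hm.
destruct (continuity_ab_min u a b Hab) as [x0 [Hmin Hx0]].
{ intros; apply continuous_pt; auto. }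
exists (u x0 - m); split; [pose proof (Hm x0 Hx0); lra|]; intros x Hx; specialize (Hmin x Hx); lra.
Qed.

Lemma compact_bound (u : R -> R) (a b : R) : a <= b -> (forall x, continuous u x) ->
  exists M, 0 < M /\ forall x, a <= x <= b -> Rabs (u x) <= M.
Proof.
intros Hab Hu.
destruct (continuity_ab_maj (fun x => Rabs (u x)) a b Hab) as [x0 [Hmax Hx0]].
{ intros x Hx; apply (continuity_pt_comp u Rabs); [apply continuous_pt; auto|apply Rcontinuity_abs]. }
exists (Rabs (u x0) + 1); split; [pose proof (Rabs_pos (u x0)); lra|].
intros x Hx; specialize (Hmax x Hx); lra.
Qed.

(** Stated for the left end with A(al0) = lam0 > 0; the right end is obtained from it by reflection
    and a change of sign. Strict inequalities at lam0 persist for nearby lambda by monotonicity near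
    [al0], compactness farther away and the margin [eps] at infinity. *)
Lemma left_geometry (A A1 A2 A3 : R -> R) (lam0 al0 b N eps : R) : smooth3 A A1 A2 A3 ->
  0 < lam0 -> A al0 = lam0 -> A1 al0 <> 0 -> (forall x, x < al0 -> lam0 < Rabs (A x)) ->
  0 < eps -> (forall x, x < N -> lam0 + eps <= Rabs (A x)) ->
  al0 < b -> (forall x, al0 < x <= b -> Rabs (A x) < lam0) ->
  exists r0, 0 < r0 /\ forall r, 0 < r <= r0 -> exists c delta, 0 < c /\ 0 < delta /\
    al0 + 4 * r <= b /\ (forall x, Rabs (x - al0) <= 4 * r -> c <= A x /\ A1 x <= - c) /\
    forall lam, Rabs (lam - lam0) <= delta -> exists al, Rabs (al - al0) <= r /\ A al = lam /\
      (forall x, x < al -> lam < A x) /\ (forall x, al < x <= b -> Rabs (A x) < lam) /\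
      (forall x, al + r / 2 <= x <= b -> Rabs (A x) <= lam - c).
Proof.
intros HA Hlam0 Aal A1al Hout Heps Hlim Hb Hin.
destruct (smooth3_continuous _ _ _ _ HA) as (cA & cA1 & _ & _).
assert (dA := fun x => proj1 (HA x)).
set (s := Rabs (A1 al0)); assert (Hs : 0 < s) by (apply Rabs_pos_lt; auto).
destruct (continuous_near A al0 (lam0 / 2) (cA al0)) as (d & Hd & Hnd); [lra|].
destruct (continuous_near A1 al0 (s / 2) (cA1 al0)) as (d1 & Hd1 & Hnd1); [lra|].
set (d' := Rmin d d1); assert (Hd' : 0 < d') by (apply Rmin_glb_lt; auto).
assert (d'd : d' <= d) by apply Rmin_l; assert (d'd1 : d' <= d1) by apply Rmin_r.
assert (Apos : forall x, Rabs (x - al0) <= d' -> lam0 / 2 <= A x).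
{ intros x Hx; pose proof (Hnd x ltac:(lra)) as H; apply Rabs_lt_between in H; lra. }
(* A nonnegative, hence positive, slope would make 0 < A <= lam0 just left of [al0], where |A|
   exceeds lam0. *)
assert (A1neg : A1 al0 < 0).
{ destruct (Rle_or_lt 0 (A1 al0)) as [H|H]; auto; exfalso.
  assert (Es : s = A1 al0) by (apply Rabs_pos_eq; auto).
  assert (A (al0 - d') <= A al0).
  { apply (derive_nonneg_le A A1); [lra|auto|].
    intros t Ht; pose proof (Hnd1 t) as H1; assert (H2 : Rabs (t - al0) <= d1) by (apply Rabs_le; lra).
    specialize (H1 H2); apply Rabs_lt_between in H1; lra. }
  assert (Ha : lam0 / 2 <= A (al0 - d')).
  { apply Apos; replace (al0 - d' - al0) with (- d') by ring; rewrite Rabs_Ropp Rabs_pos_eq; lra. }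
  pose proof (Hout (al0 - d') ltac:(lra)) as Ho; rewrite Rabs_pos_eq in Ho; lra. }
assert (Es : s = - A1 al0) by (apply Rabs_left; auto).
set (c0 := Rmin (lam0 / 2) (s / 2)).
assert (Hc0 : 0 < c0) by (apply Rmin_glb_lt; lra).
assert (c0l : c0 <= lam0 / 2) by apply Rmin_l; assert (c0s : c0 <= s / 2) by apply Rmin_r.
assert (Hloc : forall x, Rabs (x - al0) <= d' -> c0 <= A x /\ A1 x <= - c0).
{ intros x Hx; split; [pose proof (Apos x Hx); lra|].
  pose proof (Hnd1 x ltac:(lra)) as H; apply Rabs_lt_between in H; lra. }
set (r0 := Rmin (d' / 4) ((b - al0) / 4)).
assert (Hr0 : 0 < r0) by (apply Rmin_glb_lt; lra).
assert (r0d : r0 <= d' / 4) by apply Rmin_l; assert (r0b : r0 <= (b - al0) / 4) by apply Rmin_r.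
exists r0; split; auto; intros r Hr.
assert (Hdec : forall x y, al0 - 4 * r <= x <= y -> y <= al0 + 4 * r -> c0 * (y - x) <= A x - A y).
{ intros x y Hx Hy.
  assert (- (A x) - c0 * x <= - (A y) - c0 * y); [|lra].
  apply (derive_nonneg_le (fun t => - (A t) - c0 * t) (fun t => - (A1 t) - c0)); [lra| |].
  - intros t Ht; apply is_derive_sub; [apply is_derive_neg; auto|].
    apply is_derive_lin.
  - intros t Ht; destruct (Hloc t) as [_ H]; [apply Rabs_le; lra|lra]. }
(* A zero of A on the left is impossible since |A| > lam0 there, so A keeps its positive sign. *)
assert (Aleft : forall x, x <= al0 - r -> 0 < A x).
{ intros x Hx; destruct (Rle_or_lt (A x) 0) as [H|H]; auto; exfalso.
  destruct (IVT_gen A x (al0 - r) 0) as [t [Ht At]].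
  - intros t; apply continuous_pt; auto.
  - assert (0 < A (al0 - r)) by (destruct (Hloc (al0 - r)) as [H1 _]; [apply Rabs_le; lra|lra]).
    rewrite Rmin_left ?Rmax_right; lra.
  - rewrite Rmin_left ?Rmax_right in Ht; auto. pose proof (Hout t ltac:(lra)) as Ho.
    rewrite At Rabs_R0 in Ho; lra. }
set (N' := Rmin N (al0 - r)).
assert (N'1 : N' <= N) by apply Rmin_l; assert (N'2 : N' <= al0 - r) by apply Rmin_r.
destruct (compact_gap A N' (al0 - r) lam0) as (e2 & He2 & Hgap2); auto.
{ intros x Hx; pose proof (Hout x ltac:(lra)) as Ho; rewrite Rabs_pos_eq in Ho; auto.
  left; apply Aleft; lra. }
destruct (compact_gap (fun x => - Rabs (A x)) (al0 + r) b (- lam0)) as (e1 & He1 & Hgap1).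
{ lra. }
{ intros x; apply (continuous_comp (fun x => Rabs (A x)) (fun x => - x)).
  - apply (continuous_comp A Rabs); auto; apply continuous_Rabs.
  - apply (is_derive_continuous _ _ (-1)); auto_derive; trivial; ring. }
{ intros x Hx; pose proof (Hin x ltac:(lra)); lra. }
set (e := Rmin eps (Rmin e1 e2)).
assert (He : 0 < e) by (repeat apply Rmin_glb_lt; auto).
assert (ee : e <= eps /\ e <= e1 /\ e <= e2).
{ unfold e; pose proof (Rmin_l eps (Rmin e1 e2)); pose proof (Rmin_r eps (Rmin e1 e2));
  pose proof (Rmin_l e1 e2); pose proof (Rmin_r e1 e2); lra. }
clearbody e; destruct ee as (ee0 & ee1 & ee2).
(* One number serves as [c] and as [delta]: e/2 leaves half of the gap after lambda moves, c0 r/2 is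
   the drop of A over the distance r/2, and c0/2 stays below the bounds on A and -A'. *)
set (w := Rmin (e / 2) (Rmin (c0 * (r / 2)) (c0 / 2))).
assert (Hcr : 0 < c0 * (r / 2)) by pos.
assert (Hw : 0 < w) by (repeat apply Rmin_glb_lt; lra).
assert (ww : w <= e / 2 /\ w <= c0 * (r / 2) /\ w <= c0 / 2).
{ unfold w; pose proof (Rmin_l (e / 2) (Rmin (c0 * (r / 2)) (c0 / 2))); pose proof (Rmin_r (e / 2) (Rmin (c0 * (r / 2)) (c0 / 2)));
  pose proof (Rmin_l (c0 * (r / 2)) (c0 / 2)); pose proof (Rmin_r (c0 * (r / 2)) (c0 / 2)); lra. }
clearbody w; destruct ww as (w1 & w2 & w3).
exists w, w; split; [auto|split; [auto|split; [lra|split]]].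
{ intros x Hx; destruct (Hloc x ltac:(lra)); lra. }
intros lam Hlam; apply Rabs_le_between in Hlam.
pose proof (Hdec (al0 - r) al0 ltac:(lra) ltac:(lra)) as D1.
pose proof (Hdec al0 (al0 + r) ltac:(lra) ltac:(lra)) as D2.
destruct (IVT_gen A (al0 - r) (al0 + r) lam) as [al [Hal Alam]].
{ intros t; apply continuous_pt; auto. }
{ rewrite Rmin_right ?Rmax_left; lra. }
rewrite Rmin_left ?Rmax_right in Hal; try lra.
exists al; split; [apply Rabs_le; lra|split; [auto|]].
assert (Near : forall x, al <= x <= al0 + 4 * r -> c0 * (x - al) <= lam - Rabs (A x) \/ c0 * (x - al) <= lam - A x /\ 0 < A x).
{ intros x Hx; right; split; [rewrite -Alam; apply Hdec; lra|].
  destruct (Hloc x); [apply Rabs_le; lra|lra]. }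
assert (Near' : forall x, al <= x <= al0 + 4 * r -> c0 * (x - al) <= lam - Rabs (A x)).
{ intros x Hx; destruct (Near x Hx) as [H|[H H0]]; auto; rewrite Rabs_pos_eq; lra. }
split; [|split].
- intros x Hx; destruct (Rle_or_lt x (al0 - r)) as [H|H].
  + destruct (Rle_or_lt N' x) as [H1|H1]; [pose proof (Hgap2 x ltac:(lra)); lra|].
    pose proof (Hlim x ltac:(lra)) as Hl; rewrite Rabs_pos_eq in Hl; [lra|left; auto].
  + pose proof (Hdec x al ltac:(lra) ltac:(lra)) as H1.
    assert (0 < c0 * (al - x)) by pos. lra.
- intros x Hx; destruct (Rle_or_lt x (al0 + 4 * r)) as [H|H].
  + pose proof (Near' x ltac:(lra)). assert (0 < c0 * (x - al)) by pos. lra.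
  + pose proof (Hgap1 x ltac:(lra)) as H1; cbv beta in H1; lra.
- intros x Hx; destruct (Rle_or_lt x (al0 + 4 * r)) as [H|H].
  + pose proof (Near' x ltac:(lra)). assert (c0 * (r / 2) <= c0 * (x - al)) by (apply Rmult_le_compat_l; lra). lra.
  + pose proof (Hgap1 x ltac:(lra)) as H1; cbv beta in H1; lra.
Qed.

(** * Quantization of a single well *)

(** The lambda terms rotate (Q, P) and cancel in the derivative of Q^2 + P^2, which is 4 A Q P / h;
    Gronwall then spreads a zero at one point to every other point. *)
Lemma zs_nonzero (A Q P : R -> R) (lam h : R) : 0 < h -> (forall x, continuous A x) ->
  (forall x, is_derive Q x ((lam + A x) * P x / h) /\ is_derive P x (- ((lam - A x) * Q x / h))) ->
  (exists x, Q x <> 0 \/ P x <> 0) -> forall x, Q x <> 0 \/ P x <> 0.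
Proof.
intros Hh cA Hs [x0 Hx0] x.
destruct (Req_dec (Q x) 0) as [HQ|HQ]; auto; destruct (Req_dec (P x) 0) as [HP|HP]; auto; exfalso.
destruct (compact_bound A (Rmin x x0) (Rmax x x0)) as (M & HM & HA); auto.
{ eapply Rle_trans; [apply Rmin_l|apply Rmax_l]. }
set (k := 2 * M / h).
set (n := fun y => Q y * Q y + P y * P y).
assert (n0 : 0 < n x0).
{ unfold n; destruct Hx0 as [H|H]; apply Rsqr_pos_lt in H; unfold Rsqr in H;
  [pose proof (Rle_0_sqr (P x0)) as H1|pose proof (Rle_0_sqr (Q x0)) as H1]; unfold Rsqr in H1; lra. }
assert (nx : n x = 0) by (unfold n; rewrite HQ HP; ring).
assert (dn : forall y, is_derive n y (4 * A y * (Q y * P y) / h)).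
{ intros y; destruct (Hs y) as [dQ dP]; eapply is_derive_eq;
  [apply is_derive_add; apply is_derive_mul; eauto|field; lra]. }
assert (bn : forall y, Rmin x x0 <= y <= Rmax x x0 -> Rabs (4 * A y * (Q y * P y) / h) <= k * n y).
{ intros y Hy; replace (4 * A y * (Q y * P y) / h) with (2 * / h * (A y * (2 * (Q y * P y)))) by (field; lra).
  replace (k * n y) with (2 * / h * (M * n y)) by (unfold k; field; lra).
  assert (0 < / h) by pos.
  apply Rabs_le_mult; [rewrite Rabs_pos_eq; lra|].
  apply Rabs_le_mult; auto. unfold n; apply Rabs_le.
  pose proof (Rle_0_sqr (Q y + P y)) as H1; pose proof (Rle_0_sqr (Q y - P y)) as H2; unfold Rsqr in *; lra. }
assert (G : forall y, Rmin x x0 <= y <= Rmax x x0 ->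
  is_derive n y (4 * A y * (Q y * P y) / h) /\ Rabs (4 * A y * (Q y * P y) / h) <= k * n y) by auto.
destruct (Rle_or_lt x x0) as [H|H].
- rewrite Rmin_left ?Rmax_right in G; auto.
  destruct (exp_growth n _ k x x0 H G) as [_ G1]; rewrite nx in G1; lra.
- rewrite Rmin_right ?Rmax_left in G; try lra.
  destruct (exp_growth n _ k x0 x (Rlt_le _ _ H) G) as [G1 _]; rewrite nx in G1; lra.
Qed.

Lemma amplitude_exists (u v : R) : 0 < u -> 0 < v -> exists k, 0 < k /\ k ^ 4 * v = u.
Proof.
intros Hu Hv; exists (Rpower (u / v) (1 / 4)); split; [apply exp_pos|].
rewrite -Rpower_pow; [|apply exp_pos]; rewrite Rpower_mult.
replace (1 / 4 * INR 4) with 1 by (simpl; field).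
rewrite Rpower_1; [field; lra|pos].
Qed.

Lemma amplitude_bounds (c M u v k : R) : 0 < c -> c <= u <= M -> c <= v <= M -> 0 < k ->
  k ^ 4 * v = u -> k <= 1 + M / c /\ / k <= 1 + M / c.
Proof.
intros Hc Hu Hv Hk E.
assert (B : forall t, 0 < t -> t ^ 4 <= M / c -> t <= 1 + M / c).
{ intros t Ht H; destruct (Rle_or_lt t 1) as [H1|H1].
  - assert (0 <= t ^ 4) by (apply pow_le; lra); lra.
  - assert (t <= t ^ 4) by (rewrite -{1}(pow_1 t); apply Rle_pow; [lra|lia]); lra. }
assert (Q : forall p q, c <= p <= M -> c <= q <= M -> p / q <= M / c).
{ intros p q Hp Hq; apply Rmult_le_compat; try lra.
  - left; apply Rinv_0_lt_compat; lra.
  - apply Rinv_le_contravar; lra. }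
split; apply B; auto.
- replace (k ^ 4) with (u / v) by (rewrite -E; field; lra); auto.
- apply Rinv_0_lt_compat; auto.
- replace ((/ k) ^ 4) with (v / u) by (rewrite -E; field; split; lra); auto.
Qed.

(** Cramer's rule: two approximate linear equations for (X, Y) whose determinant is sin (s + t),
    which must be small if (X, Y) is not. *)
Lemma phase_sum_sin (X Y s t e1 e2 : R) :
  Rabs (X * cos s - Y * sin s) <= e1 -> Rabs (X * cos t + Y * sin t) <= e2 ->
  Rabs (sin (s + t)) * (Rabs X + Rabs Y) <= 2 * (e1 + e2).
Proof.
intros H1 H2.
assert (S1 : forall x, Rabs (sin x) <= 1) by (intros; apply Rabs_le, SIN_bound).
assert (C1 : forall x, Rabs (cos x) <= 1) by (intros; apply Rabs_le, COS_bound).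
assert (B : forall u v p q, Rabs u <= e1 -> Rabs v <= e2 -> Rabs p <= 1 -> Rabs q <= 1 -> Rabs (u * p + v * q) <= e1 + e2).
{ intros u v p q Hu Hv Hp Hq; eapply Rle_trans; [apply Rabs_triang|].
  pose proof (Rabs_le_mult _ _ _ _ Hu Hp); pose proof (Rabs_le_mult _ _ _ _ Hv Hq); lra. }
assert (C1' : Rabs (- cos t) <= 1) by (rewrite Rabs_Ropp; auto).
pose proof (B _ _ _ _ H1 H2 (S1 t) (S1 s)) as HX.
pose proof (B _ _ _ _ H1 H2 C1' (C1 s)) as HY.
replace ((X * cos s - Y * sin s) * sin t + (X * cos t + Y * sin t) * sin s) with (sin (s + t) * X) in HX
  by (rewrite sin_plus; ring).
replace ((X * cos s - Y * sin s) * - cos t + (X * cos t + Y * sin t) * cos s) with (sin (s + t) * Y) in HY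
  by (rewrite sin_plus; ring).
rewrite Rabs_mult in HX; rewrite Rabs_mult in HY; lra.
Qed.

(** Exchanging X and Y in the second equation amounts to replacing t by pi/2 + t. *)
Lemma phase_sum_cos (X Y s t e1 e2 : R) :
  Rabs (X * cos s - Y * sin s) <= e1 -> Rabs (Y * cos t - X * sin t) <= e2 ->
  Rabs (cos (s + t)) * (Rabs X + Rabs Y) <= 2 * (e1 + e2).
Proof.
intros H1 H2.
replace (cos (s + t)) with (sin (s + (PI / 2 + t))).
2: { rewrite cos_sin; f_equal; ring. }
apply phase_sum_sin; auto.
rewrite -Rabs_Ropp in H2.
replace (cos (PI / 2 + t)) with (- sin t) by (rewrite sin_cos; ring).
rewrite -cos_sin. replace (X * - sin t + Y * cos t) with (Y * cos t - X * sin t) by ring.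
rewrite -Rabs_Ropp; auto.
Qed.

Lemma smooth3_reflect (A A1 A2 A3 : R -> R) (sg : R) : smooth3 A A1 A2 A3 ->
  smooth3 (fun x => sg * A (- x)) (fun x => - sg * A1 (- x)) (fun x => sg * A2 (- x)) (fun x => - sg * A3 (- x)).
Proof.
intros HA.
assert (dr : forall u u1 s x, is_derive u (- x) (u1 (- x)) -> is_derive (fun x => s * u (- x)) x (- s * u1 (- x))).
{ intros u u1 s x Hu; eapply is_derive_eq.
  - apply is_derive_mul; [apply is_derive_cst|].
    apply (is_derive_compR u (fun x => - x)); [exact Hu|].
    instantiate (1 := -1); auto_derive; trivial; ring.
  - cbv beta; ring. }
intros x; destruct (HA (- x)) as (d & d1 & d2 & c3).
split; [apply (dr A A1); auto|split; [|split]].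
- eapply is_derive_eq; [apply (dr A1 A2 (- sg)); auto|ring].
- apply (dr A2 A3); auto.
- apply continuousZ, (continuous_comp (fun x => - x) A3); auto.
  apply (is_derive_continuous _ _ (-1)); auto_derive; trivial; ring.
Qed.

Lemma RInt_reflect (u : R -> R) (a b : R) : (forall x, continuous u x) ->
  RInt (fun x => u (- x)) a b = RInt u (- b) (- a) :> R.
Proof.
intros Hu.
assert (E : forall a b, ex_RInt u a b) by (intros; apply (ex_RInt_continuous (V := R_CompleteNormedModule)); auto).
assert (H := is_RInt_comp_opp u a b _ (RInt_correct (V := R_CompleteNormedModule) u (- a) (- b) (E _ _))).
apply (is_RInt_opp (V := R_NormedModule)) in H.
transitivity (opp (RInt u (- a) (- b))).
- apply is_RInt_unique; eapply is_RInt_ext; [|exact H].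
  intros x _; unfold opp; simpl; ring.
- apply (opp_RInt_swap (V := R_CompleteNormedModule)); auto.
Qed.

(** The signs of QP in the forbidden tails that square integrability leaves possible. On the left
    the sign of A is normalised to be positive; on the right both signs occur, one for each case of
    the theorem. *)
Definition decaying (A : R -> R) (lam : R) (Q P : R -> R) : Prop :=
  (forall x0, (forall x, x <= x0 -> lam < A x) -> 0 <= Q x0 * P x0) /\
  (forall x0, (forall x, x0 <= x -> lam < A x) -> Q x0 * P x0 <= 0) /\
  (forall x0, (forall x, x0 <= x -> A x < - lam) -> 0 <= Q x0 * P x0).

(* In the forbidden regions QP is monotone, so a wrong sign would keep |QP| away from zero. *)
Lemma decaying_of_tails (A Q P : R -> R) (h lam : R) : 0 < h -> 0 < lam ->
  (forall x, is_derive Q x ((lam + A x) * P x / h) /\ is_derive P x (- ((lam - A x) * Q x / h))) ->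
  (forall x0 c, 0 < c -> ~ (forall x, x0 <= x -> c <= Q x ^ 2 + P x ^ 2) /\
                  ~ (forall x, x <= x0 -> c <= Q x ^ 2 + P x ^ 2)) ->
  decaying A lam Q P.
Proof.
intros Hh Hlam Hs Ht.
assert (Hi : 0 < / h) by (apply Rinv_0_lt_compat; auto).
assert (dQP : forall x, is_derive (fun x => Q x * P x) x (/ h * ((lam + A x) * P x ^ 2 + (A x - lam) * Q x ^ 2))).
{ intros x; destruct (Hs x) as [d1 d2]; eapply is_derive_eq; [apply is_derive_mul; eauto|field; lra]. }
assert (up : forall a b, a <= b -> (forall x, a <= x <= b -> lam < A x) -> Q a * P a <= Q b * P b).
{ intros a b Hab H; apply (derive_nonneg_le (fun x => Q x * P x) _ a b Hab (fun t _ => dQP t)).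
  intros t Htt; specialize (H t Htt); apply Rmult_le_pos; [lra|].
  pos. }
assert (down : forall a b, a <= b -> (forall x, a <= x <= b -> A x < - lam) -> Q b * P b <= Q a * P a).
{ intros a b Hab H; apply Ropp_le_cancel.
  apply (derive_nonneg_le (fun x => - (Q x * P x)) _ a b Hab (fun t _ => is_derive_neg _ _ _ (dQP t))).
  intros t Htt; specialize (H t Htt); rewrite Ropp_mult_distr_r; apply Rmult_le_pos; [lra|].
  assert (0 <= (- lam - A t) * P t ^ 2) by (apply Rmult_le_pos; [lra|apply pow2_ge_0]).
  assert (0 <= (lam - A t) * Q t ^ 2) by (apply Rmult_le_pos; [lra|apply pow2_ge_0]). lra. }
assert (sq : forall x, 2 * (Q x * P x) <= Q x ^ 2 + P x ^ 2 /\ - (2 * (Q x * P x)) <= Q x ^ 2 + P x ^ 2).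
{ intros x; pose proof (pow2_ge_0 (Q x - P x)); pose proof (pow2_ge_0 (Q x + P x)); lra. }
split; [|split]; intros x0 H; apply Rnot_lt_le; intros Hneg.
- apply (proj2 (Ht x0 (- (2 * (Q x0 * P x0))) ltac:(lra))); intros x Hx.
  pose proof (up x x0 Hx (fun y Hy => H y (proj2 Hy))); pose proof (sq x); lra.
- apply (proj1 (Ht x0 (2 * (Q x0 * P x0)) ltac:(lra))); intros x Hx.
  pose proof (up x0 x Hx (fun y Hy => H y (proj1 Hy))); pose proof (sq x); lra.
- apply (proj1 (Ht x0 (- (2 * (Q x0 * P x0))) ltac:(lra))); intros x Hx.
  pose proof (down x0 x Hx (fun y Hy => H y (proj1 Hy))); pose proof (sq x); lra.
Qed.

(** The phase s at [x2] comes from the left turning point by connection and WKB propagation, the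
    phase t from the right one by connection for the reflected potential [B]. Two phase conditions
    on one nonzero vector are compatible only if the sine, or the cosine, of s + t = I/h + 2 theta
    is small. *)
Lemma well_quantization (theta : R) (A A1 A2 A3 : R -> R) (lam0 al0 be0 sg N eps : R) :
  is_connection_phase theta -> smooth3 A A1 A2 A3 -> 0 < lam0 -> al0 < be0 ->
  A al0 = lam0 -> A be0 = sg * lam0 -> sg = 1 \/ sg = -1 -> A1 al0 <> 0 -> A1 be0 <> 0 ->
  (forall x, al0 < x < be0 -> Rabs (A x) < lam0) ->
  (forall x, x < al0 \/ be0 < x -> lam0 < Rabs (A x)) ->
  0 < eps -> (forall x, N < Rabs x -> lam0 + eps <= Rabs (A x)) ->
  exists delta h0 C, 0 < delta /\ 0 < h0 /\ 0 < C /\ forall lam, Rabs (lam - lam0) <= delta ->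
  exists al be, al < be /\ (forall x, lam ^ 2 - A x ^ 2 = 0 <-> x = al \/ x = be) /\
  forall h Q P, 0 < h <= h0 ->
  (forall x, is_derive Q x ((lam + A x) * P x / h) /\ is_derive P x (- ((lam - A x) * Q x / h))) ->
  (exists x, Q x <> 0 \/ P x <> 0) -> decaying A lam Q P ->
  (sg = 1 -> Rabs (sin (RInt (fun t => sqrt (lam ^ 2 - A t ^ 2)) al be / h + 2 * theta)) <= C * h) /\
  (sg = -1 -> Rabs (cos (RInt (fun t => sqrt (lam ^ 2 - A t ^ 2)) al be / h + 2 * theta)) <= C * h).
Proof.
intros Hth HA Hlam0 Hab Aal Abe Hsg A1al A1be Hin Hout Heps Hlim.
destruct (smooth3_continuous _ _ _ _ HA) as (cA & cA1 & cA2 & cA3).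
(* The midpoint splits the well so that each half is governed by its own end. *)
set (b := (al0 + be0) / 2).
assert (Hb : al0 < b < be0) by (unfold b; lra).
assert (sg2 : sg * sg = 1) by (destruct Hsg; subst sg; ring).
assert (sgabs : forall x, Rabs (sg * x) = Rabs x).
{ intros x; destruct Hsg; subst sg; [rewrite Rmult_1_l; auto|].
  replace (-1 * x) with (- x) by ring; apply Rabs_Ropp. }
pose proof (smooth3_reflect _ _ _ _ sg HA) as HB.
set (B := fun x => sg * A (- x)) in HB; set (B1 := fun x => - sg * A1 (- x)) in HB;
set (B2 := fun x => sg * A2 (- x)) in HB; set (B3 := fun x => - sg * A3 (- x)) in HB.
destruct (left_geometry A A1 A2 A3 lam0 al0 b (- Rabs N) eps HA) as (r1 & Hr1 & G1); auto; try lra.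
{ intros x Hx; apply Hlim; pose proof (Rle_abs (- x)); pose proof (Rle_abs N); rewrite Rabs_Ropp in H; lra. }
{ intros x Hx; apply Hin; lra. }
destruct (left_geometry B B1 B2 B3 lam0 (- be0) (- b) (- Rabs N) eps HB) as (r2 & Hr2 & G2); auto; try lra.
{ unfold B; rewrite Ropp_involutive Abe -Rmult_assoc sg2; ring. }
{ unfold B1; rewrite Ropp_involutive; apply Rmult_integral_contrapositive_currified; auto.
  destruct Hsg; subst sg; lra. }
{ intros x Hx; unfold B; rewrite sgabs; apply Hout; lra. }
{ intros x Hx; unfold B; rewrite sgabs; apply Hlim; rewrite Rabs_Ropp.
  pose proof (Rle_abs (- x)); pose proof (Rle_abs N); rewrite Rabs_Ropp in H; lra. }
{ intros x Hx; unfold B; rewrite sgabs; apply Hin; lra. }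
set (r := Rmin r1 r2).
assert (Hr : 0 < r) by (apply Rmin_glb_lt; auto).
assert (rr1 : r <= r1) by apply Rmin_l; assert (rr2 : r <= r2) by apply Rmin_r.
destruct (G1 r ltac:(lra)) as (c1 & d1 & Hc1 & Hd1 & Hb1 & Hn1 & K1).
destruct (G2 r ltac:(lra)) as (c2 & d2 & Hc2 & Hd2 & Hb2 & Hn2 & K2).
clear G1 G2; clearbody r.
set (c := Rmin c1 c2).
assert (Hc : 0 < c) by (apply Rmin_glb_lt; auto).
assert (cc1 : c <= c1) by apply Rmin_l; assert (cc2 : c <= c2) by apply Rmin_r; clearbody c.
assert (HMex : exists M, 0 < M /\ forall x, al0 - 4 * r <= x <= be0 + 4 * r ->
  Rabs (A x) <= M /\ Rabs (A1 x) <= M /\ Rabs (A2 x) <= M /\ Rabs (A3 x) <= M).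
{ assert (Hord : al0 - 4 * r <= be0 + 4 * r) by lra.
  destruct (compact_bound A _ _ Hord cA) as (m0 & Hm0 & B0).
  destruct (compact_bound A1 _ _ Hord cA1) as (m1 & Hm1 & B1').
  destruct (compact_bound A2 _ _ Hord cA2) as (m2 & Hm2 & B2').
  destruct (compact_bound A3 _ _ Hord cA3) as (m3 & Hm3 & B3').
  exists (m0 + m1 + m2 + m3); split; [lra|]; intros x Hx.
  specialize (B0 x Hx); specialize (B1' x Hx); specialize (B2' x Hx); specialize (B3' x Hx).
  repeat split; lra. }
destruct HMex as (M & HM & HMb).
destruct (zs_turning c M Hc HM) as (ct & Mt & Hct & HMt & Hturn).
destruct (Hth ct Mt r Hct HMt Hr) as (C1 & h1 & HC1 & Hh1 & Hcon).
destruct (wkb_propagation c (2 * M) (be0 - al0) Hc ltac:(lra) ltac:(lra)) as (C2 & HC2 & Hwkb).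
set (Kb := 1 + 2 * M / c).
assert (HKb : 0 < Kb).
{ unfold Kb; assert (0 < 2 * M / c) by pos; lra. }
set (CE := C2 * (1 + C1) + C1).
assert (HCE : 0 < CE).
{ unfold CE; assert (0 < C2 * (1 + C1)) by pos; lra. }
exists (Rmin d1 d2), (Rmin 1 h1), (2 * CE * Kb).
split; [apply Rmin_glb_lt; auto|split; [apply Rmin_glb_lt; lra|split; [pos|]]].
intros lam Hlam.
assert (Hl1 : Rabs (lam - lam0) <= d1) by (eapply Rle_trans; [exact Hlam|apply Rmin_l]).
assert (Hl2 : Rabs (lam - lam0) <= d2) by (eapply Rle_trans; [exact Hlam|apply Rmin_r]).
destruct (K1 lam Hl1) as (al & Hal & Alam & Lout & Lin & Lgap).
destruct (K2 lam Hl2) as (bm & Hbm & Blam & Rout & Rin & Rgap).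
clear K1 K2; set (be := - bm).
assert (Ebm : bm = - be) by (unfold be; ring); clearbody be; subst bm.
apply Rabs_le_between in Hal; apply Rabs_le_between in Hbm.
assert (Rout' : forall x, be < x -> lam < sg * A x).
{ intros x Hx; pose proof (Rout (- x) ltac:(lra)) as H; unfold B in H; rewrite Ropp_involutive in H; auto. }
assert (Rin' : forall x, b <= x < be -> Rabs (A x) < lam).
{ intros x Hx; pose proof (Rin (- x) ltac:(lra)) as H; unfold B in H; rewrite Ropp_involutive sgabs in H; auto. }
assert (Rgap' : forall x, b <= x <= be - r / 2 -> Rabs (A x) <= lam - c).
{ intros x Hx; pose proof (Rgap (- x) ltac:(lra)) as H; unfold B in H; rewrite Ropp_involutive sgabs in H; lra. }
assert (Abe' : A be = sg * lam).
{ unfold B in Blam; rewrite Ropp_involutive in Blam; rewrite -Blam -Rmult_assoc sg2; ring. }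
assert (lampos : c <= lam) by (rewrite -Alam; destruct (Hn1 al) as [H _]; [apply Rabs_le; lra|lra]).
assert (inside : forall x, al < x < be -> Rabs (A x) < lam).
{ intros x Hx; destruct (Rle_or_lt x b); [apply Lin|apply Rin']; lra. }
exists al, be; split; [lra|split].
{ assert (Fac : forall x, lam ^ 2 - A x ^ 2 = (lam - Rabs (A x)) * (lam + Rabs (A x))).
  { intros x; rewrite -(pow2_abs (A x)); ring. }
  intros x; rewrite Fac; split.
  - intros H; apply Rmult_integral in H; pose proof (Rabs_pos (A x)).
    destruct H as [H|H]; [|lra].
    destruct (Rtotal_order x al) as [L|[E|L]]; auto.
    + specialize (Lout x L); pose proof (Rle_abs (A x)); lra.
    + destruct (Rtotal_order x be) as [L'|[E|L']]; auto.
      * specialize (inside x ltac:(lra)); lra.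
      * specialize (Rout' x L'); pose proof (Rle_abs (sg * A x)); rewrite sgabs in H1; lra.
  - intros [->| ->].
    + rewrite Alam Rabs_pos_eq; [ring|lra].
    + rewrite Abe' sgabs Rabs_pos_eq; [ring|lra]. }

(* Phase conditions at a common point of the well *)
intros h Q P Hh Hs Hnz (Dl & Dr & Dr').
assert (Hh1' : 0 < h <= h1) by (split; [lra|eapply Rle_trans; [apply Hh|apply Rmin_r]]).
assert (Hhone : 0 < h <= 1) by (split; [lra|eapply Rle_trans; [apply Hh|apply Rmin_l]]).
set (F := fun t => sqrt (lam ^ 2 - A t ^ 2)).
assert (cF : forall x, continuous F x).
{ intros x; apply (continuous_comp (fun t => lam ^ 2 - A t ^ 2) sqrt); [|apply continuous_sqrt].
  apply (continuous_minus (V := R_NormedModule)); [apply continuous_const|].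
  apply (is_derive_continuous _ _ (INR 2 * A1 x * A x ^ pred 2)).
  apply (is_derive_pow A 2), (HA x). }
assert (EF : forall u v, ex_RInt F u v).
{ intros u v; apply (ex_RInt_continuous (V := R_CompleteNormedModule)); auto. }
assert (T1 : simple_turning ct Mt (2 * r) al (fun x => lam + A x) (fun x => lam - A x)).
{ apply (Hturn A A1 A2 A3); auto; [lra|]; intros x Hx.
  destruct (Hn1 x) as [n1 n2]; [apply Rabs_le; lra|].
  destruct (HMb x ltac:(lra)) as (m0 & m1 & m2 & m3).
  pose proof (Rle_abs (A x)); repeat split; auto; lra. }
set (x1 := al + r); set (x2 := be - r).
assert (fb : forall x, al + r / 2 <= x <= be - r / 2 -> c <= lam + A x <= 2 * M /\ c <= lam - A x <= 2 * M).
{ intros x Hx.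
  assert (Rabs (A x) <= lam - c).
  { destruct (Rle_or_lt x b); [pose proof (Lgap x ltac:(lra)); lra|apply Rgap'; lra]. }
  apply Rabs_le_between in H.
  assert (lam <= M).
  { rewrite -Alam; destruct (HMb al ltac:(lra)) as (m0 & _); pose proof (Rle_abs (A al)); lra. }
  lra. }
destruct (fb x1 ltac:(unfold x1; lra)) as [f1 g1]; destruct (fb x2 ltac:(unfold x2; lra)) as [f2 g2].
destruct (amplitude_exists (lam + A x1) (lam - A x1)) as (ka & Hka & Eka); try lra.
destruct (amplitude_exists (lam + A x2) (lam - A x2)) as (kb & Hkb & Ekb); try lra.
assert (I1 := Hcon al _ _ h Q P ka T1 Hh1' (fun x _ => Hs x)).
assert (S1 : 0 <= Q (al - r) * P (al - r)) by (apply Dl; intros x Hx; apply Lout; lra).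
fold x1 in I1; specialize (I1 S1 Hka Eka).
assert (FE : forall u v, RInt (fun x => sqrt ((lam + A x) * (lam - A x))) u v = RInt F u v :> R).
{ intros u v; apply RInt_ext; intros x _; unfold F; f_equal; ring. }
rewrite FE in I1.
assert (Cf : C2b (al + r / 2) (be - r / 2) (2 * M) (fun x => lam + A x) A1 A2).
{ intros x Hx; destruct (HA x) as (d & dd1 & dd2 & _).
  destruct (HMb x ltac:(lra)) as (m0 & m1 & m2 & m3); destruct (fb x ltac:(lra)).
  split; [|split; [|split; [|repeat split]]]; auto; try lra.
  - eapply is_derive_eq; [apply is_derive_add; [apply is_derive_cst|exact d]|ring].
  - rewrite Rabs_pos_eq; lra. }
assert (Cg : C2b (al + r / 2) (be - r / 2) (2 * M) (fun x => lam - A x) (fun x => - A1 x) (fun x => - A2 x)).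
{ intros x Hx; destruct (HA x) as (d & dd1 & dd2 & _).
  destruct (HMb x ltac:(lra)) as (m0 & m1 & m2 & m3); destruct (fb x ltac:(lra)).
  split; [|split; [|split; [|repeat split]]]; try (rewrite Rabs_Ropp; lra).
  - eapply is_derive_eq; [apply is_derive_sub; [apply is_derive_cst|exact d]|ring].
  - apply is_derive_neg; auto.
  - apply (continuous_opp (V := R_NormedModule)); auto.
  - rewrite Rabs_pos_eq; lra. }
assert (I2 := Hwkb _ _ _ _ _ _ _ _ Cf Cg).
assert (I2' := I2 (fun x Hx => conj (proj1 (proj1 (fb x (conj (Rlt_le _ _ (proj1 Hx)) (Rlt_le _ _ (proj2 Hx))))))
   (proj1 (proj2 (fb x (conj (Rlt_le _ _ (proj1 Hx)) (Rlt_le _ _ (proj2 Hx)))))))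
   h Q P x1 x2 Hhone (fun x _ => Hs x)).
specialize (I2' ltac:(unfold x1; lra) ltac:(unfold x1, x2; lra) ltac:(unfold x2; lra) ltac:(unfold x1, x2; lra)
  C1 ka kb _ ltac:(lra) Hka Eka Hkb Ekb I1).
rewrite FE in I2'. clear I2 I1.
set (s := RInt F al x1 / h + theta + RInt F x1 x2 / h) in I2'.
set (T := Rabs (Q x2) + Rabs (P x2)) in *.
set (X := Q x2 / kb); set (Y := P x2 * kb).
destruct (amplitude_bounds c (2 * M) _ _ kb Hc f2 g2 Hkb Ekb) as [kb1 kb2]; fold Kb in kb1, kb2.
assert (HT : T <= Kb * (Rabs X + Rabs Y)).
{ unfold T; replace (Q x2) with (kb * X) by (unfold X; field; lra).
  replace (P x2) with (/ kb * Y) by (unfold Y; field; lra).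
  rewrite (Rabs_mult kb X) (Rabs_mult (/ kb) Y) (Rabs_pos_eq kb); [|lra].
  rewrite (Rabs_pos_eq (/ kb)); [|left; apply Rinv_0_lt_compat; auto].
  pose proof (Rmult_le_compat_r _ _ _ (Rabs_pos X) kb1); pose proof (Rmult_le_compat_r _ _ _ (Rabs_pos Y) kb2). lra. }
assert (HXY : 0 < Rabs X + Rabs Y).
{ pose proof (Rabs_pos X); pose proof (Rabs_pos Y).
  destruct (zs_nonzero A Q P lam h ltac:(lra) cA Hs Hnz x2) as [Hn|Hn].
  - assert (0 < Rabs X); [|lra]. apply Rabs_pos_lt; unfold X, Rdiv.
    apply Rmult_integral_contrapositive_currified; auto; apply Rinv_neq_0_compat; lra.
  - assert (0 < Rabs Y); [|lra]. apply Rabs_pos_lt; unfold Y.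
    apply Rmult_integral_contrapositive_currified; auto; lra. }
assert (T2 : simple_turning ct Mt (2 * r) (- be) (fun x => lam + B x) (fun x => lam - B x)).
{ apply (Hturn B B1 B2 B3); auto; [lra|]; intros x Hx.
  destruct (Hn2 x) as [n1 n2]; [apply Rabs_le; lra|].
  destruct (HMb (- x) ltac:(lra)) as (m0 & m1 & m2 & m3).
  pose proof (Rle_abs (B x)) as H; unfold B in H at 2; rewrite sgabs in H.
  repeat split; try lra.
  - unfold B1; rewrite Ropp_mult_distr_l_reverse Rabs_Ropp sgabs; auto.
  - unfold B2; rewrite sgabs; auto.
  - unfold B3; rewrite Ropp_mult_distr_l_reverse Rabs_Ropp sgabs; auto. }
assert (Ex2 : - be + r = - x2) by (unfold x2; ring).
assert (FB : RInt (fun x => sqrt ((lam + B x) * (lam - B x))) (- be) (- be + r) = RInt F x2 be :> R).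
{ transitivity (RInt (fun x => F (- x)) (- be) (- be + r)).
  - apply RInt_ext; intros x _; unfold F, B; f_equal.
    transitivity (lam ^ 2 - (sg * sg) * A (- x) ^ 2); [ring|rewrite sg2; ring].
  - rewrite RInt_reflect // Ex2 !Ropp_involutive; auto. }
assert (dopp : forall u l x, is_derive u (- x) l -> is_derive (fun x => u (- x)) x (- l)).
{ intros u l x Hu; eapply is_derive_eq.
  - apply (is_derive_compR u (fun x => - x)); [exact Hu|].
    instantiate (1 := -1); auto_derive; trivial; ring.
  - ring. }
set (t := RInt F x2 be / h + theta).
assert (Est : s + t = RInt F al be / h + 2 * theta).
{ rewrite -(RInt_Chasles (V := R_CompleteNormedModule) F al x1 be) // -(RInt_Chasles (V := R_CompleteNormedModule) F x1 x2 be) //.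
  unfold s, t, plus; simpl; field; lra. }
assert (Hx0 : - be - r = - (be + r)) by ring.
(* The errors are proportional to |Q| + |P| at [x2], which the amplitude bounds compare with |X| +
   |Y|; this is positive by uniqueness and cancels. *)
assert (final : forall w, Rabs w * (Rabs X + Rabs Y) <= 2 * (C2 * (1 + C1) * h * T + C1 * h * T) -> Rabs w <= 2 * CE * Kb * h).
{ intros w Hw; apply Rmult_le_reg_r with (Rabs X + Rabs Y); auto.
  eapply Rle_trans; [exact Hw|].
  replace (2 * (C2 * (1 + C1) * h * T + C1 * h * T)) with (2 * CE * h * T) by (unfold CE; ring).
  replace (2 * CE * Kb * h * (Rabs X + Rabs Y)) with (2 * CE * h * (Kb * (Rabs X + Rabs Y))) by ring.
  apply Rmult_le_compat_l; auto; pos. }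
split; intros Es; subst sg; fold F; rewrite -Est; apply final.
(* Reflection reverses one derivative sign, so (Q, -P) solves the system of the reflected
   potential. *)
- assert (I3 := Hcon (- be) _ _ h (fun x => Q (- x)) (fun x => - P (- x)) kb T2 Hh1').
  cbv beta in I3; rewrite FB Ex2 Hx0 !Ropp_involutive in I3.
  apply phase_sum_sin; auto.
  replace (X * cos t + Y * sin t) with (Q x2 / kb * cos t - - P x2 * kb * sin t) by (unfold X, Y; ring).
  replace T with (Rabs (Q x2) + Rabs (- P x2)) by (rewrite Rabs_Ropp; reflexivity).
  apply I3; auto.
  + intros x _; destruct (Hs (- x)) as [dQ dP]; split; eapply is_derive_eq.
    * apply dopp, dQ.
    * unfold B; rewrite Rmult_1_l; field; lra.
    * apply is_derive_neg, dopp, dP.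
    * unfold B; rewrite Rmult_1_l; field; lra.
  + pose proof (Dr (be + r)) as H.
    assert (Q (be + r) * P (be + r) <= 0); [|lra].
    apply H; intros x Hx; pose proof (Rout' x ltac:(lra)); lra.
  + unfold B; rewrite Ropp_involutive Rmult_1_l; auto.
(* When A = -lambda at the right end it is f that vanishes. Exchanging Q and P exchanges f and g, so
   the amplitude becomes [/ kb] and the cosine appears. *)
- assert (I3 := Hcon (- be) _ _ h (fun x => P (- x)) (fun x => Q (- x)) (/ kb) T2 Hh1').
  cbv beta in I3; rewrite FB Ex2 Hx0 !Ropp_involutive in I3.
  apply phase_sum_cos; auto.
  replace (Y * cos t - X * sin t) with (P x2 / / kb * cos t - Q x2 * / kb * sin t) by (unfold X, Y; field; lra).
  replace T with (Rabs (P x2) + Rabs (Q x2)) by (unfold T; ring).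
  apply I3; auto.
  + intros x _; destruct (Hs (- x)) as [dQ dP]; split; eapply is_derive_eq.
    * apply dopp, dP.
    * unfold B; field; lra.
    * apply dopp, dQ.
    * unfold B; field; lra.
  + pose proof (Dr' (be + r)) as H. rewrite Rmult_comm; apply H; intros x Hx; pose proof (Rout' x ltac:(lra)); lra.
  + apply Rinv_0_lt_compat; auto.
  + unfold B; rewrite Ropp_involutive.
    replace (lam - -1 * A x2) with (lam + A x2) by ring.
    replace (lam + -1 * A x2) with (lam - A x2) by ring.
    rewrite -Ekb; field; lra.
Qed.

(** * The value of the connection phase *)

(* [herm h n x = (H n x, H (n - 1) x)], with [H n x * exp (- x^2 / (2 h))] the Hermite functions. *)
Fixpoint herm (h : R) (n : nat) (x : R) : R * R :=
  match n with
  | O => (1, 0)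
  | S m => (2 * x * fst (herm h m x) - 2 * INR m * h * snd (herm h m x), fst (herm h m x))
  end.

Lemma is_derive_herm (h : R) (n : nat) (x : R) :
  is_derive (fun x => fst (herm h n x)) x (2 * INR n * snd (herm h n x)).
Proof.
(* The recurrence reaches two steps back, so consecutive indices are proved together. *)
enough (H : forall x, is_derive (fun x => fst (herm h n x)) x (2 * INR n * snd (herm h n x)) /\
  is_derive (fun x => fst (herm h (S n) x)) x (2 * INR (S n) * snd (herm h (S n) x))) by apply H.
clear x; induction n as [|n IH]; intros x.
- simpl; split.
  + eapply is_derive_eq; [apply is_derive_cst|ring].
  + auto_derive; trivial; ring.
- split; [apply IH|].
  apply (is_derive_ext (fun x => 2 * x * fst (herm h (S n) x) - 2 * INR (S n) * h * fst (herm h n x))); [reflexivity|].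
  destruct (IH x) as [d0 d1]; eapply is_derive_eq.
  + apply is_derive_sub.
    * apply (is_derive_mul (fun x => 2 * x)); [|exact d1].
      instantiate (1 := 2); auto_derive; trivial; ring.
    * apply is_derive_mul; [apply is_derive_cst|exact d0].
  + cbv beta. rewrite (S_INR (S n)). simpl (snd _). simpl (fst (herm h (S n) x)). ring.
Qed.

(** If H_(n+1) vanished identically, so would its derivative 2 (n + 1) H_n. *)
Lemma herm_nonzero (h : R) (n : nat) : exists x, fst (herm h n x) <> 0.
Proof.
induction n as [|n [x0 IH]]; [exists 0; simpl; lra|].
apply Classical_Pred_Type.not_all_ex_not; intros H.
pose proof (is_derive_herm h (S n) x0) as D.
assert (D0 : is_derive (fun x => fst (herm h (S n) x)) x0 0).
{ apply (is_derive_ext (fun _ => 0)); [intros t; symmetry; apply H|apply is_derive_cst]. }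
apply is_derive_unique in D; apply is_derive_unique in D0; rewrite D0 in D.
symmetry in D; apply Rmult_integral in D; destruct D as [D|D]; [|contradiction].
assert (0 < INR (S n)) by (apply lt_0_INR; lia). lra.
Qed.

(** An exponential bound survives the recurrence because |x| <= exp |x|, and the Gaussian still
    dominates it. *)
Lemma herm_growth (h : R) (n : nat) : 0 < h -> exists C, 0 < C /\ forall x,
  Rabs (fst (herm h n x)) <= C * exp (INR n * Rabs x) /\ Rabs (snd (herm h n x)) <= C * exp (INR n * Rabs x).
Proof.
intros Hh; induction n as [|n [C [HC IH]]].
- exists 1; split; [lra|]; intros x; simpl; rewrite Rmult_0_l exp_0 Rabs_R1 Rabs_R0; lra.
- pose proof (pos_INR n) as Hn.
  assert (0 <= 2 * INR n * h) by pos.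
  exists (2 * C + 2 * INR n * h * C + C); split.
  { assert (0 <= 2 * INR n * h * C) by pos. lra. }
  intros x; destruct (IH x) as [I1 I2].
  assert (E : exp (INR (S n) * Rabs x) = exp (Rabs x) * exp (INR n * Rabs x)).
  { rewrite -exp_plus; f_equal; rewrite S_INR; ring. }
  pose proof (Rabs_pos x) as Hx.
  assert (E1 : Rabs x <= exp (Rabs x)) by (pose proof (exp_ineq1_le (Rabs x)); lra).
  assert (E2 : 1 <= exp (Rabs x)) by (pose proof (exp_ineq1_le (Rabs x)); lra).
  assert (E0 := exp_pos (INR n * Rabs x)).
  set (w := exp (INR n * Rabs x)) in *; set (v := exp (Rabs x)) in *.
  assert (Hvw : w <= v * w) by (rewrite -{1}(Rmult_1_l w); apply Rmult_le_compat_r; lra).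
  assert (Cw : C * w <= C * (v * w)) by (apply Rmult_le_compat_l; lra).
  assert (CC : 0 <= C * (v * w)) by pos.
  assert (CC2 : 0 <= 2 * INR n * h * (C * (v * w))) by pos.
  rewrite E; simpl fst; simpl snd; split; [|lra].
  eapply Rle_trans; [apply Rabs_triang|]; rewrite Rabs_Ropp.
  assert (Rabs (2 * x * fst (herm h n x)) <= 2 * v * (C * w)).
  { apply Rabs_le_mult; auto; apply Rabs_le_mult; auto; rewrite Rabs_pos_eq; lra. }
  assert (Rabs (2 * INR n * h * snd (herm h n x)) <= 2 * INR n * h * (C * (v * w))).
  { apply Rabs_le_mult; [rewrite Rabs_pos_eq; lra|lra]. }
  lra.
Qed.

Lemma RInt_half_circle : RInt (fun t => sqrt (1 - t ^ 2)) (-1) 1 = PI / 2.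
Proof.
assert (HP := PI_RGT_0).
assert (cf : forall x, continuous (fun t => sqrt (1 - t ^ 2)) x).
{ intros x; apply (continuous_comp (fun t => 1 - t ^ 2) sqrt); [|apply continuous_sqrt].
  apply (is_derive_continuous _ _ (- 2 * x)); auto_derive; trivial; ring. }
transitivity (RInt (fun t => sqrt (1 - t ^ 2)) (sin (- (PI / 2))) (sin (PI / 2))).
{ rewrite sin_neg sin_PI2; reflexivity. }
assert (H : is_RInt (fun y => scal (cos y) (sqrt (1 - sin y ^ 2))) (- (PI / 2)) (PI / 2)
    (RInt (fun t => sqrt (1 - t ^ 2)) (sin (- (PI / 2))) (sin (PI / 2)))).
{ apply (is_RInt_comp (fun t => sqrt (1 - t ^ 2)) sin cos).
  - intros; apply cf.
  - intros x _; split; [apply is_derive_sin|apply continuous_cos]. }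
rewrite -(is_RInt_unique _ _ _ _ H); apply is_RInt_unique.
apply (is_RInt_ext (fun y => cos y ^ 2)).
{ rewrite Rmin_left ?Rmax_right; try lra; intros y Hy.
  assert (0 <= cos y) by (apply cos_ge_0; lra).
  replace (1 - sin y ^ 2) with (cos y ^ 2).
  - rewrite sqrt_pow2; auto; unfold scal; simpl; unfold mult; simpl; ring.
  - pose proof (sin2_cos2 y) as E; unfold Rsqr in E; lra. }
set (v := fun y => (y + sin y * cos y) / 2).
assert (HI : is_RInt (fun y => cos y ^ 2) (- (PI / 2)) (PI / 2) (minus (v (PI / 2)) (v (- (PI / 2))))).
2: { replace (minus (v (PI / 2)) (v (- (PI / 2)))) with (PI / 2) in HI; [exact HI|].
     unfold v; rewrite cos_neg cos_PI2; unfold minus, plus, opp; simpl; field. }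
apply (is_RInt_derive v).
- intros y _; unfold v; auto_derive; trivial. pose proof (sin2_cos2 y) as E; unfold Rsqr in E.
  replace (1 + (1 * cos y * cos y + sin y * (1 * - sin y))) with (2 * (cos y * cos y)) by lra; field.
- intros y _; apply (is_derive_continuous _ _ (2 * cos y * - sin y)); auto_derive; trivial; ring.
Qed.

(* Dirac oscillator: A(x) = -x with lambda = 1 has eigenvalues exactly at h = 1/(2k), and the
   action pi/2 is there k pi h. *)
Lemma connection_phase_value (theta : R) : is_connection_phase theta -> cos (2 * theta) = 0.
Proof.
intros Hth.
assert (HA : smooth3 (fun x => - x) (fun _ => -1) (fun _ => 0) (fun _ => 0)).
{ intros x; split; [auto_derive; trivial; ring|split; [apply is_derive_cst|split; [apply is_derive_cst|apply continuous_const]]]. }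
destruct (well_quantization theta _ _ _ _ 1 (-1) 1 (-1) 2 1 Hth HA) as (delta & h0 & C & Hd & Hh0 & HC & W);
  try lra.
{ intros x Hx; apply Rabs_lt_between; lra. }
{ intros x Hx; destruct Hx as [Hx|Hx]; [rewrite Rabs_pos_eq; lra|rewrite Rabs_Ropp Rabs_pos_eq; lra]. }
{ intros x Hx; rewrite Rabs_Ropp; lra. }
destruct (W 1) as (al & be & Hab & Hz & Hq); [replace (1 - 1) with 0 by ring; rewrite Rabs_R0; lra|clear W].
assert (al = -1 /\ be = 1) as [-> ->].
{ assert (Ha := proj2 (Hz al) (or_introl eq_refl)); assert (Hb := proj2 (Hz be) (or_intror eq_refl)).
  destruct (proj1 (Hz 1) ltac:(ring)); destruct (proj1 (Hz (-1)) ltac:(ring)); split; lra. }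
assert (EI : RInt (fun t => sqrt (1 ^ 2 - (- t) ^ 2)) (-1) 1 = PI / 2 :> R).
{ rewrite -RInt_half_circle; apply RInt_ext; intros t _; f_equal; ring. }
rewrite EI in Hq.
assert (Hk : forall n : nat, / (2 * INR (S n)) <= h0 -> Rabs (cos (2 * theta)) <= C * / (2 * INR (S n))).
{ intros n Hn; assert (HS : 0 < INR (S n)) by (apply lt_0_INR; lia).
  set (h := / (2 * INR (S n))) in *.
  assert (Hh : 0 < h) by (apply Rinv_0_lt_compat; lra).
  set (gs := fun x => exp (- (x ^ 2) / (2 * h))).
  (* Hermite functions of index n and n + 1. The ladder relations close into h q' = x q - p and h p'
     = q - x p exactly because 2 (n + 1) h = 1. *)
  set (q := fun x => fst (herm h n x) * gs x); set (p := fun x => fst (herm h (S n) x) * gs x).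
  assert (dg : forall x, is_derive gs x (- x / h * gs x)).
  { intros x; unfold gs; eapply is_derive_eq.
    - apply (is_derive_compR exp (fun x => - (x ^ 2) / (2 * h))); [apply is_derive_exp|].
      instantiate (1 := - x / h); auto_derive; trivial; field; lra.
    - ring. }
  assert (dq : forall x, is_derive q x ((x * q x - p x) / h)).
  { intros x; eapply is_derive_eq; [apply is_derive_mul; [apply is_derive_herm|apply dg]|].
    unfold q, p; simpl fst; field; lra. }
  assert (dp : forall x, is_derive p x ((q x - x * p x) / h)).
  { intros x; eapply is_derive_eq; [apply is_derive_mul; [apply is_derive_herm|apply dg]|].
    unfold q, p; simpl snd. assert (E : 2 * INR (S n) = / h) by (unfold h; rewrite Rinv_inv; auto).
    rewrite E; field; lra. }
  assert (small : forall e, 0 < e -> exists X, forall x, X <= Rabs x -> p x ^ 2 + q x ^ 2 < e).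
  { intros e He; destruct (herm_growth h (S n) Hh) as (G & HG & Gr).
    set (m := INR (S n)) in *.
    (* Beyond the first summand the Gaussian beats exp (2 m |x|) by a factor exp (- |x|); the second
       summand makes 2 G^2 exp (- |x|) smaller than e. *)
    set (X := h * (2 * m + 1) + 2 * G ^ 2 / e); exists X; intros x Hx.
    assert (G2 : 0 < G ^ 2) by pos.
    assert (0 < 2 * G ^ 2 / e) by pos.
    assert (0 < h * (2 * m + 1)) by pos.
    destruct (Gr x) as [g1 g2].
    assert (gsq : gs x ^ 2 = exp (- (x ^ 2) / h)).
    { unfold gs; replace (exp (- x ^ 2 / (2 * h)) ^ 2) with (exp (- x ^ 2 / (2 * h)) * exp (- x ^ 2 / (2 * h))) by ring.
      rewrite -exp_plus; f_equal; field; lra. }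
    assert (B : forall u, Rabs u <= G * exp (m * Rabs x) -> (u * gs x) ^ 2 <= G ^ 2 * exp (- Rabs x)).
    { intros u Hu; rewrite Rpow_mult_distr gsq -(pow2_abs u).
      apply Rle_trans with ((G * exp (m * Rabs x)) ^ 2 * exp (- x ^ 2 / h)).
      - apply Rmult_le_compat_r; [left; apply exp_pos|apply pow_incr; split; auto; apply Rabs_pos].
      - rewrite Rpow_mult_distr Rmult_assoc; apply Rmult_le_compat_l; [lra|].
        replace (exp (m * Rabs x) ^ 2) with (exp (m * Rabs x) * exp (m * Rabs x)) by ring; rewrite -!exp_plus.
        assert (L : m * Rabs x + m * Rabs x + - x ^ 2 / h <= - Rabs x).
        { rewrite -(pow2_abs x). apply Rmult_le_reg_l with h; auto.
          replace (h * (m * Rabs x + m * Rabs x + - Rabs x ^ 2 / h)) with (h * (2 * m) * Rabs x - Rabs x * Rabs x) by (field; lra).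
          assert (h * (2 * m + 1) * Rabs x <= Rabs x * Rabs x) by (apply Rmult_le_compat_r; [apply Rabs_pos|unfold X in Hx; lra]).
          lra. }
        destruct L as [L|L]; [left; apply exp_increasing; auto|rewrite L; apply Rle_refl]. }
    pose proof (B _ g1) as B1; pose proof (B _ g2) as B2.
    fold (p x) in B1; change (snd (herm h (S n) x) * gs x) with (q x) in B2.
    assert (Ee : 2 * (G ^ 2 * exp (- Rabs x)) < e).
    { rewrite exp_Ropp -Rmult_assoc. apply Rlt_div_l; [apply exp_pos|].
      pose proof (exp_ineq1_le (Rabs x)).
      assert (e * (2 * G ^ 2 / e) < e * exp (Rabs x)) by (apply Rmult_lt_compat_l; auto; unfold X in Hx; lra).
      replace (e * (2 * G ^ 2 / e)) with (2 * G ^ 2) in H2 by (field; lra). lra. }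
    lra. }
  set (Q := fun x => p x - q x); set (P := fun x => p x + q x).
  assert (Hs : forall x, is_derive Q x ((1 + - x) * P x / h) /\ is_derive P x (- ((1 - - x) * Q x / h))).
  { intros x; split; eapply is_derive_eq.
    - apply is_derive_sub; [apply dp|apply dq].
    - unfold P; field; lra.
    - apply is_derive_add; [apply dp|apply dq].
    - unfold Q; field; lra. }
  destruct (Hq h Q P) as [_ Hc].
  - lra.
  - exact Hs.
  - destruct (herm_nonzero h n) as [x Hx]; exists x.
    assert (Hqx : q x <> 0).
    { apply Rmult_integral_contrapositive_currified; auto; apply Rgt_not_eq, exp_pos. }
    destruct (Req_dec (Q x) 0) as [HQ|HQ]; auto; right; intros HP; apply Hqx; unfold Q, P in *; lra.
  - apply (decaying_of_tails _ _ _ h); auto; [lra|]; intros x0 c Hc.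
    destruct (small (c / 2) ltac:(lra)) as [X HX].
    split; intros H; [set (y := Rmax (Rabs x0) X)|set (y := - Rmax (Rabs x0) X)];
      pose proof (Rmax_l (Rabs x0) X); pose proof (Rmax_r (Rabs x0) X);
      pose proof (Rle_abs x0); pose proof (Rle_abs (- x0)) as H3; rewrite Rabs_Ropp in H3;
      (assert (Hy : X <= Rabs y); [unfold y; rewrite ?Rabs_Ropp; eapply Rle_trans; [|apply Rle_abs]; auto|]);
      specialize (HX y Hy); specialize (H y ltac:(unfold y; lra)); unfold Q, P in H; lra.
  - specialize (Hc eq_refl).
    (* The action divided by h is an integer multiple of pi and drops out of |cos|. *)
    replace (PI / 2 / h) with (INR (S n) * PI) in Hc by (unfold h; field; lra).
    assert (Ec : forall j x, Rabs (cos (INR j * PI + x)) = Rabs (cos x)).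
    { induction j as [|j IH]; intros x; [simpl; f_equal; f_equal; ring|].
      rewrite S_INR; replace ((INR j + 1) * PI + x) with (INR j * PI + (x + PI)) by ring.
      rewrite IH neg_cos Rabs_Ropp; auto. }
    rewrite Ec in Hc; exact Hc. }
apply Classical_Prop.NNPP; intros Hne; apply Rabs_pos_lt in Hne.
set (a := Rabs (cos (2 * theta))) in *.
(* An index beyond both summands makes h admissible and the bound C h smaller than [a], so the
   constant |cos (2 theta)| cannot be positive. *)
set (Y := / h0 + C / a).
assert (0 < C / a) by pos.
assert (0 < / h0) by pos.
destruct (nfloor_ex Y) as [n [_ Hn]]; [unfold Y; lra|].
rewrite -S_INR in Hn.
specialize (Hk n).
assert (HS : 0 < INR (S n)) by (apply lt_0_INR; lia).
assert (H1 : / (2 * INR (S n)) <= h0).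
{ rewrite -(Rinv_inv h0); apply Rinv_le_contravar; auto; unfold Y in Hn; lra. }
specialize (Hk H1).
assert (H2 : a * INR (S n) <= C / 2).
{ replace (C / 2) with (C * / (2 * INR (S n)) * INR (S n)) by (field; lra).
  apply Rmult_le_compat_r; lra. }
assert (H3 : a * (C / a) < a * INR (S n)) by (apply Rmult_lt_compat_l; auto; unfold Y in Hn; lra).
replace (a * (C / a)) with C in H3 by (field; lra). lra.
Qed.

(** * Reduction of the eigenvalue problem *)

(** Powers of a real increment are real, so the real part acts on the coefficients only, and it is
    continuous. *)
Lemma is_pseries_Re (a : nat -> C) (t : R) (l : C) :
  @is_pseries C_AbsRing C_NormedModule a (RtoC t) l -> is_pseries (fun n => Re (a n)) t (Re l).
Proof.
intros H; unfold is_pseries, is_series in *.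
assert (Hp : forall n, pow_n (K := C_AbsRing) (RtoC t) n = RtoC (t ^ n)).
{ induction n as [|n IH]; [reflexivity|].
  change (pow_n (K := C_AbsRing) (RtoC t) (S n)) with (Cmult (RtoC t) (pow_n (K := C_AbsRing) (RtoC t) n)).
  rewrite IH -RtoC_mult; reflexivity. }
assert (HS : forall n, sum_n (fun k => scal (pow_n t k) (Re (a k))) n
   = Re (sum_n (G := C_AbelianMonoid) (fun k => scal (V := C_NormedModule) (pow_n (K := C_AbsRing) (RtoC t) k) (a k)) n)).
{ assert (H1 : forall k, scal (pow_n t k) (Re (a k)) =
    Re (scal (V := C_NormedModule) (pow_n (K := C_AbsRing) (RtoC t) k) (a k))).
  { intros k; rewrite Hp pow_n_pow; change (t ^ k * Re (a k) = Re (RtoC (t ^ k) * a k)%C).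
    unfold Cmult, RtoC, Re; simpl; ring. }
  induction n as [|n IH]; [rewrite !sum_O; apply H1|].
  rewrite !sum_Sn IH H1; reflexivity. }
apply (filterlim_ext (fun n => Re (sum_n (G := C_AbelianMonoid)
   (fun k => scal (V := C_NormedModule) (pow_n (K := C_AbsRing) (RtoC t) k) (a k)) n))).
{ intros n; symmetry; apply HS. }
apply (filterlim_comp _ _ _ _ Re _ _ _ H).
intros P [eps He]; exists eps; intros y [Hy _]; apply He; exact Hy.
Qed.

Lemma ex_derive_n_of_pseries (A : R -> R) (x0 r : R) (b : nat -> R) : 0 < r ->
  (forall x, Rabs (x - x0) < r -> is_pseries b (x - x0) (A x)) -> forall n, ex_derive_n A n x0.
Proof.
intros Hr HA n.
assert (Hcv : Rbar_lt (Rabs 0) (CV_radius b)).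
{ rewrite Rabs_R0; destruct (Rbar_lt_le_dec 0 (CV_radius b)) as [H|H]; auto; exfalso.
  (* With radius 0 the terms at r/2 would not tend to 0, although the series converges there. *)
  apply (CV_disk_outside b (r / 2)).
  - rewrite Rabs_pos_eq; [|lra]. eapply Rbar_le_lt_trans; [exact H|simpl; lra].
  - assert (E : is_pseries b (x0 + r / 2 - x0) (A (x0 + r / 2))).
    { apply HA; replace (x0 + r / 2 - x0) with (r / 2) by ring; rewrite Rabs_pos_eq; lra. }
    replace (x0 + r / 2 - x0) with (r / 2) in E by ring.
    apply (is_lim_seq_ext (fun n => scal (pow_n (r / 2) n) (b n))).
    + intros k; rewrite pow_n_pow; unfold scal; simpl; unfold mult; simpl; ring.
    + apply ex_series_lim_0; eexists; exact E. }
apply (ex_derive_n_ext_loc (fun y => PSeries b (y + - x0))).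
- exists (mkposreal _ Hr); intros y Hy; apply is_pseries_unique, HA; exact Hy.
- apply ex_derive_n_comp_trans, ex_derive_n_PSeries.
  replace (x0 + - x0) with 0 by ring; exact Hcv.
Qed.

Lemma smooth3_of_ex_derive_n (A : R -> R) : (forall x n, ex_derive_n A n x) ->
  smooth3 A (Derive A) (Derive_n A 2) (Derive_n A 3).
Proof.
intros H x; assert (D : forall k, is_derive (Derive_n A k) x (Derive_n A (S k) x)).
{ intros k; apply Derive_correct, (H x (S k)). }
split; [apply (D 0%nat)|split; [apply (D 1%nat)|split; [apply (D 2%nat)|]]].
exact (is_derive_continuous _ _ _ (D 3%nat)).
Qed.

(* The conjugation symmetry (u1, u2) -> (conj u2, conj u1) reduces solutions to u2 = conj u1; in
   terms of Q = Re u1 - Im u1 and P = Re u1 + Im u1 the system becomes real. *)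
Lemma zs_real_solution (A : R -> R) (lam h : R) (u1 u2 du1 du2 : R -> C) : 0 < h ->
  (forall x, @is_derive R_AbsRing C_R_NormedModule u1 x (du1 x) /\
     @is_derive R_AbsRing C_R_NormedModule u2 x (du2 x) /\
     (RtoC lam * u1 x = Ci * RtoC h * du1 x - Ci * RtoC (A x) * u2 x)%C /\
     (RtoC lam * u2 x = Ci * RtoC (A x) * u1 x - Ci * RtoC h * du2 x)%C) ->
  (exists x, u1 x <> RtoC 0 \/ u2 x <> RtoC 0) ->
  exists Q P : R -> R,
    (forall x, is_derive Q x ((lam + A x) * P x / h) /\ is_derive P x (- ((lam - A x) * Q x / h))) /\
    (exists x, Q x <> 0 \/ P x <> 0) /\
    (forall x, Q x ^ 2 + P x ^ 2 <= 4 * (Cmod (u1 x) ^ 2 + Cmod (u2 x) ^ 2)).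
Proof.
intros Hh Hu Hnz.
assert (HRe : forall (v : R -> C) x l, @is_derive R_AbsRing C_R_NormedModule v x l -> is_derive (fun x => Re (v x)) x (Re l)).
{ intros v x l H; unfold is_derive.
  apply (filterdiff_ext_lin (fun y => Re (v y)) (fun y => Re (scal (V := C_R_NormedModule) y l))); [|intros; reflexivity].
  apply (filterdiff_comp' (V := C_R_NormedModule) v Re x _ Re H).
  apply (filterdiff_linear (U := C_R_NormedModule) (V := R_NormedModule) Re).
  exact (is_linear_fst (K := R_AbsRing) (U := R_NormedModule) (V := R_NormedModule)). }
assert (HIm : forall (v : R -> C) x l, @is_derive R_AbsRing C_R_NormedModule v x l -> is_derive (fun x => Im (v x)) x (Im l)).
{ intros v x l H; unfold is_derive.
  apply (filterdiff_ext_lin (fun y => Im (v y)) (fun y => Im (scal (V := C_R_NormedModule) y l))); [|intros; reflexivity].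
  apply (filterdiff_comp' (V := C_R_NormedModule) v Im x _ Im H).
  apply (filterdiff_linear (U := C_R_NormedModule) (V := R_NormedModule) Im).
  exact (is_linear_snd (K := R_AbsRing) (U := R_NormedModule) (V := R_NormedModule)). }
set (a := fun x => Re (u1 x)); set (b := fun x => Im (u1 x));
set (c := fun x => Re (u2 x)); set (d := fun x => Im (u2 x)).
assert (da : forall x, is_derive a x ((A x * c x + lam * b x) / h) /\ is_derive b x ((A x * d x - lam * a x) / h) /\
   is_derive c x ((A x * a x - lam * d x) / h) /\ is_derive d x ((A x * b x + lam * c x) / h)).
{ intros x; destruct (Hu x) as (d1 & d2 & E1 & E2).
  assert (R1 : Re (du1 x) = (A x * c x + lam * b x) / h /\ Im (du1 x) = (A x * d x - lam * a x) / h).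
  { unfold a, b, c, d; destruct (u1 x) as [p q], (u2 x) as [s t], (du1 x) as [p' q'].
    unfold Cmult, Cminus, Cplus, Copp, RtoC, Ci, Re, Im in *; simpl in *.
    injection E1; intros Ei Er; split; apply Rmult_eq_reg_r with h; try lra;
    unfold Rdiv; rewrite Rmult_assoc Rinv_l; lra. }
  assert (R2 : Re (du2 x) = (A x * a x - lam * d x) / h /\ Im (du2 x) = (A x * b x + lam * c x) / h).
  { unfold a, b, c, d; destruct (u1 x) as [p q], (u2 x) as [s t], (du2 x) as [s' t'].
    unfold Cmult, Cminus, Cplus, Copp, RtoC, Ci, Re, Im in *; simpl in *.
    injection E2; intros Ei Er; split; apply Rmult_eq_reg_r with h; try lra;
    unfold Rdiv; rewrite Rmult_assoc Rinv_l; lra. }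
  destruct R1 as [<- <-], R2 as [<- <-].
  split; [apply HRe; auto|split; [apply HIm; auto|split; [apply HRe; auto|apply HIm; auto]]]. }
assert (Hsq : forall x, Cmod (u1 x) ^ 2 + Cmod (u2 x) ^ 2 = a x ^ 2 + b x ^ 2 + (c x ^ 2 + d x ^ 2)).
{ intros x; unfold Cmod; rewrite !pow2_sqrt; unfold a, b, c, d, Re, Im; auto;
  apply Rplus_le_le_0_compat; apply pow2_ge_0. }
(* p + i q is u1 + conj u2 for (e1, e2) = (1, 0) and -i (u1 - conj u2) for (0, 1). Both solve the
   reduced system, and they cannot both vanish identically. *)
assert (sol : forall e1 e2 : R, e1 ^ 2 + e2 ^ 2 = 1 -> e1 * e2 = 0 ->
  let p := fun x => e1 * (a x + c x) + e2 * (b x + d x) in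
  let q := fun x => e1 * (b x - d x) + e2 * (c x - a x) in
  (exists x, p x <> 0 \/ q x <> 0) ->
  exists Q P : R -> R,
    (forall x, is_derive Q x ((lam + A x) * P x / h) /\ is_derive P x (- ((lam - A x) * Q x / h))) /\
    (exists x, Q x <> 0 \/ P x <> 0) /\
    (forall x, Q x ^ 2 + P x ^ 2 <= 4 * (Cmod (u1 x) ^ 2 + Cmod (u2 x) ^ 2))).
{ intros e1 e2 He He0 p q [x0 Hx0].
  assert (lin : forall f1 f2 k1 k2 l1 l2 x, is_derive f1 x l1 -> is_derive f2 x l2 ->
    is_derive (fun x => k1 * f1 x + k2 * f2 x) x (k1 * l1 + k2 * l2)).
  { intros f1 f2 k1 k2 l1 l2 x D1 D2; eapply is_derive_eq.
    - apply is_derive_add; apply is_derive_mul; eauto using is_derive_cst.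
    - cbv beta; ring. }
  assert (dp : forall x, is_derive p x ((A x * p x + lam * q x) / h)).
  { intros x; destruct (da x) as (D1 & D2 & D3 & D4); eapply is_derive_eq.
    - apply (lin (fun x => a x + c x) (fun x => b x + d x)); apply is_derive_add; eauto.
    - unfold p, q; field; lra. }
  assert (dq : forall x, is_derive q x ((- lam * p x - A x * q x) / h)).
  { intros x; destruct (da x) as (D1 & D2 & D3 & D4); eapply is_derive_eq.
    - apply (lin (fun x => b x - d x) (fun x => c x - a x)); apply is_derive_sub; eauto.
    - unfold p, q; field; lra. }
  exists (fun x => p x - q x), (fun x => p x + q x); split; [|split].
  - intros x; split; eapply is_derive_eq; [apply is_derive_sub; eauto|field; lra|apply is_derive_add; eauto|field; lra].
  - exists x0; destruct (Req_dec (p x0 - q x0) 0) as [H|H]; auto; right; intros H1; destruct Hx0 as [Hx0|Hx0]; apply Hx0; lra.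
  - intros x; rewrite Hsq. replace ((p x - q x) ^ 2 + (p x + q x) ^ 2) with (2 * (p x ^ 2 + q x ^ 2)) by ring.
    assert (E : p x ^ 2 + q x ^ 2 = e1 ^ 2 * ((a x + c x) ^ 2 + (b x - d x) ^ 2) + e2 ^ 2 * ((b x + d x) ^ 2 + (c x - a x) ^ 2)
      + (e1 * e2) * (2 * (a x + c x) * (b x + d x) + 2 * (b x - d x) * (c x - a x))) by (unfold p, q; ring).
    rewrite He0 in E.
    set (s := a x ^ 2 + b x ^ 2 + (c x ^ 2 + d x ^ 2)) in *.
    assert (B1 : (a x + c x) ^ 2 + (b x - d x) ^ 2 <= 2 * s).
    { unfold s; pose proof (pow2_ge_0 (a x - c x)); pose proof (pow2_ge_0 (b x + d x)); lra. }
    assert (B2 : (b x + d x) ^ 2 + (c x - a x) ^ 2 <= 2 * s).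
    { unfold s; pose proof (pow2_ge_0 (a x + c x)); pose proof (pow2_ge_0 (b x - d x)); lra. }
    pose proof (Rmult_le_compat_l _ _ _ (pow2_ge_0 e1) B1); pose proof (Rmult_le_compat_l _ _ _ (pow2_ge_0 e2) B2).
    assert (e1 ^ 2 * (2 * s) + e2 ^ 2 * (2 * s) = 2 * s) by (rewrite -Rmult_plus_distr_r He; ring).
    lra. }
destruct Hnz as [x0 Hx0].
assert (Hn : ~ (a x0 = 0 /\ b x0 = 0 /\ c x0 = 0 /\ d x0 = 0)).
{ intros (H1 & H2 & H3 & H4); destruct Hx0 as [Hx0|Hx0]; apply Hx0;
  [rewrite (surjective_pairing (u1 x0))|rewrite (surjective_pairing (u2 x0))]; unfold RtoC; f_equal; auto. }
destruct (Req_dec (a x0 + c x0) 0) as [H1|H1].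
2: { apply (sol 1 0); [ring|ring|]; exists x0; left; lra. }
destruct (Req_dec (b x0 - d x0) 0) as [H2|H2].
2: { apply (sol 1 0); [ring|ring|]; exists x0; right; lra. }
apply (sol 0 1); [ring|ring|]; exists x0.
destruct (Req_dec (b x0 + d x0) 0) as [H3|H3]; [right|left; lra].
intros H4; apply Hn; repeat split; lra.
Qed.

(** * Consequences of the limit inferior and of square integrability *)

Module Lebesgue.
Import all_boot all_order all_algebra all_classical all_reals all_analysis.
Import measurable_realfun Rstruct Rstruct_topology.
Open Scope R_scope.

Lemma liminf_margin (f : R -> R) (m : R) : (m%:E < liminf_abs_infty f)%E ->
  exists N eps : R, 0 < eps /\ forall x, N < Rabs x -> m + eps <= f x.
Proof.
rewrite /liminf_abs_infty limf_einfE => /ereal_sup_gt [_ [V [N VN] <-] H].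
have Hx x : V x -> (ereal_inf [set (f t)%:E | t in V] <= (f x)%:E)%E.
  by move=> Vx; apply: ereal_inf_lbound; exists x.
case E : (ereal_inf _) H Hx => [v| |] // H Hx.
- exists N, (v - m); split; first by move: H; rewrite lte_fin => /RltP; lra.
  move=> x /VN /Hx; rewrite lee_fin => /RleP; lra.
(* An infimum +oo is impossible, since the real values of f beyond [N] lie above it. *)
- exists N, 1; split; first lra.
  by move=> x /VN /Hx; rewrite leye_eq.
Qed.

(** A positive constant has infinite integral over a half-line, and this integral would be a lower
    bound for the squared norm. *)
Lemma L2_unbounded (u : R -> C * C) (c x0 : R) : L2_C2 u -> 0 < c ->
  (forall x, x0 <= x -> c <= Cmod (fst (u x)) ^ 2 + Cmod (snd (u x)) ^ 2) \/
  (forall x, x <= x0 -> c <= Cmod (fst (u x)) ^ 2 + Cmod (snd (u x)) ^ 2) -> False.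
Proof.
move=> [m1 [m2 [m3 [m4 fin]]]] c0 Hlow.
have [I [HI Hc]] : exists I : set R, (I = `[x0, +oo[%classic \/ I = `]-oo, x0]%classic) /\
    forall x, I x -> c <= Cmod (fst (u x)) ^ 2 + Cmod (snd (u x)) ^ 2.
  case: Hlow => H; [exists `[x0, +oo[%classic|exists `]-oo, x0]%classic]; split; auto=> x /=;
    by rewrite in_itv /= ?andbT => /RleP; apply: H.
pose F x : R := (Cmod (fst (u x)) ^ 2 + Cmod (snd (u x)) ^ 2).
have F0 x : (0 <= (F x)%:E)%E.
  by rewrite lee_fin; apply/RleP; exact (Rplus_le_le_0_compat _ _ (pow2_ge_0 _) (pow2_ge_0 _)).
have mF0 : @measurable_fun _ _ (measurableTypeR R) (measurableTypeR R) setT F.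
  have -> : F = (fun x => Re (fst (u x)) * Re (fst (u x)) + Im (fst (u x)) * Im (fst (u x)) +
    (Re (snd (u x)) * Re (snd (u x)) + Im (snd (u x)) * Im (snd (u x)))).
    have E z : (Cmod z ^ 2 = Re z * Re z + Im z * Im z).
      rewrite /Cmod pow2_sqrt; first by rewrite /Re /Im; ring.
      exact (Rplus_le_le_0_compat _ _ (pow2_ge_0 _) (pow2_ge_0 _)).
    by apply: funext => x; rewrite /F !E.
  by apply: measurable_funD; apply: measurable_funD; apply: measurable_funM.
have mF := (measurable_EFinP _ _).2 mF0.
have mI : measurable (I : set (measurableTypeR R)) by case: HI => ->.
have muI : lebesgue_measure (I : set (measurableTypeR R)) = +oo%E.
  by case: HI => ->; rewrite lebesgue_measure_itv /= ?ltry ?ltNyr /=.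
have le1 : (\int[lebesgue_measure]_(x in I) c%:E <= \int[lebesgue_measure]_(x in I) (F x)%:E)%E.
  apply: ge0_le_integral => //.
  - by move=> x _; rewrite lee_fin; apply/RleP; exact (Rlt_le _ _ c0).
  - exact: measurable_funS mF.
  - by move=> x /Hc cF; rewrite lee_fin; apply/RleP.
have le2 : (\int[lebesgue_measure]_(x in I) (F x)%:E <= \int[lebesgue_measure]_(x in setT) (F x)%:E)%E.
  by apply: ge0_subset_integral.
have := Order.POrderTheory.le_lt_trans (Order.POrderTheory.le_trans le1 le2) fin.
rewrite integral_cst //; set m := (X in (_ * X < _)%E); have -> : m = +oo%E by exact: muI.
rewrite gt0_muley ?ltxx //.
by rewrite lte_fin; apply/RltP.
Qed.

End Lebesgue.

Lemma eigenvalue_real_solution (A : R -> R) (h lam : R) : 0 < h -> ZS_eigenvalue h A lam ->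
  exists Q P : R -> R,
    (forall x, is_derive Q x ((lam + A x) * P x / h) /\ is_derive P x (- ((lam - A x) * Q x / h))) /\
    (exists x, Q x <> 0 \/ P x <> 0) /\
    (forall x0 c, 0 < c -> ~ (forall x, x0 <= x -> c <= Q x ^ 2 + P x ^ 2) /\
                  ~ (forall x, x <= x0 -> c <= Q x ^ 2 + P x ^ 2)).
Proof.
intros Hh (u & HL2 & Hop & x0 & Hx0).
set (spec := fun x (d : C * C) =>
    @is_derive R_AbsRing C_R_NormedModule (fun t => fst (u t)) x (fst d) /\
    @is_derive R_AbsRing C_R_NormedModule (fun t => snd (u t)) x (snd d) /\
    (RtoC lam * fst (u x) = Ci * RtoC h * fst d - Ci * RtoC (A x) * snd (u x))%C /\
    (RtoC lam * snd (u x) = Ci * RtoC (A x) * fst (u x) - Ci * RtoC h * snd d)%C).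
(* The operator provides derivatives point by point; [epsilon] collects them into a function. *)
set (du := fun x => epsilon (inhabits (RtoC 0, RtoC 0)) (spec x)).
assert (Hdu : forall x, spec x (du x)).
{ intros x; apply epsilon_spec; destruct (Hop x) as (d1 & d2 & H); exists (d1, d2); exact H. }
destruct (zs_real_solution A lam h (fun x => fst (u x)) (fun x => snd (u x))
  (fun x => fst (du x)) (fun x => snd (du x)) Hh Hdu) as (Q & P & Hs & Hnz & Hb).
{ exists x0; destruct (Classical_Prop.classic (fst (u x0) = RtoC 0)) as [H1|H1]; auto.
  right; intros H2; apply Hx0; rewrite (surjective_pairing (u x0)) H1 H2; reflexivity. }
exists Q, P; split; [exact Hs|split; [exact Hnz|]].
intros y c Hc; split; intros H; apply (Lebesgue.L2_unbounded u (c / 4) y HL2); try lra;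
  [left|right]; intros x Hx; specialize (H x Hx); specialize (Hb x); cbv beta in Hb; lra.
Qed.

Lemma A1_smooth (A : R -> R) : (exists (d : R) (F : C -> C), 0 < d /\
    analytic_in_strip d F /\ forall x : R, F (RtoC x) = RtoC (A x)) ->
  smooth3 A (Derive A) (Derive_n A 2) (Derive_n A 3).
Proof.
intros (d & F & Hd & HF & HFA); apply smooth3_of_ex_derive_n; intros x0.
destruct (HF (RtoC x0)) as (r & a & Hr & Ha); [unfold RtoC, Im; simpl; rewrite Rabs_R0; auto|].
apply (ex_derive_n_of_pseries A x0 r (fun n => Re (a n)) Hr).
intros x Hx; assert (E : (RtoC x - RtoC x0)%C = RtoC (x - x0)) by (rewrite RtoC_minus; reflexivity).
specialize (Ha (RtoC x)); rewrite E Cmod_R HFA in Ha.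
apply (is_pseries_Re a (x - x0) (RtoC (A x))); auto.
Qed.

(** The sign [s] normalises s A(al0) = lam0; a change of sign of A is absorbed by passing from (Q,
    P) to (P, -Q). As cos (2 theta) = 0, the shift by 2 theta exchanges sine and cosine up to sign,
    so equal signs of A give a cosine and opposite signs a sine. *)
Lemma eigenvalue_phase (A : R -> R) (lam0 al0 be0 : R) : assumption_A1 A lam0 al0 be0 ->
  exists delta h0 C, 0 < delta /\ 0 < h0 <= 1 /\ 0 < C /\
  forall lam h, lam0 - delta <= lam <= lam0 + delta -> 0 < h <= h0 -> ZS_eigenvalue h A lam ->
  (A al0 = A be0 -> Rabs (cos (action_integral A lam / h)) <= C * h) /\
  (A al0 = - A be0 -> Rabs (sin (action_integral A lam / h)) <= C * h).
Proof.
intros [HAn Hlam0 Hord Hturn Hsimple Hin Hout Hlim].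
apply A1_smooth in HAn.
destruct (Lebesgue.liminf_margin _ _ Hlim) as (N & eps & Heps & Hfar).
destruct connection as [theta Hth].
assert (Hc2 := connection_phase_value theta Hth).
assert (Hs2 : Rabs (sin (2 * theta)) = 1).
{ pose proof (sin2_cos2 (2 * theta)) as E; rewrite Hc2 in E; unfold Rsqr in E.
  pose proof (Rabs_pos (sin (2 * theta))) as E1; pose proof (Rsqr_abs (sin (2 * theta))) as E2; unfold Rsqr in E2. nra. }
assert (Aal : Rabs (A al0) = lam0) by (apply Hturn; auto).
assert (Abe : Rabs (A be0) = lam0) by (apply Hturn; auto).
assert (nz : Derive A al0 <> 0 /\ Derive A be0 <> 0).
{ split; intros E; apply Hsimple; rewrite E; ring. }
assert (Hsign : exists s sg, (s = 1 \/ s = -1) /\ (sg = 1 \/ sg = -1) /\ s * A al0 = lam0 /\ s * A be0 = sg * lam0 /\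
   (A al0 = A be0 -> sg = 1) /\ (A al0 = - A be0 -> sg = -1)).
{ unfold Rabs in Aal, Abe; destruct (Rcase_abs (A al0)), (Rcase_abs (A be0)).
  - exists (-1), 1; repeat split; try lra; auto.
  - exists (-1), (-1); repeat split; try lra; auto.
  - exists 1, (-1); repeat split; try lra; auto.
  - exists 1, 1; repeat split; try lra; auto. }
destruct Hsign as (s & sg & Hs & Hsg & Es & Esg & Hcase1 & Hcase2).
assert (ss : s * s = 1) by (destruct Hs; subst s; ring).
assert (sabs : forall x, Rabs (s * x) = Rabs x).
{ intros x; destruct Hs; subst s; [rewrite Rmult_1_l; auto|].
  replace (-1 * x) with (- x) by ring; apply Rabs_Ropp. }
assert (HB : smooth3 (fun x => s * A x) (fun x => s * Derive A x) (fun x => s * Derive_n A 2 x) (fun x => s * Derive_n A 3 x)).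
{ assert (dz : forall u x l, is_derive u x l -> is_derive (fun x => s * u x) x (s * l)).
  { intros u x l H; apply is_derive_cmul; exact H. }
  intros x; destruct (HAn x) as (d1 & d2 & d3 & c3).
  split; [apply dz; auto|split; [apply dz; auto|split; [apply dz; auto|apply continuousZ; auto]]]. }
assert (s0 : s <> 0) by (destruct Hs; subst s; lra).
destruct (well_quantization theta _ _ _ _ lam0 al0 be0 sg N eps Hth HB) as (delta & h0 & C & Hd & Hh0 & HC & W); auto.
{ apply Rmult_integral_contrapositive_currified; tauto. }
{ apply Rmult_integral_contrapositive_currified; tauto. }
{ intros x Hx; rewrite sabs; auto. }
{ intros x Hx; rewrite sabs; auto. }
{ intros x Hx; rewrite sabs; auto. }
(* lam0/2 keeps lambda positive, as the tail argument requires; h0 <= 1 serves the choice of the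
   remainder. *)
exists (Rmin delta (lam0 / 2)), (Rmin h0 1), C.
assert (d1 : Rmin delta (lam0 / 2) <= delta) by apply Rmin_l.
assert (d2 : Rmin delta (lam0 / 2) <= lam0 / 2) by apply Rmin_r.
assert (h1 : Rmin h0 1 <= h0) by apply Rmin_l; assert (h2 : Rmin h0 1 <= 1) by apply Rmin_r.
split; [apply Rmin_glb_lt; lra|split; [split; [apply Rmin_glb_lt; lra|auto]|split; [auto|]]].
intros lam h Hlam Hh Heig.
destruct (W lam) as (al & be & Hab & Hz & Hq); [apply Rabs_le; lra|clear W].
assert (Etp : turning_points A lam = (al, be)).
{ apply turning_points_unique; split; [exact Hab|]; intros x; rewrite -Hz; simpl.
  replace (lam * (lam * 1) - s * A x * (s * A x * 1)) with (lam * (lam * 1) - (s * s) * (A x * (A x * 1))) by ring.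
  rewrite ss Rmult_1_l; tauto. }
assert (EI : RInt (fun t => sqrt (lam ^ 2 - (s * A t) ^ 2)) al be = action_integral A lam).
{ unfold action_integral; rewrite Etp; apply RInt_ext; intros t _; f_equal; simpl.
  transitivity (lam * (lam * 1) - (s * s) * (A t * (A t * 1))); [ring|rewrite ss; ring]. }
rewrite EI in Hq; set (I := action_integral A lam / h) in *.
destruct (eigenvalue_real_solution A h lam ltac:(lra) Heig) as (Q & P & Hsol & Hnz & Htail).
assert (Hsol' : exists Q P : R -> R,
  (forall x, is_derive Q x ((lam + s * A x) * P x / h) /\ is_derive P x (- ((lam - s * A x) * Q x / h))) /\
    (exists x, Q x <> 0 \/ P x <> 0) /\ decaying (fun x => s * A x) lam Q P).
{ destruct Hs as [E|E]; rewrite E.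
  - assert (Hs1 : forall x, is_derive Q x ((lam + 1 * A x) * P x / h) /\ is_derive P x (- ((lam - 1 * A x) * Q x / h))).
    { intros x; rewrite !Rmult_1_l; auto. }
    exists Q, P; split; [exact Hs1|split; [auto|]].
    apply (decaying_of_tails _ _ _ h); auto; lra.
  - assert (Hs1 : forall x, is_derive P x ((lam + -1 * A x) * - Q x / h) /\
        is_derive (fun x => - Q x) x (- ((lam - -1 * A x) * P x / h))).
    { intros x; destruct (Hsol x) as [D1 D2]; split; eapply is_derive_eq.
      - exact D2.
      - field; lra.
      - apply is_derive_neg, D1.
      - field; lra. }
    exists P, (fun x => - Q x); split; [exact Hs1|split].
    + destruct Hnz as [x [Hx|Hx]]; exists x; [right; lra|left; auto].
    + apply (decaying_of_tails _ _ _ h); auto; [lra|lra|].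
      intros x0 c Hc; destruct (Htail x0 c Hc) as [T1 T2]; split; intros H; [apply T1|apply T2];
      intros x Hx; specialize (H x Hx); cbv beta in H; lra. }
destruct Hsol' as (Q' & P' & Hsol' & Hnz' & Hdec).
destruct (Hq h Q' P' ltac:(lra) Hsol' Hnz' Hdec) as [B1 B2].
split; intros HE.
- specialize (B1 (Hcase1 HE)); rewrite sin_plus Hc2 Rmult_0_r Rplus_0_l Rabs_mult Hs2 Rmult_1_r in B1; exact B1.
- specialize (B2 (Hcase2 HE)); rewrite cos_plus Hc2 Rmult_0_r in B2.
  rewrite Rminus_0_l Rabs_Ropp Rabs_mult Hs2 Rmult_1_r in B2; exact B2.
Qed.

(** Up to pi/3 the derivative 4 cos t - 1 is positive; beyond, sin t >= 1/2 while t <= pi/2 <= 2. *)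
Lemma sin_lower (w : R) : Rabs w <= PI / 2 -> Rabs w <= 4 * Rabs (sin w).
Proof.
assert (HP := PI_RGT_0); assert (HP4 := PI_4).
assert (P : forall w, 0 <= w <= PI / 2 -> w <= 4 * sin w).
{ intros t Ht; destruct (Rle_or_lt t (PI / 3)) as [H|H].
  - assert (4 * sin 0 - 0 <= 4 * sin t - t); [|rewrite sin_0 in H0; lra].
    apply (derive_nonneg_le (fun t => 4 * sin t - t) (fun t => 4 * cos t - 1)); [lra| |].
    + intros x _; auto_derive; trivial; ring.
    + intros x Hx; assert (cos (PI / 3) <= cos x) by (apply cos_decr_1; lra).
      rewrite cos_PI3 in H0; lra.
  - assert (sin (PI / 6) <= sin t) by (apply sin_incr_1; lra).
    rewrite sin_PI6 in H0; lra. }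
intros Hw; destruct (Rle_or_lt 0 w) as [H|H].
- rewrite (Rabs_pos_eq w) in Hw |- *; auto; pose proof (Rle_abs (sin w)); pose proof (P w ltac:(lra)); lra.
- rewrite (Rabs_left w) in Hw |- *; auto; rewrite -(Rabs_Ropp (sin w)) -sin_neg.
  pose proof (Rle_abs (sin (- w))); pose proof (P (- w) ltac:(lra)); lra.
Qed.

Lemma sin_near_zero (y e : R) : Rabs (sin y) <= e -> exists k : Z, Rabs (y - IZR k * PI) <= 4 * e.
Proof.
intros H; assert (HP := PI_RGT_0).
(* The integer nearest to y/pi, so that the remaining angle is at most pi/2 in absolute value. *)
set (k := Int_part (y / PI + / 2)); exists k.
destruct (base_Int_part (y / PI + / 2)) as [K1 K2]; fold k in K1, K2.
set (w := y - IZR k * PI).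
assert (Hw : Rabs w <= PI / 2).
{ assert (Ew : w = PI * (y / PI + / 2 - IZR k) - PI / 2) by (unfold w; field; lra).
  assert (0 <= PI * (y / PI + / 2 - IZR k)) by (apply Rmult_le_pos; lra).
  assert (PI * (y / PI + / 2 - IZR k) <= PI * 1) by (apply Rmult_le_compat_l; lra).
  apply Rabs_le; lra. }
assert (E : Rabs (sin w) = Rabs (sin y)).
{ assert (En : forall n : nat, forall x, Rabs (sin (x + INR n * PI)) = Rabs (sin x)).
  { induction n as [|n IH]; intros x; [simpl; f_equal; f_equal; ring|].
    rewrite S_INR; replace (x + (INR n + 1) * PI) with ((x + PI) + INR n * PI) by ring.
    rewrite IH neg_sin Rabs_Ropp; auto. }
  unfold w; destruct (Z_le_gt_dec 0 k) as [Hk|Hk].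
  - rewrite -(En (Z.to_nat k)) INR_IZR_INZ Z2Nat.id; auto; f_equal; f_equal; ring.
  - replace (y - IZR k * PI) with (y + INR (Z.to_nat (- k)) * PI); [apply En|].
    rewrite INR_IZR_INZ Z2Nat.id; [|lia]; rewrite opp_IZR; ring. }
pose proof (sin_lower w Hw). rewrite E in H0; lra.
Qed.

(* A number off the grid ((k + s) pi h) can be moved onto it, and one on the grid off it, by a
   shift of size O(h^2); hence only eigenvalues constrain the remainder. *)
Lemma remainder_exists (E : R -> R -> Prop) (I : R -> R) (s lam0 delta h0 B : R) : h0 <= 1 -> 0 <= B ->
  (forall lam h, lam0 - delta <= lam <= lam0 + delta -> 0 < h <= h0 -> E lam h ->
     exists k : Z, Rabs (I lam - (IZR k + s) * PI * h) <= B * h ^ 2) ->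
  exists r, bounded_on_box lam0 delta h0 r /\ forall h lam, 0 < h <= h0 ->
    lam0 - delta <= lam <= lam0 + delta ->
    (E lam h <-> exists k : Z, I lam = (IZR k + s) * PI * h + h ^ 2 * r lam h).
Proof.
intros Hh0 HB HE.
set (ok := fun lam h r => Rabs r <= B + 1 /\ (E lam h <-> exists k : Z, I lam = (IZR k + s) * PI * h + h ^ 2 * r)).
assert (H : forall lam h, lam0 - delta <= lam <= lam0 + delta -> 0 < h <= h0 -> exists r, ok lam h r).
{ intros lam h Hl Hh; assert (Hh2 : 0 < h ^ 2) by (apply pow_lt; lra).
  destruct (Classical_Prop.classic (E lam h)) as [HEh|HEh].
  - destruct (HE lam h Hl Hh HEh) as [k Hk].
    exists ((I lam - (IZR k + s) * PI * h) / h ^ 2); split.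
    + rewrite Rabs_div; [|lra]. rewrite (Rabs_pos_eq (h ^ 2)); [|lra].
      apply Rle_trans with B; [|lra]. apply Rle_div_l; auto.
    + split; auto; intros _; exists k; field; lra.
  - destruct (Classical_Prop.classic (exists k : Z, I lam = (IZR k + s) * PI * h + h ^ 2 * 0)) as [[k Hk]|Hn].
    (* The value 0 would put a non-eigenvalue on the grid. With 1, a second grid point would have to
       lie at distance h^2, hence h would be an integer multiple of pi, which 0 < h <= 1
       excludes. *)
    + exists 1; split; [rewrite Rabs_R1; lra|split; [contradiction|]].
      intros [j Hj]; exfalso.
      assert (Eh : IZR (k - j) * PI = h).
      { rewrite minus_IZR; apply Rmult_eq_reg_r with h; [|lra]; lra. }
      pose proof PI2_1 as HP.
      destruct (Z_le_gt_dec (k - j) 0) as [Hz|Hz].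
      * apply IZR_le in Hz; assert (IZR (k - j) * PI <= 0 * PI) by (apply Rmult_le_compat_r; lra). lra.
      * assert (1 <= IZR (k - j)) by (apply (IZR_le 1); lia).
        assert (1 * PI <= IZR (k - j) * PI) by (apply Rmult_le_compat_r; lra). lra.
    + exists 0; split; [rewrite Rabs_R0; lra|split; contradiction]. }
exists (fun lam h => epsilon (inhabits 0) (ok lam h)); split.
- exists (B + 1); intros lam h Hl Hh.
  apply (epsilon_spec (inhabits 0) (ok lam h) (H lam h Hl Hh)).
- intros h lam Hh Hl; apply (epsilon_spec (inhabits 0) (ok lam h) (H lam h Hl Hh)).
Qed.

Theorem theorem1p1 (A : R -> R) (lambda0 alpha0 beta0 : R)
  (hA : assumption_A1 A lambda0 alpha0 beta0) :
  (A alpha0 = A beta0 ->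
    exists (delta h0 : R) (r_plus : R -> R -> R),
      0 < delta /\ 0 < h0 /\ bounded_on_box lambda0 delta h0 r_plus /\
      forall h lambda : R, 0 < h <= h0 ->
        lambda0 - delta <= lambda <= lambda0 + delta ->
        (ZS_eigenvalue h A lambda <->
         exists k : Z,
           action_integral A lambda = (IZR k + 1 / 2) * PI * h + h ^ 2 * r_plus lambda h))
  /\
  (A alpha0 = - A beta0 ->
    exists (delta h0 : R) (r_minus : R -> R -> R),
      0 < delta /\ 0 < h0 /\ bounded_on_box lambda0 delta h0 r_minus /\
      forall h lambda : R, 0 < h <= h0 ->
        lambda0 - delta <= lambda <= lambda0 + delta ->
        (ZS_eigenvalue h A lambda <->
         exists k : Z,
           action_integral A lambda = IZR k * PI * h + h ^ 2 * r_minus lambda h)).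
Proof.
destruct (eigenvalue_phase A lambda0 alpha0 beta0 hA) as (delta & h0 & C & Hd & Hh0 & HC & H).
(* Multiplication by h turns the phase error O(h) into O(h^2). The shift s is -1/2 for the cosine
   condition and 0 for the sine condition. *)
assert (scale : forall (I h : R) (k : Z) s, 0 < h -> Rabs (I / h + s * PI - IZR k * PI) <= 4 * (C * h) ->
   Rabs (I - (IZR k + - s) * PI * h) <= 4 * C * h ^ 2).
{ intros I h k s Hh Hk.
  replace (I - (IZR k + - s) * PI * h) with (h * (I / h + s * PI - IZR k * PI)) by (field; lra).
  rewrite Rabs_mult (Rabs_pos_eq h); [|lra].
  replace (4 * C * h ^ 2) with (h * (4 * (C * h))) by ring; apply Rmult_le_compat_l; lra. }
split; intros HE.
- destruct (remainder_exists (fun lam h => ZS_eigenvalue h A lam) (action_integral A) (1 / 2) lambda0 delta h0 (4 * C))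
    as (r & Hr & Hiff); try lra.
  { intros lam h Hl Hh Heig; destruct (H lam h Hl Hh Heig) as [Hcos _]; specialize (Hcos HE).
    destruct (sin_near_zero (action_integral A lam / h + - (1 / 2) * PI) (C * h)) as [k Hk].
    - replace (action_integral A lam / h + - (1 / 2) * PI) with (- (PI / 2 - action_integral A lam / h)) by (field; lra).
      rewrite sin_neg Rabs_Ropp sin_shift; auto.
    - exists k; pose proof (scale _ h k _ ltac:(lra) Hk) as S; rewrite Ropp_involutive in S; exact S. }
  exists delta, h0, r; split; [lra|split; [lra|split; [exact Hr|exact Hiff]]].
- destruct (remainder_exists (fun lam h => ZS_eigenvalue h A lam) (action_integral A) 0 lambda0 delta h0 (4 * C))
    as (r & Hr & Hiff); try lra.
  { intros lam h Hl Hh Heig; destruct (H lam h Hl Hh Heig) as [_ Hsin]; specialize (Hsin HE).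
    destruct (sin_near_zero (action_integral A lam / h) (C * h) Hsin) as [k Hk]; exists k.
    rewrite -Ropp_0; apply scale; auto; [lra|].
    replace (action_integral A lam / h + 0 * PI - IZR k * PI) with (action_integral A lam / h - IZR k * PI) by ring; auto. }
  exists delta, h0, r; split; [lra|split; [lra|split; [auto|]]].
  intros h lam Hh Hl; rewrite (Hiff h lam Hh Hl).
  split; intros [k Hk]; exists k; rewrite Hk; ring.
Qed.
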